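(* Let $\{X_k\}_{k\ge0}$ be an irreducible, aperiodic, finite-state Markov chain with invariant distribution $\pi$, let $A$ be a $d\times d$-matrix-valued function and $b$ an $\mathbb R^d$-valued function on the state space, and let $\bar A:=E_{X\sim\pi}(A(X))$, $\bar b:=E_{X\sim\pi}(b(X))$. Suppose $-\bar A$ is Hurwitz, i.e. all its eigenvalues have strictly negative real parts. Consider the TD-learning recursion $$\theta_{k+1}=\theta_k-\epsilon_k\bigl(A(X_k)\theta_k+b(X_k)\bigr),\qquad k\ge0,$$ with $\theta_0\in\mathbb R^d$ a fixed vector and step sizes $$\epsilon_k=(k+1)^{-\delta},\qquad\delta\in(1/2,1).$$ Let $\theta^*$ be defined by $\bar A\theta^*+\bar b=0$, let $\bar\theta_n=\frac1n\sum_{k=1}^n\theta_k$, and let $\Sigma_\infty$ be the matrix defined in the context. Suppose $\Sigma_\infty\succ0$. Then, for $Z\sim N(0,I)$ in $\mathbb R^d$, as $n\to\infty$, $$d_{\mathcal W}\Bigl(\sqrt n(\bar\theta_n-\theta^* ),\ (\bar A^{-1}\Sigma_\infty\bar A^{-T})^{1/2}Z\Bigr)=O\left(\max\left\{\frac{\sqrt{\log n}}{n^{\delta-1/2}},\ \frac1{n^{(1-\delta)/2}}\right\}\right).$$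
   Context: The Markov chain is time-homogeneous with transition matrix $P$ and arbitrary initial distribution; $Pf(x)=E[f(X_1)\mid X_0=x]$. $\bar A^{-T}$ denotes $(\bar A^{-1})^\top$. The Wasserstein distance is $d_{\mathcal W}(X,Y)=\sup_{h\in Lip_1}E[h(X)-h(Y)]$, where $Lip_1$ is the set of functions $h:\mathbb R^d\to\mathbb R$ with $|h(x)-h(y)|\le\|x-y\|$ (Euclidean norm). Define the centered TD noise $r_{\rm TD}(x):=(A(x)-\bar A)\theta^*+(b(x)-\bar b)$, which satisfies $\pi r_{\rm TD}=0$. Let $V_{\rm TD}$ solve the Poisson equation $V_{\rm TD}-PV_{\rm TD}=r_{\rm TD}$, and define $$m_{k+1}:=V_{\rm TD}(X_{k+1})-E[V_{\rm TD}(X_{k+1})\mid X_k],\qquad\Sigma_\infty:=E_\pi[m_1m_1^\top],$$ where $E_\pi$ is expectation when $X_0\sim\pi$. The constant implied by $O(\cdot)$ does not depend on $n$ (it may depend on all other data, including $\delta$). *)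

(* Defs.v *)
From mathcomp Require Import all_boot all_order all_algebra.
From mathcomp Require Import all_classical all_reals all_analysis.
From mathcomp Require Import complex.

Set Implicit Arguments.
Unset Strict Implicit.
Unset Printing Implicit Defensive.

Import Order.TTheory GRing.Theory Num.Theory.
Import numFieldNormedType.Exports.
Local Open Scope classical_set_scope.
Local Open Scope ring_scope.

Definition stochastic (R : realType) (S : finType) (p : S -> S -> R) : Prop :=
  (forall x y, 0 <= p x y) /\ (forall x, \sum_y p x y = 1).

(* (Pf)(x) = E[f(X_1) | X_0 = x] *)
Definition Pop (R : realType) (S : finType) (V : lmodType R)
    (p : S -> S -> R) (f : S -> V) (x : S) : V :=
  \sum_y p x y *: f y.

(* P^n(x, y), i.e. P^n applied to the indicator function of y *)
Definition nstep (R : realType) (S : finType) (p : S -> S -> R) (n : nat)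
    (x y : S) : R :=
  iter n (@Pop R S R^o p) (fun z => (z == y)%:R) x.

Definition irreducible_chain (R : realType) (S : finType) (p : S -> S -> R)
    : Prop :=
  forall x y, exists n, 0 < nstep p n x y.

(* gcd {n >= 1 | P^n(x, x) > 0} = 1 for every x; the gcd of this possibly
   infinite set is expressed through its common divisors. *)
Definition aperiodic_chain (R : realType) (S : finType) (p : S -> S -> R)
    : Prop :=
  forall x (g : nat),
    (forall n, (0 < n)%N -> 0 < nstep p n x x -> (g %| n)%N) -> g = 1%N.

Definition invariant_distribution (R : realType) (S : finType)
    (p : S -> S -> R) (pi : S -> R) : Prop :=
  [/\ forall x, 0 <= pi x, \sum_x pi x = 1
    & forall y, \sum_x pi x * p x y = pi y].

(* The Markov property is P(X_0 = s_0, .., X_{n+1} = s_{n+1})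
   = P(X_0 = s_0, .., X_n = s_n) p(s_n, s_{n+1}), which avoids conditioning on
   null events; the law of X_0 is unconstrained. *)
Definition markov_chain (R : realType) (S : finType) (p : S -> S -> R)
    (dO : measure_display) (Omega : measurableType dO)
    (Pr : probability Omega R) (X : nat -> Omega -> S) : Prop :=
  (forall k x, measurable (X k @^-1` [set x])) /\
  (forall n (s : nat -> S),
    Pr [set w | forall k, (k <= n.+1)%N -> X k w = s k] =
    (Pr [set w | forall k, (k <= n)%N -> X k w = s k] *
     (p (s n) (s n.+1))%:E)%E).

(* E_{X ~ pi} f(X) *)
Definition mean (R : realType) (S : finType) (V : lmodType R)
    (pi : S -> R) (f : S -> V) : V :=
  \sum_x pi x *: f x.

(* E_pi f(X_0, X_1) for the chain with X_0 ~ pi *)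
Definition mean2 (R : realType) (S : finType) (V : lmodType R)
    (pi : S -> R) (p : S -> S -> R) (f : S -> S -> V) : V :=
  mean pi (fun x => Pop p (f x) x).

Definition hurwitz (R : realType) (d : nat) (M : 'M[R]_d) : Prop :=
  forall z : R[i], eigenvalue (map_mx (real_complex R) M) z -> complex.Re z < 0.

Definition posdef (R : realType) (d : nat) (M : 'M[R]_d) : Prop :=
  M^T = M /\ forall u : 'cV[R]_d, u != 0 -> 0 < (u^T *m M *m u) 0 0.

Definition possemidef (R : realType) (d : nat) (M : 'M[R]_d) : Prop :=
  M^T = M /\ forall u : 'cV[R]_d, 0 <= (u^T *m M *m u) 0 0.

(* M^{1/2}: the positive semidefinite square root (unique when it exists, which
   is the case iff M is positive semidefinite; the default value is 0). *)
Definition sqrtmx (R : realType) (d : nat) (M : 'M[R]_d) : 'M[R]_d :=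
  xget 0 [set G | possemidef G /\ G *m G = M].

(* The canonical norm `|_| on matrices is the sup norm, hence this one. *)
Definition enorm (R : realType) (d : nat) (u : 'cV[R]_d) : R :=
  Num.sqrt (\sum_i u i 0 ^+ 2).

Definition Lip1 (R : realType) (d : nat) : set ('cV[R]_d -> R) :=
  [set h | forall x y, `|h x - h y| <= enorm (x - y)].

(* X and Y may live on different probability spaces, hence the difference of
   expectations for E[h(X) - h(Y)]. *)
Definition wasserstein (R : realType) (d : nat)
    (d1 : measure_display) (T1 : measurableType d1) (P1 : probability T1 R)
    (X : T1 -> 'cV[R]_d)
    (d2 : measure_display) (T2 : measurableType d2) (P2 : probability T2 R)
    (Y : T2 -> 'cV[R]_d) : \bar R :=
  ereal_sup [set ('E_P1[h \o X] - 'E_P2[h \o Y])%E | h in @Lip1 R d].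

(* Z ~ N(0, I): the coordinates are independent N(0, 1), i.e. the law of Z
   agrees with the product measure on measurable rectangles. *)
Definition std_gaussian (R : realType) (d : nat)
    (dO : measure_display) (T : measurableType dO) (Q : probability T R)
    (Z : T -> 'cV[R]_d) : Prop :=
  (forall i, measurable_fun [set: T] (fun w => Z w i 0)) /\
  (forall B : 'I_d -> set R, (forall i, measurable (B i)) ->
    Q [set w | forall i, B i (Z w i 0)] =
    (\prod_(i < d) normal_prob 0 1 (B i))%E).

(* theta_k along the state path x_0, x_1, .. *)
Fixpoint td_iterate (R : realType) (S : finType) (d : nat)
    (A : S -> 'M[R]_d) (b : S -> 'cV[R]_d) (eps : nat -> R)
    (theta0 : 'cV[R]_d) (x : nat -> S) (k : nat) : 'cV[R]_d :=
  if k is j.+1 then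
    let theta := td_iterate A b eps theta0 x j in
    theta - eps j *: (A (x j) *m theta + b (x j))
  else theta0.

Definition td_average (R : realType) (S : finType) (d : nat)
    (A : S -> 'M[R]_d) (b : S -> 'cV[R]_d) (eps : nat -> R)
    (theta0 : 'cV[R]_d) (x : nat -> S) (n : nat) : 'cV[R]_d :=
  n%:R^-1 *: \sum_(1 <= k < n.+1) td_iterate A b eps theta0 x k.

Definition td_noise (R : realType) (S : finType) (d : nat) (pi : S -> R)
    (A : S -> 'M[R]_d) (b : S -> 'cV[R]_d) (thetas : 'cV[R]_d) (x : S)
    : 'cV[R]_d :=
  (A x - mean pi A) *m thetas + (b x - mean pi b).

Definition poisson_solution (R : realType) (S : finType) (d : nat)
    (p : S -> S -> R) (r V : S -> 'cV[R]_d) : Prop :=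
  forall x, V x - Pop p V x = r x.

(* m_{k+1} = V(X_{k+1}) - E[V(X_{k+1}) | X_k] as a function of
   (X_k, X_{k+1}) = (x, y) *)
Definition mart_diff (R : realType) (S : finType) (d : nat)
    (p : S -> S -> R) (V : S -> 'cV[R]_d) (x y : S) : 'cV[R]_d :=
  V y - Pop p V x.

Definition Sigma_infty (R : realType) (S : finType) (d : nat) (pi : S -> R)
    (p : S -> S -> R) (V : S -> 'cV[R]_d) : 'M[R]_d :=
  mean2 pi p (fun x y => mart_diff p V x y *m (mart_diff p V x y)^T).

(* Main.v *)
(* Write D_k = theta_k - thetas. The recursion turns Abar D_k into
   (D_k - D_{k+1}) / eps_k plus the noise, and Poisson equations turn the noise
   into martingale increments and telescoping terms. After Abel summation,
   sqrt n (average of D_1, .., D_n) is - Abar^{-1} n^{-1/2} sum_k m_{k+1} up to an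
   error controlled by E|D_k|^2 = O(eps_k). That bound follows from a quadratic
   Lyapunov function of Abar, again corrected by a Poisson equation.
   The normalized martingale is compared with the Gaussian at the rate n^{-1/6},
   which never exceeds the claimed rate. A Lipschitz test function is smoothed at
   scale n^{-1/6}; Lindeberg's exchange replaces the martingale increments by
   Rademacher steps along the columns of the square root of the limit covariance,
   with the fluctuation of the conditional covariance removed by one more Poisson
   equation; finally Rademacher steps are exchanged for Gaussian ones, coordinate
   by coordinate. *)

Require Import Defs.
From mathcomp Require Import all_boot all_order all_algebra.
From mathcomp Require Import all_classical all_reals all_analysis.
From mathcomp Require Import complex measurable_realfun.
From mathcomp Require Import ring lra.
Set Implicit Arguments.
Unset Strict Implicit.
Unset Printing Implicit Defensive.
Import Order.TTheory GRing.Theory Num.Theory.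
Import numFieldNormedType.Exports.
Local Open Scope classical_set_scope.
Local Open Scope ring_scope.

                                              

(** * Path expectations as finite sums, and the law of the chain *)

Section PathExpectation.
Variables (R : realType) (S : finType) (p : S -> S -> R) (mu : S -> R).
Hypothesis p_st : stochastic p.
Hypothesis mu_ge0 : forall x, 0 <= mu x.
Hypothesis mu_sum1 : \sum_x mu x = 1.

(** Up to a given time there are finitely many paths, so expectations over the chain become iterated
    finite sums. The test function is an arbitrary Lipschitz function, and the Gaussian vector is
    known only through its law on rectangles. Vector analysis is therefore reduced to finite sums as
    well: smoothing uses a tensor spline with finitely many nodes, Gaussian averages are limits of
    finite quadratures, and derivatives occur only as coefficients of a Taylor bound, a form that
    averaging over translates preserves. Every constant is uniform in the test function, because a
    supremum over it is taken at the end. Smoothing at scale [sg] costs order [sg] and leaves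
    third-order remainders of order sg^(-2). The n steps of size n^(-1/2) then cost n^(-1/2) / sg^2,
    and both costs balance at sg = n^(-1/6). The two exponents of the claimed rate, 1/2 - delta and
    (delta - 1)/2, cross at delta = 2/3, where both equal -1/6; their maximum is never smaller. *)

Definition upd (x : nat -> S) (j : nat) (y : S) : nat -> S :=
  fun i => if i == j then y else x i.

                                                                       
                                
(** Defined for every functional, without measurability or integrability. Coordinates beyond [k]
    carry the dummy value of the initial state, so the number is the intended expectation when [phi]
    is adapted at time [k]. *)
Fixpoint EP (k : nat) (phi : (nat -> S) -> R) : R :=
  if k is j.+1 then
    EP j (fun x => \sum_y p (x j) y * phi (upd x j.+1 y))
  else \sum_x mu x * phi (fun=> x).

Definition adapted (T : Type) (k : nat) (phi : (nat -> S) -> T) : Prop :=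
  forall x y, (forall j, (j <= k)%N -> x j = y j) -> phi x = phi y.

Lemma EP_ext k phi psi : (forall x, phi x = psi x) -> EP k phi = EP k psi.
Proof. by move=> /funext ->. Qed.

Lemma EPD k phi psi :
  EP k (fun x => phi x + psi x) = EP k phi + EP k psi.
Proof.
elim: k phi psi => [|k IH] phi psi /=.
  by rewrite -big_split; apply: eq_bigr => x _; rewrite mulrDr.
rewrite -IH; apply: EP_ext => x; rewrite -big_split.
by apply: eq_bigr => y _; rewrite mulrDr.
Qed.

Lemma EPZ k c phi : EP k (fun x => c * phi x) = c * EP k phi.
Proof.
elim: k phi => [|k IH] phi /=.
  by rewrite big_distrr; apply: eq_bigr => x _ /=; rewrite mulrCA.
rewrite -IH; apply: EP_ext => x; rewrite big_distrr.
by apply: eq_bigr => y _ /=; rewrite mulrCA.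
Qed.

Lemma EPN k phi : EP k (fun x => - phi x) = - EP k phi.
Proof. by rewrite -mulN1r -EPZ; apply: EP_ext => x; rewrite mulN1r. Qed.

Lemma EPB k phi psi :
  EP k (fun x => phi x - psi x) = EP k phi - EP k psi.
Proof. by rewrite EPD EPN. Qed.

Lemma EP0 k : EP k (fun=> 0) = 0.
Proof. by rewrite -[RHS](mul0r (EP k (fun=> 0))) -EPZ; apply: EP_ext => x; rewrite mul0r. Qed.

Lemma EP_sum (I : Type) (r : seq I) k (phi : I -> (nat -> S) -> R) :
  EP k (fun x => \sum_(i <- r) phi i x) = \sum_(i <- r) EP k (phi i).
Proof.
elim: r => [|i r IH].
  by rewrite big_nil -[RHS](EP0 k); apply: EP_ext => x; rewrite big_nil.
by rewrite big_cons -IH -EPD; apply: EP_ext => x; rewrite big_cons.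
Qed.

Lemma EP_cst k c : EP k (fun=> c) = c.
Proof.
elim: k => [|k IH] /=; first by rewrite -big_distrl /= mu_sum1 mul1r.
rewrite -[RHS]IH; apply: EP_ext => x.
by rewrite -big_distrl /= (p_st.2 _) mul1r.
Qed.

Lemma EP_le k phi psi : (forall x, phi x <= psi x) -> EP k phi <= EP k psi.
Proof.
elim: k phi psi => [|k IH] phi psi H /=.
  by apply: ler_sum => x _; rewrite ler_wpM2l.
by apply: IH => x; apply: ler_sum => y _; rewrite ler_wpM2l // (p_st.1 _).
Qed.

Lemma EP_ge0 k phi : (forall x, 0 <= phi x) -> 0 <= EP k phi.
Proof. by move=> H; rewrite -(EP0 k); apply: EP_le. Qed.

Lemma EP_abs k phi : `|EP k phi| <= EP k (fun x => `|phi x|).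
Proof.
rewrite ler_norml -EPN; apply/andP; split; apply: EP_le => x; last exact: ler_norm.
by rewrite lerNl -normrN ler_norm.
Qed.

(** Jensen's inequality, as nonnegativity of the variance. *)
Lemma EP_sqr k phi : (EP k phi) ^+ 2 <= EP k (fun x => phi x ^+ 2).
Proof.
have := @EP_ge0 k (fun x => (phi x - EP k phi) ^+ 2) (fun x => sqr_ge0 _).
rewrite (@EP_ext k _ (fun x => phi x ^+ 2 + ((-2 * EP k phi) * phi x + EP k phi ^+ 2))); last first.
  by move=> x; ring.
rewrite !EPD EPZ EP_cst; set e := EP k phi; lra.
Qed.

Lemma EP_tower k n phi : (k <= n)%N -> adapted k phi -> EP n phi = EP k phi.
Proof.
elim: n => [|n IH]; first by rewrite leqn0 => /eqP ->.
rewrite leq_eqVlt => /orP[/eqP-> //|]; rewrite ltnS => kn ad.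
rewrite -(IH kn ad) /=; apply: EP_ext => x.
rewrite -[RHS]mul1r -(p_st.2 (x n)) big_distrl /=; apply: eq_bigr => y _.
congr (_ * _); apply: ad => j jk; rewrite /upd.
by case: eqP => // jn; have := leq_trans jk kn; rewrite jn ltnn.
Qed.

(** Conditioning on the states up to time [k]. The next state is a separate argument of [psi], so
    that adaptedness at time [k] can be required of the rest. *)
Lemma EP_markov k n (psi : (nat -> S) -> S -> R) : (k < n)%N ->
  (forall y, adapted k (psi^~ y)) ->
  EP n (fun x => psi x (x k.+1)) = EP n (fun x => \sum_y p (x k) y * psi x y).
Proof.
move=> kn ad.
rewrite (EP_tower kn); last first.
  move=> x y xy; rewrite xy //.
  by apply: ad => j jk; apply: xy; rewrite leqW.
rewrite (@EP_tower k n) ?(ltnW kn) //; last first.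
  move=> x y xy; apply: eq_bigr => z _; rewrite xy //; congr (_ * _).
  exact: ad.
rewrite /=; apply: EP_ext => x; apply: eq_bigr => y _; congr (_ * _).
rewrite {2}/upd eqxx; apply: ad => j jk; rewrite /upd.
by case: eqP => // jn; move: jk; rewrite jn ltnn.
Qed.

End PathExpectation.

Section PathLaw.
Context {R : realType} {S : finType} (p : S -> S -> R).
Context {dO : measure_display} {Omega : measurableType dO}
  (Pr : probability Omega R) (X : nat -> Omega -> S).
Hypothesis p_st : stochastic p.
Hypothesis X_mc : markov_chain p Pr X.

Let cyl k (s : nat -> S) := [set w | forall j, (j <= k)%N -> X j w = s j].

Lemma measurable_cyl k s : measurable (cyl k s).
Proof.
elim: k => [|k IH].
  rewrite (_ : cyl 0 s = X 0 @^-1` [set s 0%N]); first exact: X_mc.1.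
  apply/seteqP; split=> w /=; first by apply.
  by move=> H j; rewrite leqn0 => /eqP ->.
rewrite (_ : cyl k.+1 s = cyl k s `&` X k.+1 @^-1` [set s k.+1]).
  by apply: measurableI => //; exact: X_mc.1.
apply/seteqP; split=> w /=.
  by move=> H; split => [j jk|]; apply: H; rewrite // leqW.
by move=> [H1 H2] j; rewrite leq_eqVlt => /orP[/eqP -> //|]; rewrite ltnS; exact: H1.
Qed.

Definition init_law (x : S) : R := fine (Pr (X 0 @^-1` [set x])).

Lemma init_law_ge0 x : 0 <= init_law x.
Proof. by rewrite fine_ge0. Qed.

Let ind k (s x : nat -> S) : R := ([forall j : 'I_k.+1, x j == s j])%:R.

Lemma ind_cyl k s w : ind k s (X^~ w) = \1_(cyl k s) w.
Proof.
rewrite indicE /ind; congr (_%:R); congr nat_of_bool; apply/forallP/idP.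
  move=> H; apply/mem_set => j jk; apply/eqP.
  by have := H (Ordinal (jk : (j < k.+1)%N)).
by move=> /set_mem H j; apply/eqP/H; rewrite -ltnS.
Qed.

(** The Markov property in product form is the recursion of [EP] on cylinder indicators, so both
    sides agree by induction from the initial law. *)
Lemma pr_cyl k s : Pr (cyl k s) = (EP p init_law k (ind k s))%:E.
Proof.
elim: k => [|k IH].
  rewrite /= (bigD1 (s 0%N)) //= big1 ?addr0; last first.
    move=> x xs; rewrite /ind; case: forallP => [H|]; last by rewrite mulr0.
    by have := H ord0; rewrite (negPf xs).
  rewrite /ind (_ : [forall _, _] = true) ?mulr1; last first.
    by apply/forallP => j; rewrite ord1.
  rewrite /init_law fineK ?fin_num_measure//; last exact: X_mc.1.
  congr (Pr _); apply/seteqP; split=> w /=; first by apply.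
  by move=> H j; rewrite leqn0 => /eqP ->.
rewrite X_mc.2 -/(cyl k s) IH -EFinM; congr EFin.
rewrite mulrC -EPZ /=; apply: EP_ext => x.
rewrite (bigD1 (s k.+1)) //= [X in _ = _ + X]big1 ?addr0; last first.
  move=> y ys; rewrite /ind; case: forallP => [H|]; last by rewrite mulr0.
  by have := H ord_max; rewrite /upd /= eqxx (negPf ys).
rewrite /ind; case: forallP => [H|H].
  have -> : x k = s k by apply/eqP/(H ord_max).
  congr (_ * _%:R); apply/esym; case: forallP => // -[] j.
  rewrite /upd; have [-> //|jk] := eqVneq (nat_of_ord j) k.+1.
  have jk' : (j < k.+1)%N by rewrite ltn_neqAle jk -ltnS ltn_ord.
  exact: (H (Ordinal jk')).
rewrite mulr0; case: forallP => [H1|]; last by rewrite mulr0.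
case: H => j; have := H1 (widen_ord (leqnSn _) j).
by rewrite /upd /= ltn_eqF.
Qed.

Let ext k (s : {ffun 'I_k.+1 -> S}) : nat -> S := fun j => s (inord j).

(** There are finitely many words of length [k.+1], so an adapted functional is a finite combination
    of cylinder indicators. This makes it integrable whatever its values are. *)
Lemma adapted_decomp k (phi : (nat -> S) -> R) x : adapted k phi ->
  phi x = \sum_(s : {ffun 'I_k.+1 -> S}) phi (ext s) * ind k (ext s) x.
Proof.
move=> ad; pose s0 : {ffun 'I_k.+1 -> S} := [ffun j : 'I_k.+1 => x j].
have s0E j : (j <= k)%N -> x j = ext s0 j.
  by move=> jk; rewrite /ext ffunE inordK.
rewrite (bigD1 s0) //= big1 ?addr0.
  rewrite /ind (_ : [forall _, _] = true) ?mulr1; first exact: ad.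
  by apply/forallP => j; apply/eqP/s0E; rewrite -ltnS.
move=> s ss0; rewrite /ind; case: forallP => [H|]; last by rewrite mulr0.
case/eqP: ss0; apply/ffunP => j; rewrite ffunE; apply/esym/eqP.
by have := H j; rewrite /ext inord_val.
Qed.

Lemma expectation_path k (phi : (nat -> S) -> R) : adapted k phi ->
  ('E_Pr[fun w => phi (X^~ w)] = (EP p init_law k phi)%:E)%E.
Proof.
move=> ad; rewrite unlock.
rewrite (_ : EP p init_law k phi = EP p init_law k (fun x =>
    \sum_(s : {ffun 'I_k.+1 -> S}) phi (ext s) * ind k (ext s) x)); last first.
  by apply: EP_ext => x; exact: adapted_decomp.
rewrite EP_sum -sumEFin.
transitivity (\int[Pr]_w (\sum_(s : {ffun 'I_k.+1 -> S}) (phi (ext s))%:E * (\1_(cyl k (ext s)) w)%:E))%E.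
  apply: eq_integral => w _; rewrite /= (adapted_decomp (X^~ w) ad) -sumEFin.
  by apply: eq_bigr => s _; rewrite ind_cyl EFinM.
have integ s : Pr.-integrable setT (fun w => (phi (ext s))%:E * (\1_(cyl k (ext s)) w)%:E)%E.
  apply: integrableZl => //; apply: integrable_indic => //.
  exact: measurable_cyl.
rewrite integral_sum //; apply: eq_bigr => s _.
rewrite integralZl //; last first.
  by apply: integrable_indic => //; exact: measurable_cyl.
rewrite integral_indic //; last exact: measurable_cyl.
by rewrite setIT EPZ EFinM; congr (_ * _)%E; exact: pr_cyl.
Qed.

Lemma init_law_sum1 : \sum_x init_law x = 1.
Proof.
have := @expectation_path 0 (fun=> 1) (fun _ _ _ => erefl).
rewrite expectation_cst /= => -[].
by rewrite (eq_bigr init_law) => // x _; rewrite mulr1.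
Qed.

End PathLaw.

                             

(** * Solvability of the Poisson equation *)

Section PoissonEquation.
Variables (R : realType) (S : finType) (p : S -> S -> R) (pi : S -> R).
Hypothesis p_st : stochastic p.
Hypothesis p_irr : irreducible_chain p.
Hypothesis pi_inv : invariant_distribution p pi.

Lemma nstepS n x y : nstep p n.+1 x y = \sum_z p x z * nstep p n z y.
Proof. by rewrite /nstep iterS. Qed.

Lemma nstep_ge0 n x y : 0 <= nstep p n x y.
Proof.
elim: n x => [|n IH] x; first by rewrite /nstep /= ler0n.
by rewrite nstepS sumr_ge0 // => z _; rewrite mulr_ge0 // p_st.1.
Qed.

Lemma harmonic_nstep (u : S -> R) n x : (forall x, \sum_y p x y * u y = u x) ->
  \sum_y nstep p n x y * u y = u x.
Proof.
move=> hu; elim: n x => [|n IH] x.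
  rewrite (bigD1 x) //= big1 ?addr0 /nstep /= ?eqxx ?mul1r //.
  by move=> y /negPf xy; rewrite eq_sym xy mul0r.
rewrite -[RHS]hu.
under eq_bigr do rewrite nstepS big_distrl /=.
rewrite exchange_big; apply: eq_bigr => z _ /=.
by rewrite -(IH z) big_distrr; apply: eq_bigr => y _ /=; rewrite mulrA.
Qed.

(** Maximum principle: at a maximum point [x0] the n-step average of [u x0 - u] is zero with
    nonnegative terms, and irreducibility gives positive weight to any chosen state for some [n]. *)
Lemma harmonic_const (u : S -> R) : (forall x, \sum_y p x y * u y = u x) ->
  forall x y, u x = u y.
Proof.
move=> hu x y.
have [x0 x0max] : exists x0, forall z, u z <= u x0.
  by case: (Order.TotalTheory.arg_maxP u (erefl : xpredT x)) => x0 _ H; exists x0 => z; exact: H.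
suff H z : u z = u x0 by rewrite !H.
have [n n_gt0] := p_irr x0 z.
have one v : \sum_y p v y * (fun=> 1 : R) y = 1.
  by rewrite -[RHS](p_st.2 v); apply: eq_bigr => w _; rewrite mulr1.
have sum0 : \sum_y nstep p n x0 y * (u x0 - u y) = 0.
  under eq_bigr do rewrite mulrBr.
  rewrite sumrB (harmonic_nstep n x0 hu) -big_distrl /=.
  have -> : \sum_y nstep p n x0 y = 1.
    by rewrite -[RHS](harmonic_nstep n x0 one); apply: eq_bigr => v _; rewrite mulr1.
  by rewrite mul1r subrr.
have nn v : true -> 0 <= nstep p n x0 v * (u x0 - u v).
  by move=> _; rewrite mulr_ge0 ?nstep_ge0 // subr_ge0.
have H := psumr_eq0P nn sum0; move: (H z isT).
by move/eqP; rewrite mulf_eq0 gt_eqF //= subr_eq0 => /eqP.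
Qed.

(** Fredholm alternative by counting dimensions: the kernel of I - P consists of constants, so its
    range has codimension at most 1; the range lies in the hyperplane orthogonal to [pi], hence
    equals it. *)
Lemma poisson_exists (f : S -> R) : \sum_x pi x * f x = 0 ->
  exists U : S -> R, forall x, U x - \sum_y p x y * U y = f x.
Proof.
move=> pif; set n := #|S|.
(* Row vectors stand for functions, so [M] is the transpose of I - P and its row space is the range
   of I - P. *)
pose M : 'M[R]_n := \matrix_(i, j) ((i == j)%:R - p (enum_val j) (enum_val i)).
have ME (u : 'rV[R]_n) j :
    (u *m M) 0 j = u 0 j - \sum_i p (enum_val j) (enum_val i) * u 0 i.
  rewrite mxE; under eq_bigr do rewrite mxE mulrBr.
  rewrite sumrB; congr (_ - _); last by apply: eq_bigr => i _; rewrite mulrC.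
  by rewrite (bigD1 j) //= eqxx mulr1 big1 ?addr0 // => i /negPf ->; rewrite mulr0.
have reidx (g : S -> R) : \sum_y g y = \sum_(i < n) g (enum_val i).
  by rewrite (reindex (@enum_val S S)) //; exact: onW_bij (enum_val_bij S).
have kerM : (kermx M <= (const_mx 1 : 'rV[R]_n))%MS.
  apply/row_subP => k; have : row k (kermx M) *m M = 0.
    by rewrite -row_mul mulmx_ker row0.
  move: (row k _) => u uM.
  have hu x y : u 0 (enum_rank x) = u 0 (enum_rank y).
    apply: (harmonic_const (u := fun x => u 0 (enum_rank x))) => z.
    have := ME u (enum_rank z); rewrite uM mxE enum_rankK => /esym/subr0_eq ->.
    by rewrite reidx; apply: eq_bigr => i _; rewrite enum_valK.
  have [j _|n0] := pickP (fun _ : 'I_n => true); last first.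
    by apply/sub_rVP; exists 0; apply/rowP => i; have := n0 i.
  apply/sub_rVP; exists (u 0 j); apply/rowP => i; rewrite !mxE mulr1.
  by have := hu (enum_val i) (enum_val j); rewrite !enum_valK.
pose w : 'cV[R]_n := \col_j pi (enum_val j).
have Mw : M *m w = 0.
  apply/matrixP => i k; rewrite !mxE.
  under eq_bigr do rewrite !mxE mulrBl.
  rewrite sumrB; apply/eqP; rewrite subr_eq0; apply/eqP.
  case: pi_inv => _ _ /(_ (enum_val i)); rewrite reidx => h.
  rewrite (bigD1 i) //= eqxx mul1r big1 ?addr0; last first.
    by move=> j /negPf ji; rewrite eq_sym ji mul0r.
  by rewrite -h; apply: eq_bigr => j _; rewrite mulrC.
have w_neq0 : w != 0.
  apply/negP => /eqP w0; case: pi_inv => _ + _; rewrite reidx.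
  rewrite big1; first by move/eqP; rewrite eq_sym oner_eq0.
  by move=> i _; have := congr1 (fun v : 'cV_n => v i 0) w0; rewrite !mxE.
have rw : \rank w = 1%N.
  by apply/eqP; rewrite eqn_leq rank_leq_col lt0n mxrank_eq0.
have subMw : (M <= kermx w)%MS by apply/sub_kermxP.
have subwM : (kermx w <= M)%MS.
  rewrite -(mxrank_leqif_sup subMw).2 eqn_leq mxrankS //= mxrank_ker rw.
  have := mxrankS kerM; rewrite mxrank_ker => h.
  by rewrite leq_subCl (leq_trans h) // rank_leq_row.
pose fr : 'rV[R]_n := \row_j f (enum_val j).
have : (fr <= M)%MS.
  apply: submx_trans subwM; apply/sub_kermxP.
  apply/matrixP => i k; rewrite !mxE -[RHS]pif [in RHS]reidx.
  by apply: eq_bigr => j _; rewrite !mxE mulrC.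
case/submxP => u fru; exists (fun x => u 0 (enum_rank x)) => x.
have := ME u (enum_rank x); rewrite -fru !mxE enum_rankK => ->.
by congr (_ - _); rewrite reidx; apply: eq_bigr => i _; rewrite enum_valK.
Qed.

Lemma poisson_exists_mean (f : S -> R) :
  exists U : S -> R, forall x, U x - \sum_y p x y * U y = f x - mean pi (f : S -> R^o).
Proof.
apply: poisson_exists; under eq_bigr do rewrite mulrBr.
rewrite sumrB -big_distrl /=; case: pi_inv => _ -> _.
by rewrite mul1r subrr.
Qed.

End PoissonEquation.

                                            

(** * Positive semidefinite square roots and the Lyapunov function *)

Section ComplexMatrices.
Variable R : realType.

(** Schur triangularization and the spectral theorem are applied over [R[i]]; splitting into real
    and imaginary parts brings their conclusions back to real matrices. *)
Definition remx m n (M : 'M[R[i]]_(m, n)) : 'M[R]_(m, n) := map_mx (@complex.Re R) M.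
Definition immx m n (M : 'M[R[i]]_(m, n)) : 'M[R]_(m, n) := map_mx (@complex.Im R) M.

Lemma Re_sum (I : Type) (r : seq I) (F : I -> R[i]) :
  complex.Re (\sum_(i <- r) F i) = \sum_(i <- r) complex.Re (F i).
Proof. by apply: (big_morph (@complex.Re R)) => //; case=> a b [a' b']. Qed.

Lemma Im_sum (I : Type) (r : seq I) (F : I -> R[i]) :
  complex.Im (\sum_(i <- r) F i) = \sum_(i <- r) complex.Im (F i).
Proof. by apply: (big_morph (@complex.Im R)) => //; case=> a b [a' b']. Qed.

Lemma remxM m n q (M : 'M[R[i]]_(m, n)) (N : 'M[R[i]]_(n, q)) :
  remx (M *m N) = remx M *m remx N - immx M *m immx N.
Proof.
apply/matrixP => i j; rewrite !mxE Re_sum -sumrB; apply: eq_bigr => k _.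
by rewrite !mxE; case: (M i k) => a b; case: (N k j) => c e.
Qed.

Lemma immxM m n q (M : 'M[R[i]]_(m, n)) (N : 'M[R[i]]_(n, q)) :
  immx (M *m N) = remx M *m immx N + immx M *m remx N.
Proof.
apply/matrixP => i j; rewrite !mxE Im_sum -big_split; apply: eq_bigr => k _.
by rewrite !mxE; case: (M i k) => a b; case: (N k j) => c e.
Qed.

Lemma remx_real m n (M : 'M[R]_(m, n)) : remx (map_mx (real_complex R) M) = M.
Proof. by apply/matrixP => i j; rewrite !mxE. Qed.

Lemma immx_real m n (M : 'M[R]_(m, n)) : immx (map_mx (real_complex R) M) = 0.
Proof. by apply/matrixP => i j; rewrite !mxE. Qed.

Lemma remx_adj m n (M : 'M[R[i]]_(m, n)) : remx (map_mx Num.conj M^T) = (remx M)^T.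
Proof. by apply/matrixP => i j; rewrite !mxE; case: (M j i). Qed.

Lemma immx_adj m n (M : 'M[R[i]]_(m, n)) : immx (map_mx Num.conj M^T) = - (immx M)^T.
Proof. by apply/matrixP => i j; rewrite !mxE; case: (M j i). Qed.

Lemma remx1 n : remx (1%:M : 'M[R[i]]_n) = 1%:M.
Proof. by apply/matrixP => i j; rewrite !mxE; case: (i == j). Qed.

(** Real parts of the two unitarity relations. The pair of real matrices then acts like an
    orthogonal change of basis. *)
Lemma unitary_re d (P : 'M[R[i]]_d) : P \is unitarymx ->
  ((remx P)^T *m remx P + (immx P)^T *m immx P = 1%:M) /\
  (remx P *m (remx P)^T + immx P *m (immx P)^T = 1%:M).
Proof.
move=> Pu; have H := unitarymxP Pu.
have H' := mulmx1C H.
split.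
  have := congr1 (@remx _ _) H'.
  by rewrite remxM remx_adj immx_adj remx1 mulNmx opprK.
have := congr1 (@remx _ _) H.
by rewrite remxM remx_adj immx_adj remx1 mulmxN opprK.
Qed.

End ComplexMatrices.

Section PsdSquareRoot.
Variables (R : realType) (d : nat) (M : 'M[R]_d).
Hypothesis M_psd : possemidef M.

Lemma interpolation (s : seq R) (f : R -> R) :
  exists q : {poly R}, forall x, x \in s -> q.[x] = f x.
Proof.
elim: s => [|y s [q Hq]]; first by exists 0.
have [ys|ys] := boolP (y \in s).
  by exists q => x; rewrite inE => /orP[/eqP->|]; exact: Hq.
pose r := \prod_(z <- s) ('X - z%:P).
have ry : r.[y] != 0.
  by rewrite -rootE root_prod_XsubC.
exists (q + ((f y - q.[y]) / r.[y])%:P * r) => x.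
rewrite !hornerE inE => /orP[/eqP ->|xs]; first by rewrite divfK // addrC subrK.
have /rootP -> : root r x by rewrite root_prod_XsubC.
by rewrite mulr0 addr0; exact: Hq.
Qed.

                                                                          
(** [N] is the polynomial [q] evaluated at [M]. It is real and symmetric whatever complex basis
    diagonalizes [M], and its spectral action is recorded on every real intertwiner [X] between [M]
    and a diagonal matrix. Commutation with [M] keeps the symmetry in the induction. *)
Lemma poly_mx (q : {poly R}) : exists N : 'M[R]_d, N^T = N /\ N *m M = M *m N /\
  forall (X : 'M[R]_d) (L : 'rV[R]_d), X *m M = diag_mx L *m X ->
    X *m N = diag_mx (map_mx (horner q) L) *m X.
Proof.
elim/poly_ind: q => [|q c [N [NT [NM HN]]]].
  exists 0; split; first by rewrite trmx0.
  split=> [|X L _]; first by rewrite mul0mx mulmx0.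
  rewrite mulmx0 (_ : map_mx _ _ = 0) ?raddf0 ?mul0mx //.
  by apply/rowP => i; rewrite !mxE horner0.
exists (N *m M + c%:M); split.
  by rewrite linearD /= trmx_mul tr_scalar_mx M_psd.1 NT NM.
split=> [|X L XM].
  by rewrite mulmxDl mulmxDr [M *m (N *m M)]mulmxA -NM scalar_mxC.
rewrite mulmxDr mulmxA (HN X L XM) -mulmxA XM mulmxA.
rewrite (_ : map_mx (horner (_ + _)) _ = \row_i (q.[L 0 i] * L 0 i + c)); last first.
  by apply/rowP => i; rewrite [LHS]mxE [RHS]mxE hornerMXaddC.
rewrite scalar_mxC -mulmxDl; congr (_ *m _).
apply/matrixP => k l; rewrite !mxE (bigD1 k) //= !mxE eqxx mulr1n big1.
  by case: (k == l); rewrite ?mulr0n ?mulr0 ?addr0 // mulr1n.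
by move=> m mk; rewrite !mxE eq_sym (negPf mk) mulr0n mul0r.
Qed.

(** The root is the polynomial in [M] that interpolates [Num.sqrt] on the spectrum. Its existence
    guarantees that [sqrtmx] picks a genuine root and not its default value. *)
Lemma possemidef_sqrt : exists G, possemidef G /\ G *m G = M.
Proof.
have [MT Mge0] := M_psd.
pose B := map_mx (real_complex R) M.
have Bherm : B \is hermsymmx.
  apply: realsym_hermsym.
    apply/is_hermitianmxP; rewrite expr0 scale1r; apply/matrixP => i j.
    by rewrite !mxE -{1}MT mxE.
  by apply/mxOverP => i j; rewrite mxE; apply/complex_realP; exists (M i j).
have /hermitian_normalmx/orthomx_spectralP := Bherm.
have := hermitian_spectral_diag_real Bherm.
have := spectral_unitarymx B.
move: (spectralmx B) (spectral_diag B) => P sp Pu spr BE.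
have PB : P *m B = diag_mx sp *m P.
  by rewrite BE !mulmxA mulmxV ?mul1mx // unitarymx_unit.
have [U1 U2] := unitary_re Pu.
pose L := remx sp.
have spE : diag_mx sp = map_mx (real_complex R) (diag_mx L).
  apply/matrixP => i j; rewrite !mxE; case: (i == j); rewrite ?mulr0n ?mulr1n //.
  by rewrite RRe_real //; move/mxOverP: spr; exact.
clearbody L.
have PrM : remx P *m M = diag_mx L *m remx P.
  have := congr1 (@remx _ _ _) PB.
  by rewrite !remxM spE !remx_real !immx_real mulmx0 mul0mx !subr0.
have PiM : immx P *m M = diag_mx L *m immx P.
  have := congr1 (@immx _ _ _) PB.
  by rewrite !immxM spE !remx_real !immx_real mulmx0 mul0mx add0r addr0.
move: (remx P) (immx P) U1 U2 PrM PiM => X Y U1 U2 XM YM.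
(* [L 0 i] times the squared length of row i of [X], and likewise of [Y], is a value of the
   quadratic form of [M]; the two squared lengths add up to 1. *)
have L_ge0 i : 0 <= L 0 i.
  have e (Z : 'M[R]_d) : Z *m M = diag_mx L *m Z ->
      0 <= L 0 i * (Z *m Z^T) i i.
    move=> ZM; have := Mge0 (row i Z)^T.
    rewrite trmxK -row_mul ZM.
    rewrite (_ : (_ *m _) 0 0 = (diag_mx L *m Z *m Z^T) i i); last first.
      by rewrite !mxE; apply: eq_bigr => k _; rewrite !mxE.
    by rewrite -mulmxA mul_diag_mx !mxE.
  have := addr_ge0 (e X XM) (e Y YM); rewrite -mulrDr.
  by have /matrixP/(_ i i) := U2; rewrite !mxE eqxx => ->; rewrite mulr1.
have [q qE] := interpolation [seq L 0 i | i <- enum 'I_d] Num.sqrt.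
have [N [NT [_ HN]]] := poly_mx q.
pose s := map_mx Num.sqrt L.
have sE : map_mx (horner q) L = s.
  apply/rowP => i; rewrite !mxE qE //; apply/mapP; exists i => //.
  by rewrite mem_enum.
have := HN _ _ YM; have := HN _ _ XM; rewrite sE => XN YN.
have ssL : diag_mx s *m diag_mx s = diag_mx L.
  apply/matrixP => i j; rewrite mul_diag_mx !mxE; case: (i == j).
    by rewrite !mulr1n -expr2 sqr_sqrtr.
  by rewrite !mulr0n mulr0.
exists N; split; first split=> // u; last first.
  have sq (Z : 'M[R]_d) : Z *m M = diag_mx L *m Z -> Z *m N = diag_mx s *m Z ->
      Z *m (N *m N) = Z *m M.
    by move=> ZM ZN; rewrite mulmxA ZN -mulmxA ZN mulmxA ssL ZM.
  rewrite -[LHS]mul1mx -[RHS]mul1mx -U1 !mulmxDl -!mulmxA.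
  by rewrite (sq _ XM XN) (sq _ YM YN).
have e (Z : 'M[R]_d) : 0 <= ((Z *m u)^T *m diag_mx s *m (Z *m u)) 0 0.
  rewrite -mulmxA mul_diag_mx !mxE sumr_ge0 // => k _; rewrite !mxE.
  by rewrite mulrCA mulr_ge0 ?sqrtr_ge0 // -expr2 sqr_ge0.
have -> : u^T *m N *m u = (X *m u)^T *m diag_mx s *m (X *m u)
    + (Y *m u)^T *m diag_mx s *m (Y *m u).
  rewrite !trmx_mul !mulmxA -[_ *m diag_mx s *m X]mulmxA -XN.
  rewrite -[_ *m diag_mx s *m Y]mulmxA -YN -mulmxDl; congr (_ *m u).
  rewrite -!mulmxA -mulmxDr; congr (_ *m _).
  by rewrite !mulmxA -mulmxDl U1 mul1mx.
by rewrite mxE addr_ge0.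
Qed.

End PsdSquareRoot.

Section Lyapunov.
Variables (R : realType) (d : nat).

Lemma trmulmxE (u v : 'cV[R]_d) : (u^T *m v) 0 0 = \sum_i u i 0 * v i 0.
Proof. by rewrite mxE; apply: eq_bigr => i _; rewrite mxE. Qed.

(** Schur form P A = C P with P = X + iY unitary and C = T + iW lower triangular. The diagonal of
    [T] holds the real parts of the eigenvalues of [A]. *)
Lemma schur_real (A : 'M[R]_d) : hurwitz (- A) ->
  exists (X Y T W : 'M[R]_d),
  [/\ X^T *m X + Y^T *m Y = 1%:M, X *m A = T *m X - W *m Y,
      Y *m A = T *m Y + W *m X,
      forall i j : 'I_d, (i < j)%N -> T i j = 0 /\ W i j = 0
    & forall i, 0 < T i i].
Proof.
move=> hA; have [d0|d_gt0] := posnP d.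
  have E (M N : 'M[R]_d) : M = N by apply/matrixP => -[i i0]; exfalso; rewrite d0 in i0.
  exists 0, 0, 0, 0; split=> [||||i]; try exact: E.
    by move=> i j; rewrite !mxE.
  by exfalso; case: i => i i0; rewrite d0 in i0.
pose B := map_mx (real_complex R) A.
have [P Pu] := Schur B d_gt0; rewrite /similar_to conjumx ?unitarymx_unit // => Ttrig.
set C := P *m B *m invmx P in Ttrig.
have PB : P *m B = C *m P by rewrite /C -mulmxA mulVmx ?mulmx1 // unitarymx_unit.
clearbody C; have [U1 _] := unitary_re Pu.
exists (remx P), (immx P), (remx C), (immx C); split=> //.
- have := congr1 (@remx _ _ _) PB.
  by rewrite !remxM remx_real immx_real mulmx0 subr0.
- have := congr1 (@immx _ _ _) PB.
  by rewrite !immxM remx_real immx_real mulmx0 add0r.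
- by move=> i j ij; rewrite !mxE; move/is_trig_mxP: Ttrig => ->.
move=> i; have : eigenvalue C (C i i).
  rewrite eigenvalue_root_char char_poly_trig // (bigD1 i) //=.
  by rewrite rootM root_XsubC eqxx.
case/eigenvalueP => v vC v0.
have : eigenvalue (map_mx (real_complex R) (- A)) (- C i i).
  apply/eigenvalueP; exists (v *m P).
    by rewrite map_mxN mulmxN -mulmxA PB mulmxA vC scaleNr scalemxAl.
  apply: contra v0 => /eqP vP0; apply/eqP.
  by rewrite -[v](mulmxK (unitarymx_unit Pu)) vP0 mul0mx.
by move/hA; rewrite mxE; case: (C i i) => a b /=; rewrite oppr_lt0.
Qed.

                                                                             
                                           
(** In Schur coordinates the form is diagonal with weights eta^(2i). By triangularity an
    off-diagonal entry couples i only to some j < i, and after weighting it carries a factor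
    eta^(i-j) <= eta. A small [eta] makes these terms negligible against the diagonal, whose real
    part is at least [t]. *)
Lemma lyapunov (A : 'M[R]_d) : hurwitz (- A) ->
  exists Q : 'M[R]_d, exists2 c : R, 0 < c & Q^T = Q /\ forall u : 'cV[R]_d,
    c * \sum_i u i 0 ^+ 2 <= (u^T *m Q *m u) 0 0 /\
    c * \sum_i u i 0 ^+ 2 <= (u^T *m Q *m (A *m u)) 0 0.
Proof.
move=> /schur_real[X [Y [T [W [U XA YA trig Tpos]]]]].
have [t t_gt0 tT] : exists2 t : R, 0 < t & forall i, t <= T i i.
  exists (\big[Num.min/1]_i T i i); last by move=> i; exact: bigmin_le_cond.
  by apply/bigmin_gtP; split => // i _; exact: Tpos.
pose K : R := \sum_i \sum_j (`|T i j| + `|W i j|).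
have K_ge0 : 0 <= K.
  by rewrite sumr_ge0 // => i _; rewrite sumr_ge0 // => j _; rewrite addr_ge0.
(* This yields [eta * K <= t / 4], with [K] the sum of all entries; the summand 1 keeps the
   denominator positive, and the cap at 1 makes the powers of [eta] decreasing. *)
pose eta := Num.min 1 (t / (4 * (K + 1))).
have K1 : 0 < 4 * (K + 1) by rewrite mulr_gt0 // ltr_wpDl.
have eta_gt0 : 0 < eta by rewrite lt_min ltr01 divr_gt0.
have eta_le1 : eta <= 1 by rewrite ge_min lexx.
pose D : 'rV[R]_d := \row_i eta ^+ (2 * i).
pose Q := X^T *m diag_mx D *m X + Y^T *m diag_mx D *m Y.
have dE (w : 'cV[R]_d) i : (diag_mx D *m w) i 0 = eta ^+ (2 * i) * w i 0.
  by rewrite mul_diag_mx !mxE.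
have QE (u v : 'cV[R]_d) : (u^T *m Q *m v) 0 0 =
    \sum_(i < d) eta ^+ (2 * i) * ((X *m u) i 0 * (X *m v) i 0 + (Y *m u) i 0 * (Y *m v) i 0).
  rewrite mulmxDr mulmxDl !mulmxA -!trmx_mul -!mulmxA [LHS]mxE !trmulmxE -big_split.
  by apply: eq_bigr => i _; rewrite /= !dE mulrDr; congr (_ + _); rewrite mulrCA.
pose a (u : 'cV[R]_d) (i : 'I_d) : R := (X *m u) i 0.
pose b (u : 'cV[R]_d) (i : 'I_d) : R := (Y *m u) i 0.
pose S (u : 'cV[R]_d) : R := \sum_(i < d) eta ^+ (2 * i) * (a u i ^+ 2 + b u i ^+ 2).
have term_ge0 (u : 'cV[R]_d) (i : 'I_d) : 0 <= eta ^+ (2 * i) * (a u i ^+ 2 + b u i ^+ 2).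
  by rewrite mulr_ge0 ?exprn_ge0 ?(ltW eta_gt0) // addr_ge0 // sqr_ge0.
have term_le (u : 'cV[R]_d) (i : 'I_d) : eta ^+ (2 * i) * (a u i ^+ 2 + b u i ^+ 2) <= S u.
  by rewrite /S (bigD1 i) //= lerDl sumr_ge0.
have S_ge (u : 'cV[R]_d) : eta ^+ (2 * d) * \sum_i u i 0 ^+ 2 <= S u.
  have -> : \sum_i u i 0 ^+ 2 = \sum_(i < d) (a u i ^+ 2 + b u i ^+ 2).
    transitivity ((u^T *m u) 0 0).
      by rewrite trmulmxE; apply: eq_bigr => i _; rewrite expr2.
    rewrite -{2}[u]mul1mx -U mulmxDl mulmxDr mxE -!mulmxA !(mulmxA u^T).
    rewrite -!trmx_mul !trmulmxE -big_split; apply: eq_bigr => i _.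
    by rewrite /a /b !expr2.
  rewrite big_distrr; apply: ler_sum => i _ /=; rewrite ler_wpM2r //.
    by rewrite addr_ge0 // sqr_ge0.
  by apply: ler_wiXn2l; rewrite ?(ltW eta_gt0) // leq_mul2l /= ltnW.
have S_ge0 (u : 'cV[R]_d) : 0 <= S u by rewrite sumr_ge0.
have cross (u : 'cV[R]_d) (i j : 'I_d) : (j < i)%N ->
    - (eta * (`|T i j| + `|W i j|) * S u) <=
    eta ^+ (2 * i) * (T i j * (a u i * a u j + b u i * b u j)
                      + W i j * (b u i * a u j - a u i * b u j)).
  move=> ji; set e := eta ^+ i; set f := eta ^+ j.
  pose r := eta ^+ (i - j).
  have er : e = r * f by rewrite /e /f /r -exprD subnK // ltnW.
  have r_ge0 : 0 <= r by rewrite exprn_ge0 ?ltW.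
  have r_le : r <= eta.
    by rewrite /r -[leRHS]expr1; apply: ler_wiXn2l; rewrite ?subn_gt0 // ltW.
  have hi := term_le u i; have hj := term_le u j.
  rewrite !(mulnC 2) !exprM -/e -/f in hi hj *.
  rewrite {1}(_ : e ^+ 2 = r * e * f); last by rewrite expr2 {1}er; ring.
  have bnd (x y z w : R) : e ^+ 2 * (x ^+ 2 + z ^+ 2) <= S u ->
      f ^+ 2 * (y ^+ 2 + w ^+ 2) <= S u -> `|e * f * (x * y + z * w)| <= S u.
    move=> h1 h2; rewrite ler_norml; apply/andP; split.
      have := sqr_ge0 (e * x + f * y); have := sqr_ge0 (e * z + f * w); nra.
    have := sqr_ge0 (e * x - f * y); have := sqr_ge0 (e * z - f * w); nra.
  have B1 := bnd _ _ _ _ hi hj.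
  have hi' : e ^+ 2 * (b u i ^+ 2 + (- a u i) ^+ 2) <= S u by rewrite sqrrN addrC.
  have B2 := bnd _ _ _ _ hi' hj.
  have -> : r * e * f * (T i j * (a u i * a u j + b u i * b u j)
                      + W i j * (b u i * a u j - a u i * b u j)) =
    r * (T i j * (e * f * (a u i * a u j + b u i * b u j))
          + W i j * (e * f * (b u i * a u j + (- a u i) * b u j))) by ring.
  move: (e * f * (a u i * _ + _)) (e * f * (b u i * _ + _)) B1 B2 => q1 q2 B1 B2.
  have TS : `|T i j * q1 + W i j * q2| <= (`|T i j| + `|W i j|) * S u.
    rewrite mulrDl (le_trans (ler_normD _ _)) // !normrM.
    by apply: lerD; rewrite ler_wpM2l.
  rewrite lerNl -mulrN -mulrA.
  apply: (@le_trans _ _ (r * ((`|T i j| + `|W i j|) * S u))).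
    by rewrite ler_wpM2l // (le_trans _ TS) // -normrN ler_norm.
  by rewrite ler_wpM2r // mulr_ge0 // addr_ge0.
have comb (v w : 'cV[R]_d) i :
    v i 0 * (T *m v - W *m w) i 0 + w i 0 * (T *m w + W *m v) i 0 =
    \sum_j (T i j * (v i 0 * v j 0 + w i 0 * w j 0)
            + W i j * (w i 0 * v j 0 - v i 0 * w j 0)).
  rewrite !mxE mulrBr mulrDr !big_distrr /= -sumrB -!big_split /=.
  by apply: eq_bigr => j _; ring.
have main (u : 'cV[R]_d) : t / 2 * S u <= (u^T *m Q *m (A *m u)) 0 0.
  have -> : (u^T *m Q *m (A *m u)) 0 0 = \sum_(i < d) \sum_(j < d) eta ^+ (2 * i) *
      (T i j * (a u i * a u j + b u i * b u j) + W i j * (b u i * a u j - a u i * b u j)).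
    rewrite QE !mulmxA XA YA; apply: eq_bigr => i _.
    rewrite -big_distrr /=; congr (_ * _).
    by rewrite mulmxBl mulmxDl -!mulmxA comb.
  apply: (@le_trans _ _ (\sum_(i < d) \sum_(j < d)
      ((i == j)%:R * (t * (eta ^+ (2 * i) * (a u i ^+ 2 + b u i ^+ 2)))
       - eta * (`|T i j| + `|W i j|) * S u))).
    have -> : \sum_(i < d) \sum_(j < d)
      ((i == j)%:R * (t * (eta ^+ (2 * i) * (a u i ^+ 2 + b u i ^+ 2)))
       - eta * (`|T i j| + `|W i j|) * S u) = t * S u - eta * K * S u.
      under eq_bigr do rewrite sumrB -big_distrl -big_distrl -big_distrr /=.
      rewrite sumrB -big_distrl -big_distrr /=; congr (_ - _).
      rewrite /S big_distrr; apply: eq_bigr => i _ /=.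
      rewrite (bigD1 i) //= eqxx big1 ?addr0 ?mul1r // => j /negPf ji.
      by rewrite eq_sym ji.
    rewrite -mulrBl ler_wpM2r // lerBrDr -lerBrDl.
    have : eta * K <= t / (4 * (K + 1)) * (K + 1).
      apply: ler_pM; rewrite ?(ltW eta_gt0) ?lerDl //.
      by rewrite /eta ge_min lexx orbT.
    move=> h; apply: le_trans h _.
    rewrite invfM mulrA divfK; last by rewrite gt_eqF // ltr_wpDl.
    by have := t_gt0; lra.
  apply: ler_sum => i _; apply: ler_sum => j _.
  have [ij|ji|/val_inj ij] := ltngtP i j.
  - have [-> ->] := trig i j ij.
    rewrite !mul0r addr0 mulr0 normr0 addr0 mulr0 mul0r subr0.
    by rewrite (_ : i == j = false) ?mul0r //; apply/negbTE; rewrite neq_ltn ij.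
  - rewrite (_ : i == j = false) ?mul0r ?sub0r ?cross //.
    by apply/negbTE; rewrite neq_ltn ji orbT.
  rewrite -ij eqxx mul1r [X in W i i * X](_ : _ = 0); last by ring.
  rewrite mulr0 addr0 (@le_trans _ _ (t * (eta ^+ (2 * i) * (a u i ^+ 2 + b u i ^+ 2)))) //.
    by rewrite lerBlDr lerDl !mulr_ge0 ?addr_ge0 // ltW.
  by rewrite -!expr2 mulrCA ler_wpM2l ?exprn_ge0 ?(ltW eta_gt0) // ler_wpM2r ?addr_ge0 ?sqr_ge0.
exists Q, (eta ^+ (2 * d) * Num.min 1 (t / 2)).
  by rewrite mulr_gt0 ?exprn_gt0 // lt_min ltr01 divr_gt0.
split.
  by rewrite /Q linearD /= !trmx_mul !tr_diag_mx !trmxK !mulmxA.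
move=> u; have S0 := S_ge0 u; split.
  rewrite QE; apply: (@le_trans _ _ (S u)); last first.
    by apply: ler_sum => i _; rewrite -!expr2.
  apply: le_trans (S_ge u); rewrite ler_wpM2r //.
    by rewrite sumr_ge0 // => i _; exact: sqr_ge0.
  by rewrite ler_piMr ?exprn_ge0 ?(ltW eta_gt0) // ge_min lexx.
apply: le_trans (main u).
rewrite mulrAC (le_trans (ler_wpM2r _ (S_ge u))) //.
  by rewrite le_min ler01 divr_ge0 // ltW.
by rewrite mulrC ler_wpM2r // ge_min lexx orbT.
Qed.

End Lyapunov.

                           

(** * The one-dimensional Gaussian: moments and stability *)

Section GaussianIntegral.
Variable R : realType.
Notation mu := (@lebesgue_measure R).
Notation N01 := (@normal_prob R 0 1).
Notation phi := (@normal_pdf R 0 1).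

(** The Radon-Nikodym derivative is determined almost everywhere only; it is identified with the
    density because both have the same integral over every measurable set. *)
Lemma ge0_integral_normal (f : R -> \bar R) : measurable_fun [set: R] f ->
  (forall x, (0 <= f x)%E) ->
  (\int[N01]_x f x = \int[mu]_x (f x * (phi x)%:E))%E.
Proof.
move=> mf f0; have dom := @normal_prob_dominates R 0 1.
rewrite -(Radon_Nikodym_SigmaFinite.change_of_variables dom) //.
have mg := measurable_int _ (Radon_Nikodym_SigmaFinite.f_integrable dom).
have mphi : measurable_fun [set: R] (fun x => (phi x)%:E).
  by apply/measurable_EFinP; exact: measurable_normal_pdf.
apply: ae_eq_integral => //; [exact: emeasurable_funM..|].
apply: ae_eqe_mul2l; apply: integral_ae_eq => //.
  exact: Radon_Nikodym_SigmaFinite.f_integrable.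
by move=> E _ mE; rewrite -Radon_Nikodym_SigmaFinite.f_integral.
Qed.

Lemma normal_pdf01E x :
  phi x = (Num.sqrt (trigo.pi *+ 2))^-1 * expR (- (x ^+ 2 / 2)).
Proof.
rewrite normal_pdfE ?oner_eq0 // /normal_peak /normal_fun.
by rewrite subr0 expr1n mul1r mulNr.
Qed.

Lemma normal_pdf_scale a b x : 0 < b ->
  phi ((x - a) / b) / b = normal_pdf a b x.
Proof.
move=> b0; rewrite normal_pdf01E normal_pdfE ?gt_eqF //.
rewrite /normal_peak /normal_fun mulrAC; congr (_ * expR _).
  rewrite -mulrnAr sqrtrM ?sqr_ge0 // sqrtr_sqr gtr0_norm //.
  by rewrite invfM mulrC.
rewrite mulNr; congr (- _); rewrite expr_div_n -mulrA; congr (_ * _).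
by field; rewrite gt_eqF.
Qed.

                                                             
                                                               
(** Symmetry of the joint density of (Y, aY + bZ) for independent standard Y and Z: by a^2 + b^2 = 1
    both coordinates are standard, and the exponent is symmetric in them. *)
Lemma normal_pdf_swap a b y v : 0 < b -> a ^+ 2 + b ^+ 2 = 1 ->
  phi y * normal_pdf (a * y) b v = phi v * normal_pdf (a * v) b y.
Proof.
move=> b0 ab; rewrite !normal_pdfE ?oner_eq0 ?gt_eqF // /normal_fun.
move: (normal_peak 1) (normal_peak b) => p1 p2.
rewrite mulrACA [RHS]mulrACA -!expRD; congr (_ * expR _).
have -> : (y - a * v) ^+ 2 = (v - a * y) ^+ 2 + (1 - a ^+ 2) * (y ^+ 2 - v ^+ 2).
  by ring.
have -> : 1 - a ^+ 2 = b ^+ 2 by rewrite -ab addrC addKr.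
by field; rewrite gt_eqF.
Qed.

(** The weight only changes the variance of the density to 1/(1+s). The value s = -1/2 gives an
    integrable majorant for quartic growth; small s > 0 will give the variance. *)
Lemma integral_gauss_exp s : -1 < s ->
  (\int[N01]_x (expR (- (s * x ^+ 2 / 2)))%:E = ((Num.sqrt (1 + s))^-1)%:E)%E.
Proof.
move=> s1; have s1_gt0 : 0 < 1 + s by rewrite addrC -(opprK 1) subr_gt0.
have me : measurable_fun [set: R] (fun x => (expR (- (s * x ^+ 2 / 2)))%:E).
  apply/measurable_EFinP/measurableT_comp => //.
  apply: continuous_measurable_fun => x.
  by apply: cvgN; apply: cvgM; [apply: cvgM; [exact: cvg_cst|exact: exprn_continuous]|exact: cvg_cst].
rewrite ge0_integral_normal //.
set q := Num.sqrt (1 + s).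
have q_gt0 : 0 < q by rewrite sqrtr_gt0.
have q2 : q ^+ 2 = 1 + s by rewrite sqr_sqrtr // ltW.
transitivity (\int[mu]_x ((q^-1)%:E * (normal_pdf 0 q^-1 x)%:E))%E.
  apply: eq_integral => x _; rewrite -!EFinM; congr EFin.
  rewrite -[normal_pdf 0 q^-1 x]normal_pdf_scale ?invr_gt0 // subr0 !invrK.
  rewrite [LHS]mulrC [RHS]mulrC mulfK ?gt_eqF // !normal_pdf01E -[LHS]mulrA -expRD.
  by rewrite exprMn q2; congr (_ * expR _); field.
rewrite integralZl //; last exact: integrable_normal_pdf.
by rewrite integral_normal_pdf mule1.
Qed.

Definition gauss (F : R -> R) : R := (\int[N01]_x F x)%R.

Lemma expR_quad_le (t : R) : 0 <= t -> (1 + t / 2) ^+ 2 <= expR t.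
Proof.
move=> t0; have -> : expR t = expR (t / 2) ^+ 2.
  by rewrite expr2 -expRD -splitr.
by rewrite lerXn2r ?nnegrE ?expR_ge0 ?addr_ge0 ?divr_ge0 ?expR_ge1Dx.
Qed.

Lemma expRN_bounds (t : R) : 0 <= t -> `|t - (1 - expR (- t))| <= t ^+ 2.
Proof.
move=> t0; have h1 := expR_ge1Dx (- t).
have h2 : expR (- t) <= 1 - t + t ^+ 2.
  rewrite expRN -[leLHS]mul1r ler_pdivrMr ?expR_gt0 //.
  have h3 := expR_quad_le t0.
  apply: (@le_trans _ _ ((1 - t + t ^+ 2) * (1 + t / 2) ^+ 2)).
    have t2 := sqr_ge0 t; have t3 : 0 <= t ^+ 3 by rewrite exprn_ge0.
    have t4 : 0 <= t ^+ 4 by rewrite exprn_ge0.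
    have -> : (1 - t + t ^+ 2) * (1 + t / 2) ^+ 2 = 1 + t ^+ 2 / 4 + 3 / 4 * t ^+ 3 + t ^+ 4 / 4 by field.
    lra.
  rewrite ler_wpM2l //; nra.
by rewrite ger0_norm; lra.
Qed.

(** A class of integrable functions closed under the operations in use, which settles integrability
    once for all. Degree 4 is that of the error term in the computation of the variance. *)
Definition growth4 (F : R -> R) : Prop :=
  measurable_fun [set: R] F /\ exists c, forall x, `|F x| <= c * (1 + x ^+ 4).

Lemma gauss_integrable (F : R -> R) : growth4 F ->
  N01.-integrable setT (EFin \o F).
Proof.
move=> [mF [c Fc]].
have m1 : measurable_fun [set: R] (fun x : R => expR (- (-1/2 * x ^+ 2 / 2))).
  apply/measurableT_comp => //.
  apply: continuous_measurable_fun => x.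
  by apply: cvgN; apply: cvgM; [apply: cvgM; [exact: cvg_cst|exact: exprn_continuous]|exact: cvg_cst].
have ie : N01.-integrable setT (fun x => (expR (- (-1/2 * x ^+ 2 / 2)))%:E).
  apply/integrableP; split; first exact/measurable_EFinP.
  under eq_integral do rewrite /= ger0_norm ?expR_ge0 //.
  by rewrite integral_gauss_exp ?ltry //; lra.
(* Since exp(x^2/4) >= (1 + x^2/8)^2 >= 1 + x^4/64, the factor 65 suffices to dominate 1 + x^4. *)
apply: (@le_integrable _ _ _ N01 setT measurableT _
  (fun x => ((`|c| * 65)%:E * (expR (- (-1/2 * x ^+ 2 / 2)))%:E)%E)).
- exact/measurable_EFinP.
- move=> x _ /=; rewrite lee_fin (le_trans (Fc x)) //.
  rewrite [leRHS]ger0_norm ?mulr_ge0 ?expR_ge0 //.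
  have x4 : 0 <= x ^+ 4 by rewrite exprn_even_ge0.
  rewrite (@le_trans _ _ (`|c| * (1 + x ^+ 4))) //.
    by rewrite ler_wpM2r ?ler_norm // addr_ge0.
  rewrite -[leRHS]mulrA ler_wpM2l //.
  have -> : - (-1/2 * x ^+ 2 / 2) = x ^+ 2 / 4 by field.
  have x2 := sqr_ge0 x.
  have h := @expR_quad_le (x ^+ 2 / 4) (divr_ge0 x2 (ler0n _ _)).
  have e : (1 + x ^+ 2 / 4 / 2) ^+ 2 = 1 + x ^+ 2 / 4 + x ^+ 4 / 64 by field.
  rewrite e in h; lra.
- by apply: integrableZl.
Qed.

Lemma growth4_cst c : growth4 (fun=> c).
Proof.
split=> //; exists `|c| => x; rewrite ler_peMr // lerDl exprn_even_ge0 //.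
Qed.

Lemma growth4D F G : growth4 F -> growth4 G -> growth4 (fun x => F x + G x).
Proof.
move=> [mF [c Fc]] [mG [c' Gc]]; split; first exact: measurable_funD.
exists (c + c') => x; rewrite mulrDl (le_trans (ler_normD _ _)) //.
exact: lerD.
Qed.

Lemma growth4Z c F : growth4 F -> growth4 (fun x => c * F x).
Proof.
move=> [mF [c' Fc]]; split; first exact: measurable_funM.
by exists (`|c| * c') => x; rewrite normrM -mulrA ler_wpM2l.
Qed.

Lemma growth4N F : growth4 F -> growth4 (fun x => - F x).
Proof.
move=> /(growth4Z (-1)); congr growth4.
by apply/funext => x; rewrite mulN1r.
Qed.

Lemma gaussD F G : growth4 F -> growth4 G ->
  gauss (fun x => F x + G x) = gauss F + gauss G.
Proof. by move=> hF hG; rewrite /gauss RintegralD //; exact: gauss_integrable. Qed.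

Lemma gaussZ c F : growth4 F -> gauss (fun x => c * F x) = c * gauss F.
Proof. by move=> hF; rewrite /gauss RintegralZl //; exact: gauss_integrable. Qed.

Lemma gaussB F G : growth4 F -> growth4 G ->
  gauss (fun x => F x - G x) = gauss F - gauss G.
Proof. by move=> hF hG; rewrite /gauss RintegralB //; exact: gauss_integrable. Qed.

Lemma gauss_cst c : gauss (fun=> c) = c.
Proof.
rewrite /gauss Rintegral_cst // -[RHS]mulr1 -[X in _ = _ * X]/(fine 1%E).
by congr (_ * fine _); exact: probability_setT.
Qed.

Lemma gauss_le F G : growth4 F -> growth4 G -> (forall x, F x <= G x) ->
  gauss F <= gauss G.
Proof.
by move=> hF hG FG; rewrite /gauss le_Rintegral //; exact: gauss_integrable.
Qed.

Lemma gauss_abs F : growth4 F -> `|gauss F| <= gauss (fun x => `|F x|).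
Proof. by move=> hF; apply: le_normr_Rintegral => //; exact: gauss_integrable. Qed.

Lemma growth4_continuous c (F : R -> R) : continuous F ->
  (forall x, `|F x| <= c * (1 + x ^+ 4)) -> growth4 F.
Proof. by move=> cF Fc; split; [exact: continuous_measurable_fun|exists c]. Qed.

Lemma pow_le4 (x : R) k : (k <= 4)%N -> `|x| ^+ k <= 1 + x ^+ 4.
Proof.
move=> k4; have -> : x ^+ 4 = `|x| ^+ 4 by rewrite -normrX ger0_norm // exprn_even_ge0.
move: (`|x|) (normr_ge0 x) => {}x x0.
have [x1|x1] := leP x 1.
  by rewrite (le_trans (exprn_ile1 k x0 x1)) // lerDl exprn_ge0.
by rewrite (le_trans (ler_weXn2l (ltW x1) k4)) // lerDr.
Qed.

Lemma growth4_pow k : (k <= 4)%N -> growth4 (fun x => x ^+ k).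
Proof.
move=> k4; apply: (@growth4_continuous 1) => [|x]; first exact: exprn_continuous.
by rewrite mul1r normrX pow_le4.
Qed.

Lemma growth4_normpow k : (k <= 4)%N -> growth4 (fun x => `|x| ^+ k).
Proof.
move=> k4; apply: (@growth4_continuous 1) => [x|x].
  apply: (@continuous_comp _ _ _ (fun x : R => `|x|) (fun x => x ^+ k)).
    exact: norm_continuous.
  exact: exprn_continuous.
by rewrite mul1r ger0_norm ?exprn_ge0 // pow_le4.
Qed.

Lemma gauss_exp s : -1 < s ->
  gauss (fun x => expR (- (s * x ^+ 2 / 2))) = (Num.sqrt (1 + s))^-1.
Proof. by move=> s1; rewrite /gauss /Rintegral integral_gauss_exp. Qed.

(** The variance is the limit of 2/s (1 - E exp(-s x^2/2)) as s tends to 0. The error is at most s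
    times the fourth moment, plus s for the explicit value (1+s)^(-1/2) of the expectation. *)
Lemma gauss_sqr : gauss (fun x => x ^+ 2) = 1.
Proof.
set m4 := gauss (fun x => x ^+ 4).
have m4_ge0 : 0 <= m4.
  by apply: Rintegral_ge0 => x _; rewrite exprn_even_ge0.
have key s : 0 < s -> s <= 1 -> `|gauss (fun x => x ^+ 2) - 1| <= s * (m4 + 1).
  move=> s0 s1; pose E (x : R) : R := expR (- (s * x ^+ 2 / 2)).
  have cE : continuous E.
    move=> x; apply: continuous_comp; last exact: continuous_expR.
    by apply: cvgN; apply: cvgM; [apply: cvgM; [exact: cvg_cst|exact: exprn_continuous]|exact: cvg_cst].
  have t_ge0 x : 0 <= s * x ^+ 2 / 2 by rewrite divr_ge0 // mulr_ge0 ?sqr_ge0 // ltW.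
  have gE : growth4 E.
    apply: (@growth4_continuous 1) => // x; rewrite mul1r ger0_norm ?expR_ge0 //.
    apply: (@le_trans _ _ 1); last by rewrite lerDl exprn_even_ge0.
    by rewrite -expR0 ler_expR oppr_le0.
  have g2 := @growth4_pow 2 isT.
  have gE1 : growth4 (fun x => 1 + (-1) * E x).
    by apply: growth4D; [exact: growth4_cst|exact: growth4Z].
  have gE2 : growth4 (fun x => 2 / s * (1 + (-1) * E x)) by exact: growth4Z.
  have e1 : gauss (fun x => 2 / s * (1 + (-1) * E x)) = 2 / s * (1 - (Num.sqrt (1 + s))^-1).
    rewrite gaussZ // gaussD ?gauss_cst ?gaussZ //; [|exact: growth4_cst|exact: growth4Z].
    by rewrite mulN1r gauss_exp //; lra.
  have e2 : `|gauss (fun x => x ^+ 2) - 2 / s * (1 - (Num.sqrt (1 + s))^-1)| <= s * m4.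
    rewrite -e1 -gaussB // -gaussZ; last exact: growth4_pow.
    have gB : growth4 (fun x => x ^+ 2 - 2 / s * (1 + (-1) * E x)).
      by apply: growth4D => //; exact: growth4N.
    apply: le_trans (gauss_abs gB) _; apply: gauss_le.
    - split; first by apply: measurableT_comp => //; case: gB.
      by case: gB => _ [c Hc]; exists c => x; rewrite normr_id.
    - exact/growth4Z/growth4_pow.
    move=> x; have h := expRN_bounds (t_ge0 x).
    have -> : x ^+ 2 - 2 / s * (1 + (-1) * E x) =
        2 / s * (s * x ^+ 2 / 2 - (1 - expR (- (s * x ^+ 2 / 2)))).
      by rewrite /E; field; rewrite gt_eqF.
    rewrite normrM ger0_norm; last by rewrite divr_ge0 // ltW.
    apply: (@le_trans _ _ (2 / s * (s * x ^+ 2 / 2) ^+ 2)).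
      by rewrite ler_wpM2l // divr_ge0 // ltW.
    have -> : 2 / s * (s * x ^+ 2 / 2) ^+ 2 = s * x ^+ 4 / 2.
      by field; rewrite gt_eqF.
    have : 0 <= s * x ^+ 4 by rewrite mulr_ge0 ?exprn_even_ge0 // ltW.
    lra.
  have e3 : `|2 / s * (1 - (Num.sqrt (1 + s))^-1) - 1| <= s.
    set q := Num.sqrt (1 + s).
    have q2 : q ^+ 2 = 1 + s by rewrite sqr_sqrtr // addr_ge0 // ltW.
    have q1 : 1 <= q by rewrite -(sqrtr1 R) ler_sqrt; lra.
    have -> : s = q ^+ 2 - 1 by rewrite q2; ring.
    have q21 : q ^+ 2 - 1 != 0 by rewrite q2 addrC addKr gt_eqF.
    have -> : 2 / (q ^+ 2 - 1) * (1 - q^-1) = 2 / (q * (q + 1)).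
      have q0 : q != 0 by rewrite gt_eqF // (lt_le_trans ltr01).
      have q10 : q + 1 != 0 by rewrite gt_eqF //; lra.
      by field; rewrite q21 q0 q10.
    have qq : 0 < q * (q + 1) by rewrite mulr_gt0 //; lra.
    rewrite ler0_norm; last by rewrite subr_le0 ler_pdivrMr //; nra.
    rewrite opprB lerBlDr addrC -lerBlDr ler_pdivlMr //; nra.
  rewrite mulrDr mulr1 (le_trans _ (lerD e2 e3)) //.
  by rewrite (le_trans _ (ler_normD _ _)) // addrA subrK.
apply/eqP; rewrite -subr_eq0 -normr_le0 leNgt; apply/negP => h.
set e := `|_| in h key.
have s0 : 0 < Num.min 1 (e / (2 * (m4 + 1))).
  by rewrite lt_min ltr01 divr_gt0 // mulr_gt0 // ltr_wpDl.
have := key _ s0; rewrite ge_min lexx => /(_ isT).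
apply/negP; rewrite -ltNge.
apply: (@le_lt_trans _ _ (e / (2 * (m4 + 1)) * (m4 + 1))).
  by rewrite ler_wpM2r ?addr_ge0 // ge_min lexx orbT.
rewrite invfM mulrA divfK; last by rewrite gt_eqF // ltr_wpDl.
lra.
Qed.

End GaussianIntegral.

Section GaussianConvolution.
Variable R : realType.
Notation mu := (@lebesgue_measure R).
Notation N01 := (@normal_prob R 0 1).
Notation phi := (@normal_pdf R 0 1).

Lemma integral_normal_affine (F : R -> R) m b : continuous F ->
  (forall x, 0 <= F x) -> 0 < b ->
  (\int[N01]_z (F (m + b * z))%:E = \int[mu]_v (F v * normal_pdf m b v)%:E)%E.
Proof.
move=> cF F0 b0; have bN0 : b != 0 by rewrite gt_eqF.
have cA : continuous (fun z : R => m + b * z).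
  by move=> x; apply: cvgD; [exact: cvg_cst|apply: cvgM; [exact: cvg_cst|exact: cvg_id]].
have cFA : continuous (fun z => F (m + b * z)).
  by move=> x; apply: continuous_comp; [exact: cA|exact: cF].
rewrite ge0_integral_normal; last 2 first.
- by apply/measurable_EFinP; exact: continuous_measurable_fun.
- by move=> x; rewrite lee_fin.
pose A (z : R^o) : R := m + b * z.
have A'E : A^`()%classic = cst b.
  apply/funext => x; rewrite /A derive1E deriveD// deriveM// derive_cst derive_id.
  by rewrite derive_cst scaler0 addr0 add0r scaler1.
rewrite (@increasing_ge0_integration_by_substitutionT R A
    (fun v => F v * normal_pdf m b v)).
- apply: eq_integral => x _; rewrite A'E !fctE /= -EFinM; congr EFin.
  rewrite -mulrA -[normal_pdf m b _]normal_pdf_scale // divfK //.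
  by rewrite /A (addrC m) addrK (mulrC b) mulfK.
- by move=> x y xy; rewrite /A ltrD2l ltr_pM2l.
- by rewrite A'E => ?; exact: cvg_cst.
- by rewrite A'E; exact: is_cvg_cst.
- by rewrite A'E; exact: is_cvg_cst.
- by move=> x; rewrite /A.
- exact: (cvg_comp _ _ (gt0_cvgMrNy b0 cvg_id) (cvg_addrl_Ny m)).
- exact: (cvg_comp _ _ (gt0_cvgMry b0 cvg_id) (cvg_addrl m)).
- move=> x; apply: cvgM; [exact: cF|exact: continuous_normal_pdf].
- by move=> x; rewrite mulr_ge0 ?normal_pdf_ge0.
Qed.

(** Tonelli, then the symmetry of the joint density: after the swap the inner integral is that of a
    normal density in [y], which is 1. *)
Lemma gauss_convolution_ge0 (F : R -> R) a b : continuous F ->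
  (forall x, 0 <= F x) -> 0 < b -> a ^+ 2 + b ^+ 2 = 1 ->
  (\int[N01]_y \int[N01]_z (F (a * y + b * z))%:E = \int[N01]_x (F x)%:E)%E.
Proof.
move=> cF F0 b0 ab.
have mF : measurable_fun [set: R] F by exact: continuous_measurable_fun.
pose f (q : R * R) : \bar R := (F q.2 * normal_pdf (a * q.1) b q.2)%:E.
have mf : measurable_fun [set: R * R] f.
  apply/measurable_EFinP/measurable_funM; first exact: measurableT_comp.
  under eq_fun do rewrite -normal_pdf_scale //.
  apply: measurable_funM => //.
  apply: (measurableT_comp (measurable_normal_pdf 0 1)).
  apply: measurable_funM => //; apply: measurable_funB => //.
  exact: measurable_funM.
have f0 q : (0 <= f q)%E by rewrite lee_fin mulr_ge0 ?normal_pdf_ge0.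
have mphi : measurable_fun [set: R] (fun x => (phi x)%:E).
  by apply/measurable_EFinP; exact: measurable_normal_pdf.
transitivity (\int[N01]_y \int[mu]_v f (y, v))%E.
  by apply: eq_integral => y _; rewrite integral_normal_affine.
rewrite ge0_integral_normal; last 2 first.
- exact: measurable_fun_fubini_tonelli_F.
- by move=> y; exact: integral_ge0.
pose g (q : R * R) : \bar R := (f q * (phi q.1)%:E)%E.
have mg : measurable_fun [set: R * R] g.
  apply: emeasurable_funM => //.
  exact: (measurableT_comp mphi measurable_fst).
have g0 q : (0 <= g q)%E by rewrite mule_ge0 // lee_fin normal_pdf_ge0.
transitivity (\int[mu]_y \int[mu]_v g (y, v))%E.
  apply: eq_integral => y _; rewrite -ge0_integralZr //.
  - exact: measurable_fun_pair2.
  - by rewrite lee_fin normal_pdf_ge0.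
rewrite fubini_tonelli //.
rewrite [RHS]ge0_integral_normal; last 2 first.
- by apply/measurable_EFinP.
- by move=> x; rewrite lee_fin.
apply: eq_integral => v _.
transitivity (\int[mu]_y ((F v * phi v)%:E * (normal_pdf (a * v) b y)%:E))%E.
  apply: eq_integral => y _; rewrite /g /f /= -!EFinM; congr EFin.
  by rewrite -!mulrA; congr (_ * _); rewrite mulrC normal_pdf_swap.
rewrite integralZl //; last exact: integrable_normal_pdf.
by rewrite integral_normal_pdf mule1 EFinM.
Qed.

Definition lipschitz1 (L : R) (F : R -> R) : Prop :=
  forall x y, `|F x - F y| <= L * `|x - y|.

Lemma lipschitz1_continuous L F : lipschitz1 L F -> continuous F.
Proof.
move=> FL x; apply/cvgrPdist_le => e e0.
near=> y; rewrite (le_trans (FL x y)) //.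
apply: (@le_trans _ _ ((`|L| + 1) * `|x - y|)).
  by rewrite ler_wpM2r // (le_trans (ler_norm _)) // lerDl.
rewrite -ler_pdivlMl ?ltr_wpDl // mulrC.
near: y; apply: cvgr_dist_le; first exact: cvg_id.
by rewrite divr_gt0 // ltr_wpDl.
Unshelve. all: by end_near. Qed.

Lemma lipschitz1_growth L F : lipschitz1 L F -> growth4 F.
Proof.
move=> FL; apply: (@growth4_continuous _ (`|F 0| + `|L|)).
  exact: lipschitz1_continuous FL.
move=> x; have := FL x 0; rewrite subr0 => h.
have h1 : `|F x| <= `|F 0| + `|L| * `|x|.
  rewrite -[F x](subrK (F 0)) addrC (le_trans (ler_normD _ _)) // lerD2l.
  by rewrite (le_trans h) // ler_wpM2r // ler_norm.
have := @pow_le4 _ x 1 isT; rewrite expr1 => h2.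
apply: (le_trans h1); rewrite mulrDl lerD //.
  by rewrite ler_peMr // lerDl exprn_even_ge0.
by rewrite ler_wpM2l.
Qed.

Lemma lipschitz1_affine L F m b : lipschitz1 L F ->
  lipschitz1 (L * `|b|) (fun z => F (m + b * z)).
Proof.
move=> FL x y; rewrite (le_trans (FL _ _)) // -mulrA -normrM.
by rewrite opprD addrACA subrr add0r -mulrBr.
Qed.

Lemma lipschitz1_ge0 L F : lipschitz1 L F -> 0 <= L.
Proof. by move=> /(_ 1 0); rewrite subr0 normr1 mulr1; exact: le_trans. Qed.

Lemma lipschitz1_gauss L F a b : lipschitz1 L F ->
  lipschitz1 (L * `|a|) (fun y => gauss (fun z => F (a * y + b * z))).
Proof.
move=> FL x y; have gF m := lipschitz1_growth (lipschitz1_affine m b FL).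
rewrite -gaussB // (le_trans (gauss_abs _)) //.
  by apply: growth4D => //; exact: growth4N.
rewrite -[leRHS](gauss_cst (L * `|a| * `|x - y|)); apply: gauss_le.
- have := growth4D (gF (a * x)) (growth4N (gF (a * y))).
  case=> m [c h]; split; first exact: measurableT_comp.
  by exists c => z; rewrite normr_id.
- exact: growth4_cst.
move=> z; rewrite (le_trans (FL _ _)) // -mulrA -normrM.
by rewrite opprD addrACA subrr addr0 -mulrBr.
Qed.

Lemma gauss_convolution L F a b : lipschitz1 L F -> 0 < b -> a ^+ 2 + b ^+ 2 = 1 ->
  gauss (fun y => gauss (fun z => F (a * y + b * z))) = gauss F.
Proof.
move=> FL b0 ab.
have pos G : lipschitz1 L G -> (forall x, 0 <= G x) ->
    gauss (fun y => gauss (fun z => G (a * y + b * z))) = gauss G.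
  move=> GL G0; rewrite [RHS]/gauss /Rintegral.
  rewrite -(gauss_convolution_ge0 _ _ b0 ab) //; last exact: lipschitz1_continuous GL.
  rewrite [LHS]/gauss /Rintegral; congr fine; apply: eq_integral => y _.
  rewrite /gauss /Rintegral fineK //.
  apply: integrable_fin_num => //; apply: gauss_integrable.
  exact: lipschitz1_growth (lipschitz1_affine _ _ GL).
(* Positive and negative parts keep the Lipschitz constant, so the nonnegative case extends by
   linearity. *)
pose P x := Num.max (F x) 0; pose M x := Num.max (- F x) 0.
have maxL (u v : R) : `|Num.max u 0 - Num.max v 0| <= `|u - v|.
  have h1 : u - v <= `|u - v| by rewrite ler_norm.
  have h2 : v - u <= `|u - v| by rewrite distrC ler_norm.
  have h3 := normr_ge0 (u - v).
  rewrite ler_norml; case: (leP u 0) => ?; case: (leP v 0) => ?; apply/andP; split; lra.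
have PL : lipschitz1 L P by move=> x y; rewrite (le_trans _ (FL x y)) // maxL.
have ML : lipschitz1 L M.
  move=> x y; rewrite (le_trans _ (FL x y)) // (le_trans (maxL _ _)) //.
  by rewrite -opprD normrN.
have FE : F = fun x => P x - M x.
  by apply/funext => x; rewrite /P /M; case: (leP (F x) 0) => ?; case: (leP (- F x) 0) => ?; lra.
have PM m : gauss (fun z => F (m + b * z)) =
    gauss (fun z => P (m + b * z)) - gauss (fun z => M (m + b * z)).
  rewrite FE gaussB //; apply: lipschitz1_growth; exact: lipschitz1_affine.
transitivity (gauss P - gauss M); last first.
  by rewrite FE gaussB //; apply: lipschitz1_growth; eassumption.
have P0 x : 0 <= P x by rewrite /P le_max lexx orbT.
have M0 x : 0 <= M x by rewrite /M le_max lexx orbT.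
rewrite -(pos P PL P0) -(pos M ML M0) -gaussB.
- by congr gauss; apply/funext => y; rewrite PM.
- exact: lipschitz1_growth (lipschitz1_gauss _ _ PL).
- exact: lipschitz1_growth (lipschitz1_gauss _ _ ML).
Qed.

(** The convolution identity at the Pythagorean pair (3/5, 4/5) says that the mean equals 7/5 of
    itself. *)
Lemma gauss_id : gauss (fun x : R => x) = 0.
Proof.
have idL : lipschitz1 1 (fun x : R => x) by move=> x y; rewrite mul1r.
have gid := lipschitz1_growth idL.
have h : gauss (fun y : R => gauss (fun z => 3 / 5 * y + 4 / 5 * z)) = gauss (fun x : R => x).
  by apply: (gauss_convolution idL) => //; field.
have inner y : gauss (fun z : R => 3 / 5 * y + 4 / 5 * z) = 3 / 5 * y + 4 / 5 * gauss (fun x : R => x).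
  by rewrite gaussD ?gauss_cst ?gaussZ //; [exact: growth4_cst|exact: growth4Z].
move: h; rewrite (_ : (fun y => _) = fun y => 3 / 5 * y + 4 / 5 * gauss (fun x : R => x)); last exact/funext.
rewrite gaussD ?gauss_cst ?gaussZ //; [lra|exact: growth4Z|exact: growth4_cst].
Qed.

End GaussianConvolution.

                                                            

(** * Rademacher walks against the Gaussian in one dimension *)

Section RademacherWalk.
Variable R : realType.

Definition rad (a : R) (F : R -> R) (x : R) : R := (F (x + a) + F (x - a)) / 2.

(** The coefficients stay anonymous: a Rademacher step and a Gaussian step of the same size share
    their first two moments, so the polynomial parts agree whatever the coefficients are. *)
Definition taylor3 (M : R) (F : R -> R) : Prop :=
  forall x, exists c1 c2, forall t,
    `|F (x + t) - F x - c1 * t - c2 * t ^+ 2| <= M * `|t| ^+ 3.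

Definition gauss_abs3 : R := gauss (fun x => `|x| ^+ 3).

Lemma gauss_abs3_ge0 : 0 <= gauss_abs3.
Proof. by apply: Rintegral_ge0 => x _; rewrite exprn_ge0. Qed.

Lemma taylor3_ge0 M F : taylor3 M F -> 0 <= M.
Proof.
move=> /(_ 0)[c1 [c2 /(_ 1)]]; rewrite normr1 !expr1n [M * 1]mulr1.
exact: le_trans.
Qed.

Lemma rad_gauss_step M L F a x : 0 <= a -> lipschitz1 L F -> taylor3 M F ->
  `|rad a F x - gauss (fun z => F (x + a * z))| <= a ^+ 3 * (1 + gauss_abs3) * M.
Proof.
move=> a0 FL FT; have [c1 [c2 Hc]] := FT x.
have M0 := taylor3_ge0 FT.
have gF := lipschitz1_growth (lipschitz1_affine x a FL).
pose r z := F (x + a * z) - F x - c1 * (a * z) - c2 * (a * z) ^+ 2.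
have gz : growth4 (fun z : R => z).
  by have := @growth4_pow R 1 isT; under eq_fun do rewrite expr1.
have gq : growth4 (fun z => F x + (c1 * a) * z + (c2 * a ^+ 2) * z ^+ 2).
  by apply: growth4D; [apply: growth4D; [exact: growth4_cst|exact: growth4Z]|exact/growth4Z/growth4_pow].
have gr : growth4 r.
  have := growth4D gF (growth4N gq); congr growth4; apply/funext => z.
  by rewrite /r; ring.
have gE : gauss (fun z => F (x + a * z)) = F x + c2 * a ^+ 2 + gauss r.
  have -> : (fun z => F (x + a * z)) =
      fun z => (F x + (c1 * a) * z + (c2 * a ^+ 2) * z ^+ 2) + r z.
    by apply/funext => z; rewrite /r; ring.
  rewrite gaussD // gaussD; last 2 first.
  - by apply: growth4D; [exact: growth4_cst|exact: growth4Z].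
  - exact/growth4Z/growth4_pow.
  rewrite gaussD ?gauss_cst ?gaussZ ?gauss_id ?gauss_sqr //.
  - by rewrite mulr0 addr0 mulr1.
  - exact: growth4_pow.
  - exact: growth4_cst.
  - exact: growth4Z.
have h1 := Hc a; have h2 := Hc (- a).
rewrite normrN sqrrN (ger0_norm a0) in h2; rewrite (ger0_norm a0) in h1.
have hr : `|gauss r| <= M * a ^+ 3 * gauss_abs3.
  rewrite (le_trans (gauss_abs gr)) // /gauss_abs3 -gaussZ; last exact: growth4_normpow.
  apply: gauss_le.
  - case: gr => m [c h]; split; first exact: measurableT_comp.
    by exists c => z; rewrite normr_id.
  - exact/growth4Z/growth4_normpow.
  move=> z; rewrite (le_trans (Hc _)) // normrM (ger0_norm a0) exprMn.
  by rewrite mulrA.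
rewrite gE /rad; move: h1 h2 hr; rewrite !ler_norml.
set A := F (x + a); set B := F (x - a); set G := gauss r.
move=> /andP[u1 u2] /andP[v1 v2] /andP[w1 w2]; apply/andP; split; lra.
Qed.

                                                                               
                                                                
(** One Rademacher step is exchanged at a time, at the cost of a third-order remainder; the Gaussian
    increment built so far absorbs the new one because variances add. *)
Lemma rad_walk_gauss M L F a n x : 0 <= a -> lipschitz1 L F -> taylor3 M F ->
  `|iter n (rad a) F x - gauss (fun z => F (x + a * Num.sqrt n%:R * z))|
  <= n%:R * (a ^+ 3 * (1 + gauss_abs3) * M).
Proof.
move=> a0 FL FT; elim: n x => [|n IH] x.
  rewrite /= sqrtr0 mulr0 mul0r; under eq_fun do rewrite mul0r addr0.
  by rewrite gauss_cst subrr normr0.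
set K := a ^+ 3 * _ * M in IH *.
set s := Num.sqrt n%:R in IH *; set s1 := Num.sqrt n.+1%:R.
have s1_gt0 : 0 < s1 by rewrite sqrtr_gt0.
have ss : s ^+ 2 + 1 = s1 ^+ 2 by rewrite !sqr_sqrtr // -natr1.
(* The squares of s/s1 and 1/s1 add up to 1, because s^2 = n and s1^2 = n + 1. *)
have gconv : gauss (fun w => F (x + a * s1 * w)) =
    gauss (fun y => gauss (fun z => F ((x + a * s * y) + a * z))).
  rewrite -(@gauss_convolution R _ (fun w => F (x + a * s1 * w)) (s / s1) s1^-1
      (lipschitz1_affine x _ FL)).
  - congr gauss; apply/funext => y; congr gauss; apply/funext => z.
    by congr F; field; rewrite gt_eqF.
  - by rewrite invr_gt0.
  by rewrite expr_div_n exprVn -[X in _ + X]mul1r -mulrDl ss divff // sqrf_eq0 gt_eqF.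
have gF m b : growth4 (fun z => F (m + b * z)).
  exact: lipschitz1_growth (lipschitz1_affine m b FL).
have gR : growth4 (fun y => rad a F (x + a * s * y)).
  have := growth4Z 2^-1 (growth4D (gF (x + a) (a * s)) (gF (x - a) (a * s))).
  congr growth4; apply/funext => y; rewrite /rad mulrC; congr (_ / 2).
  by congr (F _ + F _); ring.
have gG : growth4 (fun y => gauss (fun z => F ((x + a * s * y) + a * z))).
  have := lipschitz1_growth (lipschitz1_gauss (a * s) a (lipschitz1_affine x 1 FL)).
  congr growth4; apply/funext => y; congr gauss; apply/funext => z.
  by rewrite mul1r addrA.
have radE : gauss (fun y => rad a F (x + a * s * y)) =
    (gauss (fun y => F ((x + a) + a * s * y)) + gauss (fun y => F ((x - a) + a * s * y))) / 2.
  rewrite -gaussD // [RHS]mulrC -gaussZ; last exact: growth4D.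
  congr gauss; apply/funext => y; rewrite /rad [LHS]mulrC; congr (2^-1 * _).
  by congr (F _ + F _); ring.
have e1 : `|gauss (fun y => rad a F (x + a * s * y)) - gauss (fun w => F (x + a * s1 * w))| <= K.
  rewrite gconv -gaussB // (le_trans (gauss_abs _)) //.
    by apply: growth4D => //; exact: growth4N.
  rewrite -[leRHS]gauss_cst; apply: gauss_le; last first.
  - by move=> y; apply: rad_gauss_step FL FT.
  - exact: growth4_cst.
  case: (growth4D gR (growth4N gG)) => m [c h]; split; first exact: measurableT_comp.
  by exists c => z; rewrite normr_id.
move: e1 (IH (x + a)) (IH (x - a)).
rewrite radE (_ : iter n.+1 _ F x =
  (iter n (rad a) F (x + a) + iter n (rad a) F (x - a)) / 2) // -[n.+1%:R]natr1.
set u1 := gauss _; set u2 := gauss _; set u3 := gauss _.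
set v1 := iter _ _ _ _; set v2 := iter _ _ _ _.
rewrite [(_ + 1) * K]mulrDl mul1r !ler_norml.
move=> /andP[h1 h2] /andP[h3 h4] /andP[h5 h6]; apply/andP; split; lra.
Qed.

End RademacherWalk.

                                           

(** * Walks in several dimensions *)

Section VectorWalk.
Variables (R : realType) (d : nat).
Implicit Types (f : 'cV[R]_d -> R) (u v g x : 'cV[R]_d) (gs : seq 'cV[R]_d).

(** The l1 norm. It dominates [enorm], so test functions stay 1-Lipschitz, and it bounds sums of
    products of coordinates directly; the dimensional factors lost go into the constants. *)
Definition n1 u : R := \sum_i `|u i 0|.

Lemma n1_ge0 u : 0 <= n1 u. Proof. exact: sumr_ge0. Qed.

Lemma n1D u v : n1 (u + v) <= n1 u + n1 v.
Proof. by rewrite -big_split; apply: ler_sum => i _; rewrite mxE ler_normD. Qed.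

Lemma n1Z c u : n1 (c *: u) = `|c| * n1 u.
Proof. by rewrite big_distrr; apply: eq_bigr => i _; rewrite mxE normrM. Qed.

Lemma n1N u : n1 (- u) = n1 u.
Proof. by rewrite -scaleN1r n1Z normrN1 mul1r. Qed.

Lemma n1_0 : n1 0 = 0.
Proof. by rewrite -(scale0r 0) n1Z normr0 mul0r. Qed.

Lemma n1_sum (I : Type) (r : seq I) (P : pred I) (F : I -> 'cV[R]_d) :
  n1 (\sum_(i <- r | P i) F i) <= \sum_(i <- r | P i) n1 (F i).
Proof.
elim/big_rec2: _ => [|i a u _ h]; first by rewrite n1_0.
by rewrite (le_trans (n1D _ _)) // lerD2l.
Qed.

Lemma n1_coord u i : `|u i 0| <= n1 u.
Proof. by rewrite /n1 (bigD1 i) //= lerDl sumr_ge0. Qed.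

Lemma enorm_le_n1 u : enorm u <= n1 u.
Proof.
rewrite /enorm -(ger0_norm (n1_ge0 u)) -sqrtr_sqr ler_wsqrtr // expr2 big_distrl /=.
apply: ler_sum => i _; rewrite -normr_id -real_normK ?num_real // expr2 normr_id.
by rewrite ler_wpM2l // n1_coord.
Qed.

(** Cauchy-Schwarz, from the double sum of the squared differences of the |u_i|. *)
Lemma n1_sqr u : n1 u ^+ 2 <= d%:R * \sum_i u i 0 ^+ 2.
Proof.
have : 0 <= \sum_i \sum_j (`|u i 0| - `|u j 0|) ^+ 2.
  by apply: sumr_ge0 => i _; apply: sumr_ge0 => j _; exact: sqr_ge0.
have E i : \sum_j (`|u i 0| - `|u j 0|) ^+ 2 =
    d%:R * u i 0 ^+ 2 + \sum_j u j 0 ^+ 2 - 2 * n1 u * `|u i 0|.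
  rewrite (eq_bigr (fun j => u i 0 ^+ 2 + u j 0 ^+ 2 - 2 * `|u i 0| * `|u j 0|)).
    rewrite sumrB big_split /= sumr_const card_ord -big_distrr /= -/(n1 u).
    by rewrite -[u i 0 ^+ 2 *+ d]mulr_natl; ring.
  move=> j _; rewrite -(real_normK (num_real (u i 0))).
  by rewrite -(real_normK (num_real (u j 0))); ring.
under eq_bigr do rewrite E.
rewrite sumrB big_split /= sumr_const card_ord -!big_distrr /= -/(n1 u).
rewrite -[_ *+ d]mulr_natl; lra.
Qed.

Definition radv g f : 'cV[R]_d -> R := fun x => (f (x + g) + f (x - g)) / 2.

Lemma radvC g h f : radv g (radv h f) = radv h (radv g f).
Proof.
apply/funext => x; rewrite /radv (addrAC x g h) (addrAC x g (- h)).
by rewrite (addrAC x (- g) h) (addrAC x (- g) (- h)); field.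
Qed.

Definition walk gs f := foldr radv f gs.

Lemma walk_iter_radv n g gs f :
  walk gs (iter n (radv g) f) = iter n (radv g) (walk gs f).
Proof.
have walkC h : walk gs (radv g h) = radv g (walk gs h).
  by elim: gs => //= h' gs' ->; rewrite radvC.
by elim: n => // n IH; rewrite !iterS walkC IH.
Qed.

(** Steps along different directions commute, so [n] rounds through all directions can be sorted
    into [n] consecutive steps per direction. The comparison with a Gaussian thereby becomes
    one-dimensional. *)
Lemma iter_walk n gs f : iter n (walk gs) f = foldr (fun g => iter n (radv g)) f gs.
Proof.
elim: gs => [|g gs IH] /=; first by elim: n => // n IH; rewrite iterS IH.
rewrite -IH; elim: n {IH} => // n IH; rewrite !iterS IH /=; congr radv.
exact: walk_iter_radv.
Qed.

                                                                             
                               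
(** Bounds on all lines in the given directions, uniform in the base point: this form survives
    averaging over translates, hence every step of a walk. *)
Definition smooth_along (L M : R) gs f : Prop :=
  forall g x, g \in gs -> lipschitz1 L (fun t => f (x + t *: g)) /\
                          taylor3 M (fun t => f (x + t *: g)).

Lemma smooth_along_avg L M gs (I : finType) (w : I -> R) (v : I -> 'cV[R]_d) f :
  (forall k, 0 <= w k) -> \sum_k w k = 1 -> smooth_along L M gs f ->
  smooth_along L M gs (fun x => \sum_k w k * f (x + v k)).
Proof.
move=> w0 w1 Hf g x gin; split.
  move=> s t; rewrite -sumrB (le_trans (ler_norm_sum _ _ _)) //.
  rewrite -[leRHS]mul1r -w1 big_distrl; apply: ler_sum => k _ /=.
  rewrite -mulrBr normrM ger0_norm // ler_wpM2l // addrAC.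
  by rewrite (addrAC x (t *: g)); exact: (Hf g (x + v k) gin).1.
move=> t.
have /choice[c Hc] : forall k, exists c : R * R, forall s,
   `|f (x + v k + (t + s) *: g) - f (x + v k + t *: g) - c.1 * s - c.2 * s ^+ 2|
     <= M * `|s| ^+ 3.
  by move=> k; have [c1 [c2 H]] := (Hf g (x + v k) gin).2 t; exists (c1, c2).
exists (\sum_k w k * (c k).1), (\sum_k w k * (c k).2) => s.
rewrite !big_distrl /= -!sumrB (le_trans (ler_norm_sum _ _ _)) //.
rewrite -[leRHS]mul1r -w1 big_distrl; apply: ler_sum => k _ /=.
rewrite -!mulrA -!mulrBr normrM ger0_norm // ler_wpM2l //.
by rewrite (addrAC x ((t + s) *: g)) (addrAC x (t *: g)) Hc.
Qed.

Lemma smooth_along_radv L M gs g f : smooth_along L M gs f ->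
  smooth_along L M gs (radv g f).
Proof.
move=> Hf; have := @smooth_along_avg L M gs bool (fun=> 2^-1)
  (fun b => if b then g else - g) f.
have h2 : 2^-1 + 2^-1 = 1 :> R by field.
rewrite big_bool /= => /(_ _ h2 Hf) H.
have -> : radv g f = fun x => \sum_(b : bool) 2^-1 * f (x + (if b then g else - g)).
  by apply/funext => x; rewrite big_bool /radv /= -mulrDr mulrC.
by apply: H => _; rewrite invr_ge0.
Qed.

Variables (I : finType) (q c : I -> R) (e : R).
Hypothesis q_ge0 : forall k, 0 <= q k.
Hypothesis q_sum1 : \sum_k q k = 1.
Hypothesis q_gauss : forall L F, lipschitz1 L F ->
  `|\sum_k q k * F (c k) - gauss F| <= L * e.

(** [c] and [q] are nodes and weights of a finite quadrature for the standard Gaussian, with error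
    [e] per unit of Lipschitz constant; this average stands for a Gaussian increment along [g]. *)
Definition favg g f : 'cV[R]_d -> R := fun x => \sum_k q k * f (x + c k *: g).

Lemma iter_radv_line a n g f x t :
  iter n (radv (a *: g)) f (x + t *: g) = iter n (rad a) (fun t => f (x + t *: g)) t.
Proof.
elim: n t => // n IH t; rewrite !iterS.
transitivity ((iter n (radv (a *: g)) f (x + t *: g + a *: g)
  + iter n (radv (a *: g)) f (x + t *: g - a *: g)) / 2); first by [].
by rewrite -!addrA -scaleNr -!scalerDl !IH.
Qed.

(** In the outermost direction the walk is compared with the Gaussian on a line and then with the
    quadrature; for the remaining directions the induction hypothesis is averaged. The normalization
    of [a] makes the variance along each direction 1. *)
Lemma walk_favg L M a n gs gs' f x : 0 <= a -> a * Num.sqrt n%:R = 1 ->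
  {subset gs' <= gs} -> smooth_along L M gs f ->
  `|iter n (walk (map ( *:%R a) gs')) f x - foldr favg f gs' x|
  <= (size gs')%:R * (n%:R * (a ^+ 3 * (1 + gauss_abs3 R) * M) + L * e).
Proof.
move=> a0 an; rewrite iter_walk; elim: gs' x => [|g gs' IH] x sub Hf.
  by rewrite /= subrr normr0 mul0r.
set K := n%:R * _ + _ in IH *.
have sub' : {subset gs' <= gs} by move=> u ugs; apply: sub; rewrite inE ugs orbT.
have gin : g \in gs by apply: sub; rewrite mem_head.
rewrite /=; set W := foldr _ _ _; set G := foldr _ _ _.
have HW : smooth_along L M gs W.
  have Hit m h F : smooth_along L M gs F -> smooth_along L M gs (iter m (radv h) F).
    by move=> HF; elim: m => // m IHm; rewrite iterS; exact: smooth_along_radv.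
  by rewrite /W; elim: (gs') => //= h hs IHs; exact: Hit.
have [WL WT] := HW g x gin.
have e1 : `|iter n (radv (a *: g)) W x - favg g W x| <= K.
  have := rad_walk_gauss n 0 a0 WL WT; rewrite an.
  under [X in gauss X]eq_fun do rewrite mul1r add0r.
  have := q_gauss WL; rewrite -/(favg g W x).
  have := iter_radv_line a n g W x 0; rewrite scale0r addr0 => ->.
  rewrite /K !ler_norml => /andP[h1 h2] /andP[h3 h4]; apply/andP; split; lra.
have e2 : `|favg g W x - favg g G x| <= (size gs')%:R * K.
  rewrite -sumrB (le_trans (ler_norm_sum _ _ _)) //.
  rewrite -[leRHS]mul1r -[X in _ <= X * _]q_sum1 big_distrl; apply: ler_sum => k _ /=.
  by rewrite -mulrBr normrM (ger0_norm (q_ge0 k)) ler_wpM2l //; exact: IH.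
rewrite -[(size gs').+1%:R]natr1 [(_ + 1) * K]mulrDl mul1r [leRHS]addrC.
rewrite -[X in `|X|](subrKA (favg g W x)).
by rewrite (le_trans (ler_normD _ _)) // lerD.
Qed.

End VectorWalk.

                                                         

(** * Taylor bounds and Lindeberg's exchange *)

Section Jets.
Variables (R : realType) (d : nat).
Implicit Types (f : 'cV[R]_d -> R) (u v g x : 'cV[R]_d) (gs : seq 'cV[R]_d).

Definition lin (D1 : 'I_d -> 'cV[R]_d -> R) x u : R := \sum_i D1 i x * u i 0.

Definition quad (D2 : 'I_d -> 'I_d -> 'cV[R]_d -> R) x u : R :=
  \sum_i \sum_l D2 i l x * (u i 0 * u l 0).

(** Derivatives are replaced by their effect: coefficient functions in a Taylor bound. The
    conditions are uniform in the base point and linear in (f, D1, D2), so a walk applied to all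
    three keeps them with the same [M]. *)
Definition jet3 (M : R) f (D1 : 'I_d -> 'cV[R]_d -> R)
    (D2 : 'I_d -> 'I_d -> 'cV[R]_d -> R) : Prop :=
  [/\ forall x u, `|f (x + u) - f x - lin D1 x u - quad D2 x u / 2| <= M * n1 u ^+ 3,
      forall i l x u, `|D2 i l (x + u) - D2 i l x| <= M * n1 u
    & forall i l x, `|D2 i l x| <= M].

Lemma quad_le (D2 : 'I_d -> 'I_d -> 'cV[R]_d -> R) x u c :
  (forall i l, `|D2 i l x| <= c) -> `|quad D2 x u| <= c * n1 u ^+ 2.
Proof.
move=> Dc; rewrite (le_trans (ler_norm_sum _ _ _)) // expr2 /n1 big_distrl big_distrr /=.
apply: ler_sum => i _; rewrite (le_trans (ler_norm_sum _ _ _)) // !big_distrr /=.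
by apply: ler_sum => l _; rewrite !normrM ler_wpM2r // mulr_ge0.
Qed.

Lemma quadZ (D2 : 'I_d -> 'I_d -> 'cV[R]_d -> R) x c u :
  quad D2 x (c *: u) = c ^+ 2 * quad D2 x u.
Proof.
rewrite big_distrr; apply: eq_bigr => i _; rewrite big_distrr; apply: eq_bigr => l _.
by rewrite !mxE /=; ring.
Qed.

Lemma quadN (D2 : 'I_d -> 'I_d -> 'cV[R]_d -> R) x u : quad D2 x (- u) = quad D2 x u.
Proof. by rewrite -scaleN1r quadZ sqrrN expr1n mul1r. Qed.

Lemma linN D1 x u : lin D1 x (- u) = - lin D1 x u.
Proof. by rewrite /lin -sumrN; apply: eq_bigr => i _; rewrite mxE mulrN. Qed.

Lemma quadB (D2 : 'I_d -> 'I_d -> 'cV[R]_d -> R) x y u :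
  quad D2 x u - quad D2 y u = quad (fun i l _ => D2 i l x - D2 i l y) x u.
Proof.
rewrite -sumrB; apply: eq_bigr => i _; rewrite -sumrB; apply: eq_bigr => l _.
by rewrite mulrBl.
Qed.

Lemma jet3_radv M f D1 D2 g : jet3 M f D1 D2 ->
  jet3 M (radv g f) (fun i => radv g (D1 i)) (fun i l => radv g (D2 i l)).
Proof.
move=> [H1 H2 H3]; split=> [x u|i l x u|i l x].
- have -> : lin (fun i => radv g (D1 i)) x u = (lin D1 (x + g) u + lin D1 (x - g) u) / 2.
    rewrite -big_split big_distrl; apply: eq_bigr => i _ /=.
    by rewrite /radv; field.
  have -> : quad (fun i l => radv g (D2 i l)) x u = (quad D2 (x + g) u + quad D2 (x - g) u) / 2.
    rewrite -big_split big_distrl; apply: eq_bigr => i _ /=.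
    rewrite -big_split big_distrl; apply: eq_bigr => l _ /=.
    by rewrite /radv; field.
  have := H1 (x + g) u; have := H1 (x - g) u.
  rewrite /radv (addrAC x u g) (addrAC x u (- g)) !ler_norml.
  by move=> /andP[h1 h2] /andP[h3 h4]; apply/andP; split; lra.
- have := H2 i l (x + g) u; have := H2 i l (x - g) u.
  rewrite /radv (addrAC x u g) (addrAC x u (- g)) !ler_norml.
  by move=> /andP[h1 h2] /andP[h3 h4]; apply/andP; split; lra.
have := H3 i l (x + g); have := H3 i l (x - g); rewrite /radv !ler_norml.
by move=> /andP[h1 h2] /andP[h3 h4]; apply/andP; split; lra.
Qed.

Lemma jet3_walk M f D1 D2 gs : jet3 M f D1 D2 ->
  jet3 M (walk gs f) (fun i => walk gs (D1 i)) (fun i l => walk gs (D2 i l)).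
Proof. by move=> H; elim: gs => //= g gs; exact: jet3_radv. Qed.

Lemma jet3_iter_walk M f D1 D2 gs n : jet3 M f D1 D2 ->
  jet3 M (iter n (walk gs) f) (fun i => iter n (walk gs) (D1 i))
    (fun i l => iter n (walk gs) (D2 i l)).
Proof. by move=> H; elim: n => //= n; exact: jet3_walk. Qed.

Lemma walk_lipschitz M f gs x : 0 <= M -> (forall x u, `|f (x + u) - f x| <= M * n1 u) ->
  `|walk gs f x - f x| <= M * \sum_(g <- gs) n1 g.
Proof.
move=> M0 Hf; elim: gs x => [|g gs IH] x /=; first by rewrite big_nil subrr normr0 mulr0.
rewrite big_cons mulrDr.
have := IH (x + g); have := IH (x - g); have := Hf x g; have := Hf x (- g).
rewrite n1N /radv !ler_norml.
move=> /andP[h1 h2] /andP[h3 h4] /andP[h5 h6] /andP[h7 h8]; apply/andP; split; lra.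
Qed.

Lemma jet3_sum_n1_ge0 gs : 0 <= \sum_(g <- gs) n1 g.
Proof. by apply: sumr_ge0 => g _; exact: n1_ge0. Qed.

Lemma sum_n1_sqr gs : \sum_(g <- gs) n1 g ^+ 2 <= (\sum_(g <- gs) n1 g) ^+ 2.
Proof.
elim: gs => [|g gs IH]; first by rewrite !big_nil expr2 mulr0.
rewrite !big_cons sqrrD; apply: (@le_trans _ _ (n1 g ^+ 2 + (\sum_(g <- gs) n1 g) ^+ 2)).
  by rewrite lerD2l.
rewrite lerD2r lerDl mulrn_wge0 // mulr_ge0 ?n1_ge0 //; exact: jet3_sum_n1_ge0.
Qed.

(** The linear terms of +g and -g cancel and the quadratic ones remain; the Lipschitz bound on [D2]
    moves their base point back to [x]. *)
Lemma walk_taylor M f D1 D2 gs x : 0 <= M -> jet3 M f D1 D2 ->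
  `|walk gs f x - f x - (\sum_(g <- gs) quad D2 x g) / 2|
  <= M * (\sum_(g <- gs) n1 g) ^+ 3.
Proof.
move=> M0 [H1 H2 H3]; elim: gs x => [|g gs IH] x /=.
  by rewrite !big_nil subrr mul0r subr0 normr0 expr0n mulr0.
rewrite !big_cons; set s := \sum_(h <- gs) n1 h in IH *; set a := n1 g.
have s_ge0 : 0 <= s := jet3_sum_n1_ge0 gs.
have a_ge0 : 0 <= a := n1_ge0 g.
have Q y : n1 (y - x) = a -> `|\sum_(h <- gs) quad D2 y h - \sum_(h <- gs) quad D2 x h| <= M * a * s ^+ 2.
  move=> yx; rewrite -sumrB (le_trans (ler_norm_sum _ _ _)) //.
  apply: (@le_trans _ _ (M * a * \sum_(h <- gs) n1 h ^+ 2)); last first.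
    by rewrite ler_wpM2l ?mulr_ge0 // sum_n1_sqr.
  rewrite big_distrr; apply: ler_sum => h _ /=; rewrite quadB; apply: quad_le => i l.
  by rewrite -yx -{1}(subrK x y) addrC addrC [y - x + x]addrC; exact: H2.
have Qp := Q (x + g); have Qm := Q (x - g).
rewrite addrAC subrr add0r in Qp; rewrite addrAC subrr add0r n1N in Qm.
have := IH (x + g); have := IH (x - g); have := H1 x g; have := H1 x (- g).
have := Qp erefl; have := Qm erefl.
have -> : M * (a + s) ^+ 3 = M * a ^+ 3 + M * s ^+ 3 + 3 * (M * a * s ^+ 2) + 3 * (M * a ^+ 2 * s) by ring.
have p1 : 0 <= M * a * s ^+ 2 by rewrite !mulr_ge0 // exprn_ge0.
have p2 : 0 <= M * a ^+ 2 * s by rewrite !mulr_ge0 // exprn_ge0.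
rewrite linN quadN n1N /radv -/a; move: (lin _ _ _) (quad _ _ _) => lg qg.
move: (\sum_(h <- gs) quad D2 x h) (\sum_(h <- gs) quad D2 _ h) (\sum_(h <- gs) quad D2 _ h) => q1 q2 q3.
rewrite !ler_norml => /andP[h1 h2] /andP[h3 h4] /andP[h5 h6] /andP[h7 h8] /andP[k1 k2] /andP[k3 k4].
by apply/andP; split; lra.
Qed.

End Jets.

Section Lindeberg.
Variables (R : realType) (S : finType) (d : nat) (p : S -> S -> R) (mu : S -> R).
Hypothesis p_st : stochastic p.
Hypothesis mu_ge0 : forall x, 0 <= mu x.
Hypothesis mu_sum1 : \sum_x mu x = 1.

Lemma EP_bound k phi c : (forall x, `|phi x| <= c) -> `|EP p mu k phi| <= c.
Proof.
move=> H; rewrite (le_trans (EP_abs p_st mu_ge0 _ _)) //.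
by rewrite -[leRHS](EP_cst p_st mu_sum1 k); exact: EP_le.
Qed.

Lemma EP_close k phi psi c : (forall x, `|phi x - psi x| <= c) ->
  `|EP p mu k phi - EP p mu k psi| <= c.
Proof. by move=> H; rewrite -EPB; exact: EP_bound. Qed.

Lemma EP_sum2 k (F : 'I_d -> 'I_d -> (nat -> S) -> R) :
  EP p mu k (fun x => \sum_i \sum_l F i l x) = \sum_i \sum_l EP p mu k (F i l).
Proof. by rewrite EP_sum; apply: eq_bigr => i _; rewrite EP_sum. Qed.

Variables (m : S -> S -> 'cV[R]_d) (gs : seq 'cV[R]_d) (U : 'I_d -> 'I_d -> S -> R).
Hypothesis m_mart : forall x i, \sum_y p x y * m x y i 0 = 0.

Let Gam x i l : R := \sum_y p x y * (m x y i 0 * m x y l 0).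

Hypothesis U_poisson : forall i l x, U i l x - \sum_y p x y * U i l y =
  Gam x i l - \sum_(g <- gs) g i 0 * g l 0.

Variables (cm cu : R).
Hypothesis cm_ge0 : 0 <= cm.
Hypothesis cu_ge0 : 0 <= cu.
Hypothesis m_le : forall x y, n1 (m x y) <= cm.
Hypothesis U_le : forall i l x, `|U i l x| <= cu.

Let s0 : R := \sum_(g <- gs) n1 g.

(** The sum starts at 1, as does the average of the iterates. It involves states up to [x k.+1],
    which is why expectations are taken at time [n.+1]. *)
Definition mart_sum (a : R) (k : nat) (x : nat -> S) : 'cV[R]_d :=
  \sum_(1 <= j < k.+1) a *: m (x j) (x j.+1).

Lemma mart_sumS a k x : mart_sum a k.+1 x = mart_sum a k x + a *: m (x k.+1) (x k.+2).
Proof. by rewrite /mart_sum big_nat_recr. Qed.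

Lemma mart_sum_adapted a k : adapted k.+1 (mart_sum a k).
Proof.
move=> x y xy; apply: eq_big_nat => j /andP[_ jk].
by rewrite !xy // ltnW.
Qed.

Variables (M a : R) (f : 'cV[R]_d -> R) (D1 : 'I_d -> 'cV[R]_d -> R)
  (D2 : 'I_d -> 'I_d -> 'cV[R]_d -> R) (n : nat).
Hypothesis M_ge0 : 0 <= M.
Hypothesis a_ge0 : 0 <= a.
Hypothesis f_jet : jet3 M f D1 D2.

Let K := walk (map ( *:%R a) gs).
Let E := EP p mu n.+1.
(** Hybrid of the exchange: [k] martingale increments followed by [n - k] rounds of the walk. *)
Let T k := E (fun x => iter (n - k) K f (mart_sum a k x)).
Let Dk k i l := iter (n - k) K (D2 i l).
(** Corrector for the fluctuation of the conditional covariance: the Poisson solution paired with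
    the second-order coefficients of the remaining walk. *)
Let Qk k : R := a ^+ 2 / 2 *
  \sum_i \sum_l E (fun x => U i l (x k.+1) * Dk k i l (mart_sum a k x)).

Lemma sum_scaled_n1 : \sum_(g <- map ( *:%R a) gs) n1 g = a * s0.
Proof.
rewrite big_map big_distrr; apply: eq_bigr => g _.
by rewrite n1Z ger0_norm.
Qed.

(** First-order terms vanish by the martingale property. The second-order ones leave the conditional
    covariance minus its target, that is [U] minus its one-step average; under the expectation this
    average becomes [U] at [x k.+2]. Up to Lipschitz errors of order [a], times a^2, the result is
    the increment of the corrector. *)
Lemma lindeberg_step k : (k < n)%N -> `|T k.+1 - T k - (Qk k - Qk k.+1)| <=
  M * a ^+ 3 * (cm ^+ 3 + s0 ^+ 3 + d%:R ^+ 2 * cu * (s0 + cm)).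
Proof.
move=> kn; pose W := mart_sum a k; pose phi := iter (n - k.+1) K f.
have hj : jet3 M phi (fun i => iter (n - k.+1) K (D1 i)) (Dk k.+1).
  exact: jet3_iter_walk.
set D1' := fun i => _ in hj; set D' := Dk k.+1 in hj *.
have nk : (n - k = (n - k.+1).+1)%N by rewrite -subSn.
have Wad : adapted k.+1 W := @mart_sum_adapted a k.
have n1am u v : n1 (a *: m u v) <= a * cm by rewrite n1Z ger0_norm // ler_wpM2l.
pose Psi x y := lin D1' (W x) (a *: m (x k.+1) y) + quad D' (W x) (a *: m (x k.+1) y) / 2.
have e1 : `|T k.+1 - (E (fun x => phi (W x)) + E (fun x => Psi x (x k.+2)))| <= M * (a * cm) ^+ 3.
  rewrite -EPD; apply: EP_close => x; rewrite mart_sumS -/(W x) -/phi.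
  case: hj => /(_ (W x) (a *: m (x k.+1) (x k.+2))) h _ _.
  rewrite (_ : _ - _ = phi (W x + a *: m (x k.+1) (x k.+2)) - phi (W x)
     - lin D1' (W x) (a *: m (x k.+1) (x k.+2)) - quad D' (W x) (a *: m (x k.+1) (x k.+2)) / 2).
    by rewrite (le_trans h) // ler_wpM2l // lerXn2r ?nnegrE ?n1_ge0 // (le_trans (n1_ge0 _) (n1am (x k.+1) (x k.+2))).
  by rewrite /Psi; ring.
have PsiE : E (fun x => Psi x (x k.+2)) =
    a ^+ 2 / 2 * \sum_i \sum_l E (fun x => Gam (x k.+1) i l * D' i l (W x)).
  rewrite /E EP_markov //; last first.
    by move=> y u v uv; rewrite /Psi (Wad u v uv) uv.
  rewrite -EP_sum2 -EPZ; apply: EP_ext => x.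
  under eq_bigr do rewrite mulrDr; rewrite big_split /=.
  rewrite [X in X + _](_ : _ = 0) ?add0r; last first.
    rewrite /lin; under eq_bigr do rewrite big_distrr /=.
    rewrite exchange_big big1 //= => i _.
    rewrite (eq_bigr (fun y => D1' i (W x) * a * (p (x k.+1) y * m (x k.+1) y i 0))).
      by rewrite -big_distrr /= m_mart mulr0.
    by move=> y _; rewrite mxE; ring.
  under eq_bigr do rewrite quadZ.
  rewrite (eq_bigr (fun y => \sum_i \sum_l a ^+ 2 / 2 * (p (x k.+1) y *
     (m (x k.+1) y i 0 * m (x k.+1) y l 0) * D' i l (W x)))); last first.
    move=> y _; rewrite /quad !big_distrr big_distrl big_distrr; apply: eq_bigr => i _ /=.
    rewrite !big_distrr big_distrl big_distrr; apply: eq_bigr => l _ /=; ring.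
  rewrite exchange_big big_distrr; apply: eq_bigr => i _ /=.
  rewrite exchange_big big_distrr; apply: eq_bigr => l _ /=.
  by rewrite -big_distrr -big_distrl.
have e2 : `|T k - (E (fun x => phi (W x)) + a ^+ 2 / 2 * \sum_i \sum_l
    E (fun x => (\sum_(g <- gs) g i 0 * g l 0) * D' i l (W x)))| <= M * (a * s0) ^+ 3.
  rewrite -EP_sum2 -EPZ -EPD; apply: EP_close => x; rewrite nk iterS -/phi.
  have := walk_taylor (map ( *:%R a) gs) (W x) M_ge0 hj; rewrite sum_scaled_n1.
  congr (`|_| <= _); rewrite opprD addrA; congr (_ - _).
  rewrite big_map; under eq_bigr do rewrite quadZ.
  rewrite -big_distrr mulrAC; congr (_ * _).
  rewrite exchange_big; apply: eq_bigr => i _; rewrite exchange_big; apply: eq_bigr => l _ /=.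
  by rewrite big_distrl; apply: eq_bigr => g _ /=; rewrite mulrC.
have dcu : d%:R ^+ 2 * cu = \sum_(i < d) \sum_(l < d) cu.
  by rewrite !sumr_const !card_ord -mulrnA -[RHS]mulr_natl natrM expr2.
have e3 i l : `|(E (fun x => Gam (x k.+1) i l * D' i l (W x))
    - E (fun x => (\sum_(g <- gs) g i 0 * g l 0) * D' i l (W x)))
    - (E (fun x => U i l (x k.+1) * Dk k i l (W x))
       - E (fun x => U i l (x k.+2) * D' i l (mart_sum a k.+1 x)))|
    <= cu * (M * (a * s0) + M * (a * cm)).
  have D'_lip : forall x u, `|D' i l (x + u) - D' i l x| <= M * n1 u.
    by case: hj => _ h _ x u; exact: h.
  have -> : E (fun x => Gam (x k.+1) i l * D' i l (W x))
    - E (fun x => (\sum_(g <- gs) g i 0 * g l 0) * D' i l (W x)) =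
    E (fun x => U i l (x k.+1) * D' i l (W x)) - E (fun x => U i l (x k.+2) * D' i l (W x)).
    rewrite {4}/E (@EP_markov _ _ _ _ p_st k.+1 _ (fun x y => U i l y * D' i l (W x))) //; last first.
      by move=> y u v uv; rewrite (Wad u v uv).
    rewrite -!EPB; apply: EP_ext => x.
    rewrite -mulrBl -U_poisson mulrBl; congr (_ - _).
    by rewrite big_distrl; apply: eq_bigr => y _ /=; rewrite mulrA.
  rewrite -!EPB; apply: EP_bound => x.
  rewrite (_ : _ - _ = U i l (x k.+1) * - (Dk k i l (W x) - D' i l (W x))
     + U i l (x k.+2) * (D' i l (mart_sum a k.+1 x) - D' i l (W x))); last by ring.
  rewrite (le_trans (ler_normD _ _)) // !normrM normrN mulrDr lerD // ler_pM //.
    rewrite /Dk nk iterS -sum_scaled_n1.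
    exact: walk_lipschitz.
  by rewrite mart_sumS (le_trans (D'_lip _ _)) // ler_wpM2l.
have e4 : `|a ^+ 2 / 2 * (\sum_i \sum_l E (fun x => Gam (x k.+1) i l * D' i l (W x))
     - \sum_i \sum_l E (fun x => (\sum_(g <- gs) g i 0 * g l 0) * D' i l (W x)))
    - (Qk k - Qk k.+1)| <= a ^+ 2 / 2 * (d%:R ^+ 2 * cu * (M * (a * s0) + M * (a * cm))).
  rewrite /Qk -!mulrBr normrM ger0_norm ?divr_ge0 ?exprn_ge0 // ler_wpM2l ?divr_ge0 ?exprn_ge0 //.
  rewrite dcu [leRHS]big_distrl -!sumrB (le_trans (ler_norm_sum _ _ _)) //.
  apply: ler_sum => i _; rewrite big_distrl -!sumrB (le_trans (ler_norm_sum _ _ _)) //.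
  by apply: ler_sum => l _; exact: e3.
rewrite PsiE in e1; move: e1 e2 e4; rewrite !ler_norml.
have s0_ge0 : 0 <= s0 := jet3_sum_n1_ge0 gs.
have extra : 0 <= M * a ^+ 3 * (d%:R ^+ 2 * cu * (s0 + cm)).
  by rewrite !mulr_ge0 ?addr_ge0 ?exprn_ge0.
move=> /andP[h1 h2] /andP[h3 h4] /andP[h5 h6]; apply/andP; split; lra.
Qed.

(** The steps telescope and leave two boundary correctors, of order a^2 only. *)
Lemma lindeberg : `|E (fun x => f (mart_sum a n x)) - iter n K f 0| <=
  M * (n%:R * a ^+ 3 + a ^+ 2) *
  (cm ^+ 3 + s0 ^+ 3 + d%:R ^+ 2 * cu * (s0 + cm) + d%:R ^+ 2 * cu).
Proof.
set kap := cm ^+ 3 + s0 ^+ 3 + d%:R ^+ 2 * cu * (s0 + cm).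
have tele k : (k <= n)%N -> `|T k - T 0%N - (Qk 0%N - Qk k)| <= k%:R * (M * a ^+ 3 * kap).
  elim: k => [_|k IH kn]; first by rewrite !subrr mul0r normr0.
  have := IH (ltnW kn); have := lindeberg_step kn; rewrite -/kap.
  rewrite -[k.+1%:R]natr1 [(_ + 1) * _]mulrDl mul1r !ler_norml.
  by move=> /andP[h1 h2] /andP[h3 h4]; apply/andP; split; lra.
have Q_le k : `|Qk k| <= a ^+ 2 / 2 * (d%:R ^+ 2 * cu * M).
  rewrite /Qk normrM ger0_norm ?divr_ge0 ?exprn_ge0 // ler_wpM2l ?divr_ge0 ?exprn_ge0 //.
  have -> : d%:R ^+ 2 * cu * M = \sum_(i < d) \sum_(l < d) cu * M.
    by rewrite !sumr_const !card_ord -mulrnA -[RHS]mulr_natl natrM expr2 mulrA.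
  rewrite (le_trans (ler_norm_sum _ _ _)) //; apply: ler_sum => i _.
  rewrite (le_trans (ler_norm_sum _ _ _)) //; apply: ler_sum => l _.
  apply: EP_bound => x; rewrite normrM ler_pM //.
  by have [_ _] := jet3_iter_walk (map ( *:%R a) gs) (n - k) f_jet; exact.
have := tele n (leqnn n); have := Q_le 0%N; have := Q_le n.
have -> : T n = E (fun x => f (mart_sum a n x)) by rewrite /T subnn.
have -> : T 0%N = iter n K f 0.
  rewrite /T subn0 -[RHS](EP_cst p_st mu_sum1 n.+1); apply: EP_ext => x.
  by rewrite /mart_sum big_geq.
have s0_ge0 : 0 <= s0 := jet3_sum_n1_ge0 gs.
have kap_ge0 : 0 <= kap by rewrite !addr_ge0 ?mulr_ge0 ?addr_ge0 ?exprn_ge0.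
have p1 : 0 <= M * a ^+ 2 * kap by rewrite !mulr_ge0 ?exprn_ge0.
have p2 : 0 <= M * n%:R * a ^+ 3 * (d%:R ^+ 2 * cu) by rewrite !mulr_ge0 ?exprn_ge0.
rewrite !ler_norml => /andP[h1 h2] /andP[h3 h4] /andP[h5 h6]; apply/andP; split; lra.
Qed.

End Lindeberg.

                                       

(** * Spline smoothing of Lipschitz functions *)

Section CubicStep.
Variable R : realType.
Implicit Types (y t : R).

Definition ppart y : R := Num.max y 0.

(** The truncated power y_+^3 and its first two derivatives. Every order above 1 returns the second
    derivative, whence the conditions [al <= 2] in what follows. *)
Definition pcube (al : nat) y : R :=
  match al with 0%N => ppart y ^+ 3 | 1%N => 3 * ppart y ^+ 2 | _ => 6 * ppart y end.

                                                                     
                  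
(** The distribution function of a sum of three independent uniform variables on [0, 1], and its
    derivatives: a third difference of y_+^3 / 6, equal to 0 left of 0 and to 1 right of 3, with
    Lipschitz second derivative. *)
Definition cstep (al : nat) y : R :=
  (pcube al y - 3 * pcube al (y - 1) + 3 * pcube al (y - 2) - pcube al (y - 3)) / 6.

Lemma ppart_cases y : (ppart y = y /\ 0 <= y) \/ (ppart y = 0 /\ y <= 0).
Proof. by rewrite /ppart; case: (leP y 0) => h; [right|left; split=> //; exact: ltW]. Qed.

Lemma pcube_taylor y t :
  `|pcube 0 (y + t) - pcube 0 y - pcube 1 y * t - pcube 2 y / 2 * t ^+ 2| <= `|t| ^+ 3 /\
  `|pcube 1 (y + t) - pcube 1 y - pcube 2 y * t| <= 3 * t ^+ 2 /\
  `|pcube 2 (y + t) - pcube 2 y| <= 6 * `|t|.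
Proof.
have mono (u v : R) : 0 <= u -> 0 <= v -> 0 <= u ^+ 3 /\ 0 <= v ^+ 3 /\ 0 <= u ^+ 2 * v /\
    0 <= u * v ^+ 2 /\ 0 <= u ^+ 2 /\ 0 <= v ^+ 2 /\ 0 <= u * v.
  by move=> u0 v0; rewrite !mulr_ge0 ?exprn_ge0.
rewrite /pcube; case: (ppart_cases y) => -[-> hy]; case: (ppart_cases (y + t)) => -[-> hyt].
- have -> : (y + t) ^+ 3 - y ^+ 3 - 3 * y ^+ 2 * t - 6 * y / 2 * t ^+ 2 = t ^+ 3 by field.
  have -> : 3 * (y + t) ^+ 2 - 3 * y ^+ 2 - 6 * y * t = 3 * t ^+ 2 by ring.
  have -> : 6 * (y + t) - 6 * y = 6 * t by ring.
  split; first by rewrite normrX.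
  split; first by rewrite ger0_norm // mulr_ge0 ?sqr_ge0.
  by rewrite normrM ger0_norm.
- have t0 : t <= 0 by lra.
  rewrite (ler0_norm t0) !ler_norml.
  have [v v0 ->] : exists2 v, 0 <= v & t = - (y + v) by exists (- t - y); lra.
  have [? [? [? [? [? [? ?]]]]]] := mono _ _ hy v0.
  by rewrite !expr0n /=; split; [|split]; apply/andP; split; lra.
- have t0 : 0 <= t by lra.
  rewrite (ger0_norm t0) !ler_norml.
  have [v v0 ->] : exists2 v, 0 <= v & t = - y + v by exists (t + y); lra.
  have ny : 0 <= - y by lra.
  have [? [? [? [? [? [? ?]]]]]] := mono _ _ ny v0.
  by rewrite !expr0n /=; split; [|split]; apply/andP; split; lra.
have t3 : 0 <= `|t| ^+ 3 by rewrite exprn_ge0.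
have t2 := sqr_ge0 t; have t1 := normr_ge0 t.
rewrite !expr0n /= !(mulr0, mul0r, subr0) normr0.
by split=> //; split; nra.
Qed.

Lemma cstep_left al y : y <= 0 -> cstep al y = 0.
Proof.
move=> y0; have e z : z <= 0 -> pcube al z = 0.
  move=> z0; rewrite /pcube; have -> : ppart z = 0 by rewrite /ppart; case: ltP => //; lra.
  by case: al => [|[|?]]; rewrite ?expr0n ?mulr0.
by rewrite /cstep !e; try lra.
Qed.

Lemma cstep_right al y : (al <= 2)%N -> 3 <= y -> cstep al y = (al == 0%N)%:R.
Proof.
move=> al2 y3; have e z : 0 <= z -> ppart z = z by move=> z0; rewrite /ppart; case: ltP => //; lra.
rewrite /cstep /pcube !e; try lra.
by case: al al2 => [|[|[|]]] // _ /=; field.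
Qed.

(** Between 0 and 3 each truncated power is at most 27 and the last one vanishes: (27 + 81) / 6 =
    18. *)
Lemma cstep_bound al y : (al <= 2)%N -> `|cstep al y| <= 18.
Proof.
move=> al2; have [y0|y0] := leP y 0; first by rewrite cstep_left // normr0.
have [y3|y3] := leP 3 y; first by rewrite cstep_right // ger0_norm ?ler0n //; case: (al == 0%N) => /=; lra.
have e z : z <= 3 -> 0 <= pcube al z <= 27.
  move=> z3; have : 0 <= ppart z <= 3.
    by rewrite /ppart; case: (leP z 0) => h; apply/andP; split; lra.
  case/andP; rewrite /pcube; move: (ppart z) => w w0 w3.
  have w2 : w ^+ 2 <= 9 by nra.
  have w3' : w ^+ 3 <= 27 by rewrite exprS; nra.
  have w2' : 0 <= w ^+ 2 by rewrite exprn_ge0.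
  have w3'' : 0 <= w ^+ 3 by rewrite exprn_ge0.
  by case: al al2 => [|[|[|]]] // _; apply/andP; split; lra.
have [] : [/\ 0 <= pcube al y <= 27, 0 <= pcube al (y - 1) <= 27,
   0 <= pcube al (y - 2) <= 27 & pcube al (y - 3) = 0].
  split; try (by apply: e; lra).
  rewrite /pcube (_ : ppart (y - 3) = 0).
    by case: al al2 {e} => [|[|[|]]] // _; rewrite ?expr0n ?mulr0.
  by rewrite /ppart; case: ltP => //; lra.
rewrite /cstep ler_norml => /andP[a1 a2] /andP[b1 b2] /andP[c1 c2] ->.
by apply/andP; split; lra.
Qed.

(** The weights 1, 3, 3, 1 over 6 multiply the errors 1, 3 and 6 of a single truncated power by 4/3;
    the first product is rounded up to 2. *)
Lemma cstep_taylor y t :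
  [/\ `|cstep 0 (y + t) - cstep 0 y - cstep 1 y * t - cstep 2 y / 2 * t ^+ 2| <= 2 * `|t| ^+ 3,
      `|cstep 1 (y + t) - cstep 1 y - cstep 2 y * t| <= 4 * t ^+ 2
    & `|cstep 2 (y + t) - cstep 2 y| <= 8 * `|t|].
Proof.
have [a0 [a1 a2]] := pcube_taylor y t.
have [b0 [b1 b2]] := pcube_taylor (y - 1) t.
have [c0 [c1 c2]] := pcube_taylor (y - 2) t.
have [d0 [d1 d2]] := pcube_taylor (y - 3) t.
rewrite /cstep !(addrAC y t); move: a0 a1 a2 b0 b1 b2 c0 c1 c2 d0 d1 d2.
have t3 : 0 <= `|t| ^+ 3 by rewrite exprn_ge0.
have t2 := sqr_ge0 t; have t1 := normr_ge0 t.
rewrite !ler_norml.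
move=> /andP[? ?] /andP[? ?] /andP[? ?] /andP[? ?] /andP[? ?] /andP[? ?].
move=> /andP[? ?] /andP[? ?] /andP[? ?] /andP[? ?] /andP[? ?] /andP[? ?].
by split; apply/andP; split; lra.
Qed.

                                                                          
                                   
(** [b 0], [b 1] and [b 2] act as a function and its derivatives. Remainders of several orders share
    one constant because the product rule for tensor products consumes them all. *)
Definition jet1 (c : R) (b : nat -> R -> R) : Prop :=
  (forall al y, (al <= 2)%N -> `|b al y| <= c) /\
  forall y t,
  [/\ `|b 0%N (y + t) - b 0%N y - b 1%N y * t - b 2%N y / 2 * t ^+ 2| <= c * `|t| ^+ 3,
      `|b 0%N (y + t) - b 0%N y - b 1%N y * t| <= c * t ^+ 2
    & forall al, (al <= 2)%N -> `|b al (y + t) - b al y| <= c * `|t|].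

Lemma cstep_jet1 z : jet1 60 (fun al y => cstep al (y - z)).
Proof.
split=> [al y al2|y t]; first by rewrite (le_trans (cstep_bound _ al2)) //; lra.
rewrite /= (addrAC y t); move: (y - z) => {}y; have [h0 h1 h2] := cstep_taylor y t.
have b0 := @cstep_bound 0 y isT; have b1 := @cstep_bound 1 y isT.
have b2 := @cstep_bound 2 y isT.
have b0' := @cstep_bound 0 (y + t) isT; have b1' := @cstep_bound 1 (y + t) isT.
have t1 := normr_ge0 t; have tt : t ^+ 2 = `|t| ^+ 2 by rewrite real_normK ?num_real.
have bt (x c : R) : `|x| <= c -> `|x * t| <= c * `|t|.
  by move=> xc; rewrite normrM ler_wpM2r.
have b1t := bt _ _ b1; have b2t := bt _ _ b2.
have b2tt : `|cstep 2 y / 2 * t ^+ 2| <= 9 * `|t| ^+ 2.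
  rewrite normrM normrX ler_wpM2r ?exprn_ge0 //.
  by rewrite normrM (ger0_norm (_ : 0 <= 2^-1)) //; lra.
have b2' := @cstep_bound 2 (y + t) isT.
rewrite tt in h1 b2tt h0 *; set w := `|t| in t1 h0 h1 h2 b1t b2t b2tt *.
(* Steps below 1 use the Taylor bounds; for longer ones boundedness gives at worst 18 + 18 + 18 |t|
   <= 54 t^2, which 60 covers. *)
have cmp : (w <= 1 /\ w ^+ 2 <= w /\ w ^+ 3 <= w ^+ 2) \/
           (1 <= w /\ w <= w ^+ 2 /\ w ^+ 2 <= w ^+ 3).
  by have [h|h] := leP w 1; [left|right]; split; try split; nra.
have w2 : 0 <= w ^+ 2 by rewrite exprn_ge0.
have w3 : 0 <= w ^+ 3 by rewrite exprn_ge0.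
move: h0 h1 h2 b0 b1 b2 b0' b1' b2' b1t b2t b2tt.
set l1 := cstep 1 y * t; set l2 := cstep 2 y * t; set q := cstep 2 y / 2 * w ^+ 2.
rewrite !ler_norml => /andP[? ?] /andP[? ?] /andP[? ?] /andP[? ?] /andP[? ?] /andP[? ?].
move=> /andP[? ?] /andP[? ?] /andP[? ?] /andP[? ?] /andP[? ?] /andP[? ?].
split; first by apply/andP; split; lra.
  by apply/andP; case: cmp => -[? [? ?]]; split; lra.
case=> [|[|[|//]]] _; rewrite ler_norml; apply/andP; case: cmp => -[? [? ?]]; split; lra.
Qed.

End CubicStep.

Section ProductJets.
Variables (R : realType) (I : eqType) (c : R) (b : I -> nat -> R -> R).
Hypothesis c_ge1 : 1 <= c.
Hypothesis b_jet : forall j, jet1 c (b j).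
Variables (y t : I -> R).

(** The multi-indices e_i and e_i + e_l; with them [pjet] is a partial derivative of first or second
    order of the tensor product. *)
Definition delta1 (i : I) : I -> nat := fun j => (i == j).
Definition delta2 (i l : I) : I -> nat := fun j => ((i == j) + (l == j))%N.

Definition pjet (r : seq I) (al : I -> nat) : R := \prod_(j <- r) b j (al j) (y j).

Lemma pjet_ext r al al' : {in r, al =1 al'} -> pjet r al = pjet r al'.
Proof. by move=> h; apply: eq_big_seq => j jr; rewrite h. Qed.

Lemma pjet_le r al : (forall j, (al j <= 2)%N) -> `|pjet r al| <= c ^+ size r.
Proof.
move=> al2; rewrite /pjet; elim: r => [|j r IH] /=; first by rewrite big_nil normr1 expr0.
by rewrite big_cons normrM exprS ler_pM //; exact: (b_jet j).1.
Qed.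

Let s (r : seq I) := \sum_(j <- r) `|t j|.
Let V (r : seq I) := \prod_(j <- r) b j 0%N (y j + t j).
Let A0 r := pjet r (fun=> 0%N).
Let L r := \sum_(i <- r) t i * pjet r (delta1 i).
Let Q r := \sum_(i <- r) \sum_(l <- r) t i * t l * pjet r (delta2 i l).

Lemma pjet_cons0 j r i : j \notin r -> i \in r ->
  pjet (j :: r) (delta1 i) = b j 0%N (y j) * pjet r (delta1 i).
Proof.
move=> jr ir; rewrite /pjet big_cons /delta1.
by have [ij|//] := eqVneq i j; rewrite -ij ir in jr.
Qed.

Lemma pjet_cons1 j r : j \notin r ->
  pjet (j :: r) (delta1 j) = b j 1%N (y j) * A0 r.
Proof.
move=> jr; rewrite /pjet big_cons /delta1 eqxx; congr (_ * _).
apply: pjet_ext => i ir; have [ij|//] := eqVneq j i.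
by rewrite ij ir in jr.
Qed.

Lemma lin_cons j r : j \notin r ->
  L (j :: r) = b j 0%N (y j) * L r + b j 1%N (y j) * t j * A0 r.
Proof.
move=> jr; rewrite /L big_cons pjet_cons1 // addrC big_distrr; congr (_ + _); last by ring.
by apply: eq_big_seq => i ir; rewrite pjet_cons0 //=; ring.
Qed.

Lemma quad_cons j r : j \notin r ->
  Q (j :: r) = b j 0%N (y j) * Q r + 2 * (b j 1%N (y j) * t j * L r)
               + b j 2%N (y j) * t j ^+ 2 * A0 r.
Proof.
move=> jr; have ne i : i \in r -> (i == j) = false.
  by move=> ir; apply/negbTE; apply: contra jr => /eqP <-.
have e0 i l : i \in r -> l \in r ->
    pjet (j :: r) (delta2 i l) = b j 0%N (y j) * pjet r (delta2 i l).
  by move=> ir lr; rewrite /pjet big_cons /delta2 !ne.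
have e1 l : l \in r -> pjet (j :: r) (delta2 j l) = b j 1%N (y j) * pjet r (delta1 l).
  move=> lr; rewrite /pjet big_cons /delta2 eqxx ne //; congr (_ * _).
  by apply: pjet_ext => i ir; rewrite eq_sym ne.
have e1' l : l \in r -> pjet (j :: r) (delta2 l j) = b j 1%N (y j) * pjet r (delta1 l).
  move=> lr; rewrite -e1 //; apply: pjet_ext => i _.
  by rewrite /delta2 addnC.
have e2 : pjet (j :: r) (delta2 j j) = b j 2%N (y j) * A0 r.
  rewrite /pjet big_cons /delta2 eqxx; congr (_ * _).
  by apply: pjet_ext => i ir; rewrite eq_sym ne.
rewrite /Q big_cons big_cons e2.
rewrite (eq_big_seq (fun l => b j 1%N (y j) * t j * (t l * pjet r (delta1 l)))); last first.
  by move=> l lr; rewrite e1 //; ring.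
rewrite -big_distrr /= -/(L r).
rewrite [X in _ + _ + X = _](eq_big_seq (fun i => b j 1%N (y j) * t j * (t i * pjet r (delta1 i))
   + b j 0%N (y j) * \sum_(l <- r) t i * t l * pjet r (delta2 i l))); last first.
  move=> i ir; rewrite big_cons e1' //; congr (_ + _); first by ring.
  by rewrite big_distrr; apply: eq_big_seq => l lr; rewrite e0 //=; ring.
by rewrite big_split -!big_distrr /= -/(L r) -/(Q r); ring.
Qed.

(** Induction on the factors. The third-order remainder of the longer product involves the
    lower-order remainders of the shorter one, so all orders are carried together. Distinct indices
    make e_j act on a single factor. *)
Lemma prod_taylor r : uniq r ->
  [/\ `|V r - A0 r| <= c ^+ size r * s r,
      `|V r - A0 r - L r| <= c ^+ size r * s r ^+ 2
    & `|V r - A0 r - L r - Q r / 2| <= c ^+ size r * s r ^+ 3].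
Proof.
have c0 : 0 <= c := le_trans ler01 c_ge1.
elim: r => [_|j r IH /andP[jr ur]].
  rewrite /V /A0 /L /Q /s /pjet !big_nil !subrr mul0r subr0 normr0 expr0 !expr0n /=.
  by rewrite mulr0.
have [h1 h2 h3] := IH ur.
have [bb bt] := b_jet j; have [t3 t2 t1] := bt (y j) (t j).
have A0E : A0 (j :: r) = b j 0%N (y j) * A0 r by rewrite /A0 /pjet big_cons.
have VE : V (j :: r) = b j 0%N (y j + t j) * V r by rewrite /V big_cons.
have sE : s (j :: r) = `|t j| + s r by rewrite /s big_cons.
have V_le : `|V r| <= c ^+ size r.
  rewrite /V; elim: (r) => [|i r' IH'] /=; first by rewrite big_nil normr1 expr0.
  by rewrite big_cons normrM exprS ler_pM //; exact: (b_jet i).1.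
have s0 : 0 <= s r by exact: sumr_ge0.
have w0 := normr_ge0 (t j).
have A0_le : `|A0 r| <= c ^+ size r by exact: pjet_le.
have b0 := bb 0%N (y j) isT; have b1 := bb 1%N (y j) isT; have b2 := bb 2%N (y j) isT.
have t1' := t1 0%N isT.
rewrite VE A0E lin_cons // quad_cons // sE [size _]/= exprS.
set K := c ^+ size r in h1 h2 h3 V_le A0_le *.
have K0 : 0 <= K by rewrite exprn_ge0.
have cK : 0 <= c * K by rewrite mulr_ge0.
have tt : t j ^+ 2 = `|t j| ^+ 2 by rewrite real_normK ?num_real.
set w := `|t j| in w0 t1' t2 t3 tt *; set sr := s r in s0 h1 h2 h3 *.
have N0 : `|b j 0%N (y j + t j) - b j 0%N (y j)| * `|V r| <= c * K * w.
  by rewrite mulrAC ler_pM.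
have Nt u : `|b j 1%N (y j) * t j| * u <= c * w * u -> True by [].
have p1 : 0 <= c * K * sr by rewrite mulr_ge0.
have p2 : 0 <= c * K * (w * sr) by rewrite !mulr_ge0.
have p3 : 0 <= c * K * (w * sr ^+ 2) by rewrite !mulr_ge0 ?exprn_ge0.
have p4 : 0 <= c * K * (w ^+ 2 * sr) by rewrite !mulr_ge0 ?exprn_ge0.
have q1 : `|b j 1%N (y j) * t j| <= c * w by rewrite normrM ler_wpM2r.
have q2 : `|b j 2%N (y j) / 2 * t j ^+ 2| <= c * w ^+ 2.
  rewrite normrM normrX -/w ler_wpM2r ?exprn_ge0 // normrM (le_trans _ b2) //.
  by rewrite ler_piMr // ger0_norm //; lra.
split.
- rewrite (_ : _ - _ = (b j 0%N (y j + t j) - b j 0%N (y j)) * V r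
     + b j 0%N (y j) * (V r - A0 r)); last by ring.
  rewrite (le_trans (ler_normD _ _)) // !normrM.
  apply: (@le_trans _ _ (c * w * K + c * (K * sr))); first by rewrite lerD // ler_pM.
  by rewrite le_eqVlt; apply/orP; left; apply/eqP; ring.
- rewrite (_ : _ - _ = (b j 0%N (y j + t j) - b j 0%N (y j) - b j 1%N (y j) * t j) * V r
     + (b j 1%N (y j) * t j * (V r - A0 r) + b j 0%N (y j) * (V r - A0 r - L r))); last by ring.
  rewrite (le_trans (ler_normD _ _)) // (le_trans (lerD (lexx _) (ler_normD _ _))) //.
  rewrite [X in X + _]normrM [X in _ + (X + _)]normrM [X in _ + (_ + X)]normrM.
  apply: (@le_trans _ _ (c * w ^+ 2 * K + (c * w * (K * sr) + c * (K * sr ^+ 2)))).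
    by rewrite !lerD // ler_pM // ?(le_trans t2) // tt.
  have -> : c * K * (w + sr) ^+ 2 = c * w ^+ 2 * K + (c * w * (K * sr) + c * (K * sr ^+ 2))
     + c * K * (w * sr) by ring.
  by rewrite lerDl.
rewrite (_ : _ - _ = (b j 0%N (y j + t j) - b j 0%N (y j) - b j 1%N (y j) * t j
       - b j 2%N (y j) / 2 * t j ^+ 2) * V r
     + (b j 2%N (y j) / 2 * t j ^+ 2 * (V r - A0 r)
     + (b j 1%N (y j) * t j * (V r - A0 r - L r)
     + b j 0%N (y j) * (V r - A0 r - L r - Q r / 2)))); last by field.
rewrite (le_trans (ler_normD _ _)) // (le_trans (lerD (lexx _) (ler_normD _ _))) //.
rewrite (le_trans (lerD (lexx _) (lerD (lexx _) (ler_normD _ _)))) //.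
rewrite [X in X + _]normrM [X in _ + (X + _)]normrM [X in _ + (_ + (X + _))]normrM.
rewrite [X in _ + (_ + (_ + X))]normrM.
apply: (@le_trans _ _ (c * w ^+ 3 * K + (c * w ^+ 2 * (K * sr) + (c * w * (K * sr ^+ 2) + c * (K * sr ^+ 3))))).
  by rewrite !lerD // ler_pM.
have -> : c * K * (w + sr) ^+ 3 = c * w ^+ 3 * K + (c * w ^+ 2 * (K * sr) + (c * w * (K * sr ^+ 2) + c * (K * sr ^+ 3)))
   + 2 * (c * K * (w ^+ 2 * sr)) + 2 * (c * K * (w * sr ^+ 2)) by ring.
by rewrite -addrA lerDl addr_ge0 // mulr_ge0.
Qed.

End ProductJets.

Section SplinePartition.
Variables (R : realType) (N : nat).

                                                                         
                                                 
(** Decreasing steps, from the constant 1 at index 0 to 0 beyond [N]. Their consecutive differences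
    telescope to exactly 1 on the whole line, also outside [0, N], at the price of unbounded
    supports for the first and the last one. *)
Definition sfam (k al : nat) (y : R) : R :=
  if k == 0%N then (al == 0%N)%:R
  else if (k <= N)%N then cstep al (y - k%:R) else 0.

Definition bspl (k al : nat) (y : R) : R := sfam k al y - sfam k.+1 al y.

Definition clampN (y : R) : R := Num.min (ppart y) N%:R.

Lemma bspl_sum al y : \sum_(k < N.+1) bspl k al y = (al == 0%N)%:R.
Proof.
rewrite -(big_mkord xpredT (fun k => bspl k al y)).
under eq_bigr do rewrite /bspl -opprB.
by rewrite sumrN telescope_sumr // opprB /sfam /= ltnn subr0.
Qed.

Lemma jet1_const c (a : R) : 1 <= c -> `|a| <= 1 ->
  jet1 c (fun al _ => if al == 0%N then a else 0).
Proof.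
move=> c1 a1; have c0 : 0 <= c := le_trans ler01 c1.
split=> [al y _|y t] /=.
  by case: (al == 0%N); rewrite ?normr0 // (le_trans a1).
rewrite !subrr !(mul0r, subr0) normr0; split; [by rewrite mulr_ge0 // exprn_ge0|by rewrite mulr_ge0 // sqr_ge0|].
by move=> al _; rewrite subrr normr0 mulr_ge0.
Qed.

Lemma jet1B c c' b b' : jet1 c b -> jet1 c' b' ->
  @jet1 R (c + c') (fun al y => b al y - b' al y).
Proof.
move=> [h1 h2] [g1 g2]; split=> [al y al2|y t].
  by rewrite (le_trans (ler_normB _ _)) // lerD ?h1 ?g1.
have [h3 h4 h5] := h2 y t; have [g3 g4 g5] := g2 y t.
split.
- rewrite (_ : _ - _ = (b 0%N (y + t) - b 0%N y - b 1%N y * t - b 2%N y / 2 * t ^+ 2)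
    - (b' 0%N (y + t) - b' 0%N y - b' 1%N y * t - b' 2%N y / 2 * t ^+ 2)); last by field.
  by rewrite (le_trans (ler_normB _ _)) // mulrDl lerD.
- rewrite (_ : _ - _ = (b 0%N (y + t) - b 0%N y - b 1%N y * t)
    - (b' 0%N (y + t) - b' 0%N y - b' 1%N y * t)); last by ring.
  by rewrite (le_trans (ler_normB _ _)) // mulrDl lerD.
move=> al al2; rewrite (_ : _ - _ = (b al (y + t) - b al y) - (b' al (y + t) - b' al y)); last by ring.
by rewrite (le_trans (ler_normB _ _)) // mulrDl lerD ?h5 ?g5.
Qed.

Lemma bspl_jet1 k : jet1 120 (bspl k).
Proof.
have sj m : jet1 60 (sfam m).
  rewrite /sfam; case: (m == 0%N).
    have := @jet1_const 60 1 _ _; rewrite normr1 lexx => /(_ _ isT).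
    rewrite (_ : (fun (al : nat) (_ : R) => if al == 0%N then 1 else 0) =
       (fun al _ => (al == 0%N)%:R)).
      by apply; lra.
    by apply/funext => al; case: (al == 0%N).
  case: (m <= N)%N; first exact: cstep_jet1.
  have := @jet1_const 60 0 _ _; rewrite normr0 ler01 => /(_ _ isT).
  rewrite (_ : (fun (al : nat) (_ : R) => if al == 0%N then 0 else 0) = (fun _ _ => 0)).
    by apply; lra.
  by apply/funext => al; case: (al == 0%N).
have -> : 120 = 60 + 60 :> R by ring.
exact: jet1B.
Qed.

(** A difference of two consecutive steps lives on [k, k + 4]; clamping the argument to [0, N]
    accounts for the two members with unbounded support. *)
Lemma bspl_near k al y : (al <= 2)%N -> (k <= N)%N ->
  ~~ (`|k%:R - clampN y| <= 4) -> bspl k al y = 0.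
Proof.
move=> al2 kN; rewrite -ltNge => far.
have kN' : (k%:R : R) <= N%:R by rewrite ler_nat.
have k0 : 0 <= (k%:R : R) by [].
have [yk|ky] := leP y k%:R.
  have cl_le : clampN y <= k%:R.
    rewrite /clampN ge_min; apply/orP; left; rewrite /ppart.
    by case: (leP y 0) => // h; lra.
  have kN4 : 4 < k%:R - clampN y by move: far; rewrite ger0_norm ?subr_ge0.
  have cl0 : 0 <= clampN y by rewrite /clampN le_min /ppart le_max lexx orbT ler0n.
  rewrite /bspl /sfam /=.
  have -> : (k == 0%N) = false by apply/negbTE; apply: contraTN kN4 => /eqP ->; rewrite -leNgt; lra.
  rewrite kN cstep_left ?subr_le0 //; case: (k < N)%N; rewrite ?subrr //.
  by rewrite cstep_left ?subrr // -natr1; lra.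
have [yk4|] := leP (k%:R + 4) y.
  rewrite /bspl /sfam /=; have [kN2|Nk] := ltnP k N.
    rewrite kN !(cstep_right al2); try (rewrite -?natr1; lra).
    by case: (k == 0%N); rewrite subrr.
  have kE : k = N by apply/eqP; rewrite eqn_leq kN.
  move: far; rewrite /clampN kE min_r ?subrr ?normr0; first by rewrite ltNge ler0n.
  by rewrite /ppart le_max -kE; apply/orP; left; lra.
move=> yk4; exfalso; move: far; apply/negP; rewrite -leNgt.
have py : ppart y = y by rewrite /ppart; case: (leP y 0) => // h; lra.
rewrite /clampN py ler_norml; case: (leP y N%:R) => h; apply/andP; split; lra.
Qed.

Lemma clampN_cases y : [\/ y <= 0 /\ clampN y = 0, (0 <= y /\ y <= N%:R) /\ clampN y = y
  | N%:R <= y /\ clampN y = N%:R].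
Proof.
have h4 : 0 <= (N%:R : R) by [].
rewrite /clampN /ppart; case: (leP y 0) => h.
  by constructor 1; rewrite min_l.
case: (leP y N%:R) => h'; first by constructor 2; split=> //; split=> //; exact: ltW.
by constructor 3; split=> //; exact: ltW.
Qed.

Lemma clampN_lip y t : `|clampN (y + t) - clampN y| <= `|t|.
Proof.
have h1 := ler_norm t; have h2 : - t <= `|t| by rewrite -normrN ler_norm.
have h3 := normr_ge0 t; have h4 : 0 <= (N%:R : R) by [].
rewrite ler_norml.
by case: (clampN_cases y) => -[? ->]; case: (clampN_cases (y + t)) => -[? ->];
  apply/andP; split; lra.
Qed.

(** An interval of radius 6 holds at most 2 * 6 + 1 integers. Radius 6 in place of 4 leaves room for
    a displacement of the point by 1. *)
Lemma count_near n (v : R) : \sum_(m < n) (`|m%:R - v| <= 6)%R%:R <= (13%:R : R).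
Proof.
rewrite -natr_sum ler_nat.
pose near6 (m : 'I_n) : bool := `|m%:R - v| <= 6.
pose A := [set m | near6 m]%SET.
have -> : (\sum_(m < n) nat_of_bool (near6 m) = #|A|)%N.
  rewrite -sum1_card [RHS]big_mkcond /=; apply: eq_bigr => m _; rewrite inE.
  by case: (near6 m).
have [->|[m0 m0A]] := set_0Vmem A; first by rewrite cards0.
have [m1 m1A m1min] := arg_minnP (fun m : 'I_n => nat_of_ord m) m0A.
have nearA m : m \in A -> -6 <= m%:R - v <= 6.
  by rewrite inE /near6 ler_norml.
have range m : m \in A -> (m1 <= m < m1 + 13)%N.
  move=> mA; rewrite m1min //=.
  have /andP[_ h1] := nearA _ mA; have /andP[h2 _] := nearA _ m1A.
  by rewrite -(ltr_nat R) natrD; lra.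
have inj : {in A &, injective (fun m : 'I_n => inord (m - m1) : 'I_13)}.
  move=> m m' mA m'A /(congr1 (@nat_of_ord _)).
  have /andP[a1 a2] := range _ mA; have /andP[b1 b2] := range _ m'A.
  rewrite !inordK ?ltn_subLR // => h; apply/val_inj => /=.
  by rewrite -(subnK a1) h subnK.
by rewrite -(card_in_imset inj) (leq_trans (max_card _)) // card_ord.
Qed.

End SplinePartition.

Section SplineSmoothing.
Variables (R : realType) (d B : nat) (h : 'cV[R]_d -> R).
Hypothesis h_lip : forall x y, `|h x - h y| <= n1 (x - y).

Notation N := (B + B)%N.
Notation idx := {ffun 'I_d -> 'I_N.+1}.

Definition node (k : idx) : 'cV[R]_d := \col_j ((k j : nat)%:R - B%:R).
Definition clampv (x : 'cV[R]_d) : 'cV[R]_d := \col_j (clampN N (x j 0 + B%:R) - B%:R).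
Definition tensor_bspl (k : idx) (al : 'I_d -> nat) (x : 'cV[R]_d) : R :=
  \prod_j bspl N (k j) (al j) (x j 0 + B%:R).
(** Quasi-interpolation: values of [h] at the integer nodes of the cube [-B, B]^d, blended by a
    tensor partition of unity; [al] selects a partial derivative. *)
Definition spline (al : 'I_d -> nat) (x : 'cV[R]_d) : R :=
  \sum_k h (node k) * tensor_bspl k al x.

Let near (k : idx) (x : 'cV[R]_d) : bool :=
  [forall j, `|(k j : nat)%:R - clampN N (x j 0 + B%:R)| <= 6].
Let cd : R := 120 ^+ d.
(** At most 13^d nodes are near a point, each with weight at most [cd] and a value of [h] within 6d
    of that at the clamped point. [B] does not enter. *)
Let C1 : R := 6 * d%:R * cd * 13 ^+ d.

Lemma n1_clampv x u : n1 (clampv (x + u) - clampv x) <= n1 u.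
Proof.
apply: ler_sum => i _; rewrite !mxE opprB addrA subrK addrAC.
exact: clampN_lip.
Qed.

Lemma n1_node k x : near k x -> n1 (node k - clampv x) <= 6 * d%:R.
Proof.
move=> /forallP kx; apply: (@le_trans _ _ (\sum_(i < d) 6)).
  by apply: ler_sum => i _; rewrite !mxE opprB addrA subrK; exact: kx.
by rewrite sumr_const card_ord mulr_natr.
Qed.

Lemma tensor_bspl_sum al x : \sum_k tensor_bspl k al x = \prod_j ((al j == 0%N)%:R : R).
Proof.
rewrite -(bigA_distr_bigA (fun j (m : 'I_N.+1) => bspl N m (al j) (x j 0 + B%:R))).
by apply: eq_bigr => j _; rewrite bspl_sum.
Qed.

Lemma near_sum x : \sum_k (near k x)%:R <= (13 ^+ d : R).
Proof.
have E k : (near k x)%:R =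
    \prod_j ((`|(k j : nat)%:R - clampN N (x j 0 + B%:R)| <= 6)%R%:R : R).
  have [/forallP H|] := boolP (near k x).
    by rewrite big1 // => j _; rewrite H.
  rewrite negb_forall => /existsP[j /negbTE H].
  by rewrite (bigD1 j) //= H mul0r.
under eq_bigr do rewrite E.
rewrite -(bigA_distr_bigA (fun j (m : 'I_N.+1) => (`|(m : nat)%:R - clampN N (x j 0 + B%:R)| <= 6)%R%:R)).
rewrite -[d in leRHS]card_ord -prodr_const; apply: ler_prod => j _.
by rewrite sumr_ge0 //=; exact: count_near.
Qed.

Lemma local_sum (G : idx -> R) x c : 0 <= c -> (forall k, near k x -> `|G k| <= c) ->
  (forall k, ~~ near k x -> G k = 0) -> `|\sum_k G k| <= c * 13 ^+ d.
Proof.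
move=> c0 Gn Gf; rewrite (le_trans (ler_norm_sum _ _ _)) //.
apply: (@le_trans _ _ (\sum_k c * (near k x)%:R)).
  apply: ler_sum => k _; have [kx|kx] := boolP (near k x); first by rewrite mulr1 Gn.
  by rewrite Gf // normr0 mulr0.
by rewrite -big_distrr /= ler_wpM2l // near_sum.
Qed.

Lemma tensor_bspl_far k al x u : (forall j, (al j <= 2)%N) -> n1 u <= 1 ->
  ~~ near k x -> tensor_bspl k al (x + u) = 0.
Proof.
move=> al2 u1; rewrite negb_forall => /existsP[j]; rewrite -ltNge => far.
rewrite /tensor_bspl (bigD1 j) //= bspl_near ?mul0r //; first by rewrite -ltnS.
rewrite -ltNge mxE addrAC.
have cl := clampN_lip N (x j 0 + B%:R) (u j 0).
have uj : `|u j 0| <= 1 := le_trans (n1_coord u j) u1.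
move: far cl; set a := clampN _ _; set b := clampN _ _; set m := (k j : nat)%:R.
move=> far cl; have : `|m - a| <= `|m - b| + `|b - a|.
  by rewrite (le_trans _ (ler_normD _ _)) // addrA subrK.
lra.
Qed.

Lemma tensor_bspl_le k al x : (forall j, (al j <= 2)%N) -> `|tensor_bspl k al x| <= cd.
Proof.
move=> al2; rewrite /tensor_bspl normr_prod /cd -[d in leRHS]card_ord -prodr_const.
apply: ler_prod => j _; rewrite normr_ge0 /=. exact: (bspl_jet1 R N (k j)).1 _ _ (al2 j).
Qed.

Lemma prod_lip (I : Type) (r : seq I) (c : R) (f g t : I -> R) : 1 <= c ->
  (forall j, `|f j| <= c) -> (forall j, `|g j| <= c) -> (forall j, `|f j - g j| <= c * `|t j|) ->
  `|\prod_(j <- r) f j - \prod_(j <- r) g j| <= c ^+ size r * \sum_(j <- r) `|t j|.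
Proof.
move=> c1 fc gc fg; have c0 : 0 <= c := le_trans ler01 c1.
elim: r => [|j r IH]; first by rewrite !big_nil subrr normr0 mulr0.
rewrite !big_cons exprS.
have g_le : `|\prod_(j <- r) g j| <= c ^+ size r.
  elim: (r) => [|i r' IH'] /=; first by rewrite big_nil normr1 expr0.
  by rewrite big_cons normrM exprS ler_pM.
rewrite (_ : _ - _ = f j * (\prod_(j <- r) f j - \prod_(j <- r) g j)
   + (f j - g j) * \prod_(j <- r) g j); last by ring.
rewrite (le_trans (ler_normD _ _)) // !normrM mulrDr addrC lerD //.
  by rewrite mulrAC ler_pM.
by rewrite -mulrA ler_pM.
Qed.

Lemma size_index_ord : size (index_enum 'I_d) = d.
Proof. by rewrite -[RHS]card_ord -sum1_card sum1_size. Qed.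

Lemma tensor_bspl_lip k al x u : (forall j, (al j <= 2)%N) ->
  `|tensor_bspl k al (x + u) - tensor_bspl k al x| <= cd * n1 u.
Proof.
move=> al2; rewrite /cd -[X in 120 ^+ X]size_index_ord.
apply: (@prod_lip _ _ 120); first lra.
- by move=> j; exact: (bspl_jet1 R N (k j)).1 _ _ (al2 j).
- by move=> j; exact: (bspl_jet1 R N (k j)).1 _ _ (al2 j).
move=> j; rewrite mxE (addrAC (x j 0)).
by have [_ /(_ (x j 0 + B%:R) (u j 0))[_ _ H]] := bspl_jet1 R N (k j); exact: H _ (al2 j).
Qed.

Lemma tensor_bspl_taylor k x u :
  `|tensor_bspl k (fun=> 0%N) (x + u) - tensor_bspl k (fun=> 0%N) x
    - lin (fun i => tensor_bspl k (delta1 i)) x u - quad (fun i l => tensor_bspl k (delta2 i l)) x u / 2|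
  <= cd * n1 u ^+ 3.
Proof.
have := @prod_taylor R 'I_d 120 (fun j => bspl N (k j)) _ (fun j => bspl_jet1 R N (k j))
  (fun j => x j 0 + B%:R) (fun j => u j 0) (index_enum 'I_d) (index_enum_uniq _).
rewrite size_index_ord => /(_ _)[|_ _]; first by lra.
congr (`|_ - _ - _ - _ / 2| <= _).
- by apply: eq_bigr => j _; rewrite mxE (addrAC (x j 0)).
- by apply: eq_bigr => i _; rewrite mulrC.
apply: eq_bigr => i _; apply: eq_bigr => l _; rewrite mulrC; congr (_ * _).
Qed.

Let al1 i j : (@delta1 'I_d i j <= 2)%N.
Proof. by rewrite /delta1; case: (_ == _). Qed.
Let al2 i l j : (@delta2 'I_d i l j <= 2)%N.
Proof. by rewrite /delta2; case: (_ == _); case: (_ == _). Qed.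

Let C1_ge0 : 0 <= C1.
Proof. by rewrite /C1 /cd !mulr_ge0 ?exprn_ge0. Qed.

Let al0 : forall j : 'I_d, ((fun=> 0%N) j <= 2)%N.
Proof. by []. Qed.

Let D0_sum x : \sum_k tensor_bspl k (fun=> 0%N) x = 1.
Proof. by rewrite tensor_bspl_sum big1. Qed.

Let D1_sum i x : \sum_k tensor_bspl k (delta1 i) x = 0.
Proof. by rewrite tensor_bspl_sum (bigD1 i) //= /delta1 eqxx /= mul0r. Qed.

Let D2_sum i l x : \sum_k tensor_bspl k (delta2 i l) x = 0.
Proof. by rewrite tensor_bspl_sum (bigD1 i) //= /delta2 eqxx; case: (l == i); rewrite /= mul0r. Qed.

Let center (a : R) (G : idx -> R) : \sum_k G k = 0 ->
  \sum_k h (node k) * G k = \sum_k (h (node k) - a) * G k.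
Proof.
move=> G0; under [RHS]eq_bigr do rewrite mulrBl.
by rewrite sumrB -big_distrr /= G0 mulr0 subr0.
Qed.

Let near_h k x : near k x -> `|h (node k) - h (clampv x)| <= 6 * d%:R.
Proof. by move=> kx; rewrite (le_trans (h_lip _ _)) // n1_node. Qed.

Let far0 k al x : (forall j, (al j <= 2)%N) -> ~~ near k x -> tensor_bspl k al x = 0.
Proof.
move=> alle kx; rewrite -[x]addr0; apply: tensor_bspl_far => //.
by rewrite n1_0.
Qed.

(** Weights that sum to zero allow [h (clampv x)] to be subtracted, after which only the oscillation
    of [h] among the near nodes counts. Hence no bound depends on the size of [h] or on [B]. *)
Lemma spline_centered (w : R) (G : idx -> R) x : 0 <= w -> \sum_k G k = 0 ->
  (forall k, `|G k| <= cd * w) -> (forall k, ~~ near k x -> G k = 0) ->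
  `|\sum_k h (node k) * G k| <= C1 * w.
Proof.
move=> w0 G0 Gw Gf; rewrite (center (h (clampv x)) G0).
have -> : C1 * w = (6 * d%:R * (cd * w)) * 13 ^+ d by rewrite /C1; ring.
apply: (@local_sum _ x) => [|k kx|k kx].
- by rewrite !mulr_ge0 // exprn_ge0.
- by rewrite normrM ler_pM // near_h.
by rewrite Gf // mulr0.
Qed.

Notation F := (spline (fun=> 0%N)).
Notation D1 := (fun i => spline (delta1 i)).
Notation D2 := (fun i l => spline (delta2 i l)).

Lemma spline_close x : `|F x - h (clampv x)| <= C1.
Proof.
have -> : F x - h (clampv x) = \sum_k (h (node k) - h (clampv x)) * tensor_bspl k (fun=> 0%N) x.
  under [RHS]eq_bigr do rewrite mulrBl.
  by rewrite sumrB -big_distrr /= D0_sum mulr1.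
rewrite /C1; apply: (@local_sum _ x) => [|k kx|k kx].
- by rewrite !mulr_ge0 // exprn_ge0.
- by rewrite normrM ler_pM // ?near_h // tensor_bspl_le.
by rewrite far0 // mulr0.
Qed.

Let D1_le i x : `|D1 i x| <= C1.
Proof.
rewrite -[C1]mulr1; apply: (@spline_centered _ _ x) => // [k|k kx].
  by rewrite mulr1 tensor_bspl_le.
exact: far0.
Qed.

Let D2_le i l x : `|D2 i l x| <= C1.
Proof.
rewrite -[C1]mulr1; apply: (@spline_centered _ _ x) => // [k|k kx].
  by rewrite mulr1 tensor_bspl_le.
exact: far0.
Qed.

Let F_lip_far x u : `|F (x + u) - F x| <= 2 * C1 + n1 u.
Proof.
have h1 := spline_close (x + u); have h2 := spline_close x.
have h3 := le_trans (h_lip (clampv (x + u)) (clampv x)) (n1_clampv x u).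
move: h1 h2 h3; rewrite !ler_norml => /andP[? ?] /andP[? ?] /andP[? ?].
by apply/andP; split; lra.
Qed.

Let F_lip_near x u : n1 u <= 1 -> `|F (x + u) - F x| <= C1 * n1 u.
Proof.
move=> u1; rewrite -sumrB; under eq_bigr do rewrite -mulrBr.
apply: (@spline_centered _ _ x) => [||k|k kx]; first exact: n1_ge0.
- by rewrite sumrB !D0_sum subrr.
- exact: tensor_bspl_lip.
by rewrite tensor_bspl_far // far0 // subrr.
Qed.

Let D2_lip_near i l x u : n1 u <= 1 -> `|D2 i l (x + u) - D2 i l x| <= C1 * n1 u.
Proof.
move=> u1; rewrite -sumrB; under eq_bigr do rewrite -mulrBr.
apply: (@spline_centered _ _ x) => [||k|k kx]; first exact: n1_ge0.
- by rewrite sumrB !D2_sum subrr.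
- exact: tensor_bspl_lip.
by rewrite tensor_bspl_far // far0 // subrr.
Qed.

Let linE x u : lin D1 x u = \sum_k h (node k) * lin (fun i => tensor_bspl k (delta1 i)) x u.
Proof.
rewrite /lin; under eq_bigr do rewrite big_distrl /=.
rewrite exchange_big; apply: eq_bigr => k _; rewrite big_distrr.
by apply: eq_bigr => i _ /=; rewrite mulrA.
Qed.

Let quadE x u : quad D2 x u = \sum_k h (node k) * quad (fun i l => tensor_bspl k (delta2 i l)) x u.
Proof.
rewrite /quad; under eq_bigr => i _.
  under eq_bigr do rewrite big_distrl /=.
  rewrite exchange_big /=.
  over.
rewrite exchange_big; apply: eq_bigr => k _; rewrite big_distrr; apply: eq_bigr => i _ /=.
by rewrite big_distrr; apply: eq_bigr => l _ /=; rewrite -mulrA.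
Qed.

Let F_taylor_near x u : n1 u <= 1 ->
  `|F (x + u) - F x - lin D1 x u - quad D2 x u / 2| <= C1 * n1 u ^+ 3.
Proof.
move=> u1; rewrite linE quadE big_distrl -!sumrB.
rewrite (eq_bigr (fun k => h (node k) * (tensor_bspl k (fun=> 0%N) (x + u)
  - tensor_bspl k (fun=> 0%N) x - lin (fun i => tensor_bspl k (delta1 i)) x u
  - quad (fun i l => tensor_bspl k (delta2 i l)) x u / 2))); last by move=> k _ /=; ring.
apply: (@spline_centered _ _ x) => [||k|k kx]; first by rewrite exprn_ge0 // n1_ge0.
- rewrite !sumrB !D0_sum subrr -big_distrl /=.
  have -> : \sum_k lin (fun i => tensor_bspl k (delta1 i)) x u = 0.
    rewrite exchange_big big1 // => i _.
    by rewrite -big_distrl /= D1_sum mul0r.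
  have -> : \sum_k quad (fun i l => tensor_bspl k (delta2 i l)) x u = 0.
    rewrite exchange_big big1 // => i _ /=; rewrite exchange_big big1 // => l _.
    by rewrite -big_distrl /= D2_sum mul0r.
  by rewrite mul0r !subr0.
- exact: tensor_bspl_taylor.
have l0 : lin (fun i => tensor_bspl k (delta1 i)) x u = 0.
  by rewrite /lin big1 // => i _; rewrite far0 // mul0r.
have q0 : quad (fun i l => tensor_bspl k (delta2 i l)) x u = 0.
  by rewrite /quad big1 // => i _; rewrite big1 // => l _; rewrite far0 // mul0r.
by rewrite tensor_bspl_far // far0 // l0 q0 mul0r !subr0.
Qed.

(** Displacements up to 1 are handled by the local Taylor bound. Beyond 1 the triangle inequality
    suffices: 2 C1 + 1 for the increment, C1 and C1 / 2 for the linear and quadratic terms, each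
    times the cube of the displacement. *)
Lemma spline_jet3 : jet3 (4 * C1 + 1) F D1 D2.
Proof.
have C0 := C1_ge0.
split=> [x u|i l x u|i l x]; last by rewrite (le_trans (D2_le i l x)) //; lra.
- have n0 := n1_ge0 u.
  have [u1|u1] := leP (n1 u) 1.
    rewrite (le_trans (F_taylor_near x u1)) // ler_wpM2r ?exprn_ge0 //; lra.
  have h1 := F_lip_far x u.
  have h2 : `|lin D1 x u| <= C1 * n1 u.
    rewrite (le_trans (ler_norm_sum _ _ _)) // big_distrr /=; apply: ler_sum => i _.
    by rewrite normrM ler_wpM2r //; exact: D1_le.
  have h3 := @quad_le R d D2 x u C1 (fun i l => D2_le i l x).
  have c2 : n1 u <= n1 u ^+ 2 by rewrite expr2 ler_peMr // ltW.
  have c3 : n1 u ^+ 2 <= n1 u ^+ 3 by rewrite [leRHS]exprS ler_peMl ?exprn_ge0 // ltW.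
  move: h1 h2 h3 c2 c3 u1; set w := n1 u; set w2 := w ^+ 2; set w3 := w ^+ 3.
  move=> h1 h2 h3 c2 c3 u1.
  have e1 : C1 * w <= C1 * w3 by rewrite ler_wpM2l //; lra.
  have e2 : C1 * w2 <= C1 * w3 by rewrite ler_wpM2l //; lra.
  have e3 : C1 * 1 <= C1 * w3 by rewrite ler_wpM2l //; lra.
  move: h1 h2 h3; rewrite !ler_norml => /andP[? ?] /andP[? ?] /andP[? ?].
  by apply/andP; split; lra.
have [u1|u1] := leP (n1 u) 1.
  by rewrite (le_trans (D2_lip_near i l x u1)) // ler_wpM2r ?n1_ge0 //; lra.
apply: (@le_trans _ _ (C1 + C1)).
  by rewrite (le_trans (ler_normB _ _)) // lerD //; exact: D2_le.
have e : C1 * 1 <= C1 * n1 u by rewrite ler_wpM2l // ltW.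
by rewrite mulrDl mul1r; lra.
Qed.

Lemma spline_lip x u : `|F (x + u) - F x| <= (4 * C1 + 1) * n1 u.
Proof.
have C0 := C1_ge0; have n0 := n1_ge0 u.
have [u1|u1] := leP (n1 u) 1.
  by rewrite (le_trans (F_lip_near x u1)) // ler_wpM2r //; lra.
rewrite (le_trans (F_lip_far x u)) //.
have e : C1 * 1 <= C1 * n1 u by rewrite ler_wpM2l // ltW.
by rewrite mulrDl mul1r; lra.
Qed.

(** Outside [-B, B] the excess |y| - B is at most y^2 / B, so truncation is paid for by a second
    moment. *)
Lemma clampv_close (x : 'cV[R]_d) : (0 < B)%N ->
  n1 (clampv x - x) <= (\sum_i x i 0 ^+ 2) / B%:R.
Proof.
move=> B0; rewrite big_distrl; apply: ler_sum => i _ /=; rewrite !mxE.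
have Bp : 0 < (B%:R : R) by rewrite ltr0n.
move: (x i 0) => y; rewrite ler_pdivlMr //.
have NE : ((B + B)%:R : R) = B%:R + B%:R by rewrite natrD.
have y2 := sqr_ge0 y.
case: (clampN_cases (B + B) (y + B%:R)) => -[hy ->]; rewrite ?NE in hy *.
- rewrite sub0r; have yB : y <= - B%:R by lra.
  rewrite ger0_norm; nra.
- by rewrite addrK subrr normr0 mul0r.
rewrite addrK ler0_norm; [nra|lra].
Qed.

End SplineSmoothing.

Section Smoothing.
Variables (R : realType) (d : nat).

(** Rescaling turns the unit grid into one of mesh [sg]: the Lipschitz constant is kept and
    third-order remainders gain sg^(-2). [C] depends on the dimension only, so [B] can be taken as
    large as the truncation error demands. *)
Lemma smoothing : exists2 C : R, 0 <= C & forall (h : 'cV[R]_d -> R) (sg : R) (B : nat),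
  (forall x y, `|h x - h y| <= n1 (x - y)) -> 0 < sg -> sg <= 1 -> (0 < B)%N ->
  exists f D1 D2, [/\ jet3 (C / sg ^+ 2) f D1 D2,
    forall x u, `|f (x + u) - f x| <= C * n1 u
  & forall x, `|f x - h x| <= C * sg + (\sum_i x i 0 ^+ 2) / (sg * B%:R)].
Proof.
pose C1 : R := 6 * d%:R * 120 ^+ d * 13 ^+ d.
have C1_ge0 : 0 <= C1 by rewrite /C1 !mulr_ge0 ?exprn_ge0.
exists (4 * C1 + 1); first by rewrite addr_ge0 // mulr_ge0.
move=> h sg B h_lip sg0 sg1 B0; set C := 4 * C1 + 1.
have sgN0 : sg != 0 by rewrite gt_eqF.
have C_ge1 : 1 <= C by rewrite /C lerDr mulr_ge0.
pose h' y := sg^-1 * h (sg *: y).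
have h'_lip x y : `|h' x - h' y| <= n1 (x - y).
  rewrite /h' -mulrBr normrM ger0_norm ?invr_ge0 ?(ltW sg0) // mulrC ler_pdivrMr //.
  by rewrite (le_trans (h_lip _ _)) // -scalerBr n1Z ger0_norm ?(ltW sg0) // mulrC.
have [j1 j2 j3] := spline_jet3 B h'_lip; rewrite -/C1 -/C in j1 j2 j3.
have lip := spline_lip B h'_lip; rewrite -/C1 -/C in lip.
have close := spline_close B h'_lip; rewrite -/C1 in close.
set F := spline B h' (fun=> 0%N) in j1 lip close.
set D1 := fun i => spline B h' (delta1 i) in j1.
set D2 := fun i l => spline B h' (delta2 i l) in j1 j2 j3.
have si0 : 0 < sg^-1 by rewrite invr_gt0.
have si u : n1 (sg^-1 *: u) = sg^-1 * n1 u by rewrite n1Z ger0_norm // ltW.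
exists (fun x => sg * F (sg^-1 *: x)), (fun i x => D1 i (sg^-1 *: x)),
  (fun i l x => sg^-1 * D2 i l (sg^-1 *: x)); split.
- split=> [x u|i l x u|i l x].
  + have := j1 (sg^-1 *: x) (sg^-1 *: u); rewrite -scalerDr si.
    have -> : lin D1 (sg^-1 *: x) (sg^-1 *: u) = sg^-1 * lin (fun i x => D1 i (sg^-1 *: x)) x u.
      by rewrite /lin big_distrr; apply: eq_bigr => i _ /=; rewrite mxE mulrCA.
    have -> : quad D2 (sg^-1 *: x) (sg^-1 *: u) =
        sg^-1 * quad (fun i l x => sg^-1 * D2 i l (sg^-1 *: x)) x u.
      rewrite quadZ /quad !big_distrr; apply: eq_bigr => i _ /=.
      by rewrite !big_distrr; apply: eq_bigr => l _ /=; ring.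
    move=> H; rewrite -(ler_pM2l si0) -[X in X * `|_|](ger0_norm (ltW si0)) -normrM.
    rewrite [X in `|X|](_ : _ = F (sg^-1 *: (x + u)) - F (sg^-1 *: x)
       - sg^-1 * lin (fun i x => D1 i (sg^-1 *: x)) x u
       - sg^-1 * quad (fun i l x => sg^-1 * D2 i l (sg^-1 *: x)) x u / 2); last first.
      by rewrite !mulrBr !mulrA mulVf // !mul1r.
    apply: (le_trans H); rewrite exprMn le_eqVlt; apply/orP; left; apply/eqP.
    by field.
  + rewrite -mulrBr normrM (ger0_norm (ltW si0)) scalerDr.
    apply: (@le_trans _ _ (sg^-1 * (C * (sg^-1 * n1 u)))).
      by rewrite ler_wpM2l ?(ltW si0) // -si; exact: j2.
    by rewrite le_eqVlt; apply/orP; left; apply/eqP; field.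
  rewrite normrM (ger0_norm (ltW si0)).
  apply: (@le_trans _ _ (sg^-1 * C)); first by rewrite ler_wpM2l ?(ltW si0) //; exact: j3.
  rewrite mulrC ler_wpM2l //; first by rewrite (le_trans ler01).
  by rewrite lef_pV2 ?posrE ?exprn_gt0 // expr2 ler_piMr // ltW.
- move=> x u; rewrite -mulrBr normrM (ger0_norm (ltW sg0)) scalerDr.
  rewrite -ler_pdivlMl // (le_trans (lip _ _)) // si.
  by rewrite le_eqVlt; apply/orP; left; apply/eqP; ring.
move=> x; set y := sg^-1 *: x.
have xE : x = sg *: y by rewrite /y scalerA divff // scale1r.
have e1 := close y; have e2 := le_trans (h'_lip (clampv B y) y) (clampv_close y B0).
have -> : h x = sg * h' y by rewrite /h' mulrA divff // mul1r -xE.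
rewrite -mulrBr normrM (ger0_norm (ltW sg0)).
apply: (@le_trans _ _ (sg * (C1 + (\sum_i y i 0 ^+ 2) / B%:R))).
  rewrite ler_wpM2l ?(ltW sg0) // -(subrKA (h' (clampv B y))).
  by rewrite (le_trans (ler_normD _ _)) // lerD.
rewrite mulrDr lerD //.
  by rewrite mulrC ler_wpM2r ?(ltW sg0) // /C; lra.
have -> : \sum_i y i 0 ^+ 2 = (sg ^+ 2)^-1 * \sum_i x i 0 ^+ 2.
  by rewrite big_distrr; apply: eq_bigr => i _ /=; rewrite mxE exprMn exprVn.
by rewrite le_eqVlt; apply/orP; left; apply/eqP; field; rewrite sgN0 pnatr_eq0 -lt0n B0.
Qed.

Lemma jet3_smooth_along (M L : R) (f : 'cV[R]_d -> R) D1 D2 gs (c : R) : 0 <= M -> 0 <= L ->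
  jet3 M f D1 D2 -> (forall x u, `|f (x + u) - f x| <= L * n1 u) ->
  (forall g, g \in gs -> n1 g <= c) -> smooth_along (L * c) (M * c ^+ 3) gs f.
Proof.
move=> M0 L0 [H1 _ _] Hl gc g x gin; have gc' := gc _ gin; split=> [s t|s].
  have -> : x + s *: g = x + t *: g + (s - t) *: g by rewrite scalerBl addrA (addrAC x) addrK.
  rewrite (le_trans (Hl _ _)) // n1Z -mulrA ler_wpM2l // mulrC.
  by rewrite ler_wpM2r.
exists (lin D1 (x + s *: g) g), (quad D2 (x + s *: g) g / 2) => t.
have := H1 (x + s *: g) (t *: g); rewrite quadZ n1Z.
have -> : lin D1 (x + s *: g) (t *: g) = lin D1 (x + s *: g) g * t.
  by rewrite /lin big_distrl; apply: eq_bigr => i _ /=; rewrite mxE; ring.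
rewrite scalerDl addrA (_ : t ^+ 2 * _ / 2 = quad D2 (x + s *: g) g / 2 * t ^+ 2); last by ring.
move=> H; apply: (le_trans H); rewrite exprMn -mulrA ler_wpM2l // mulrC.
by rewrite ler_wpM2r ?exprn_ge0 // lerXn2r ?nnegrE ?n1_ge0 // (le_trans (n1_ge0 _) gc').
Qed.

End Smoothing.

                                              

(** * Gaussian vectors by discretization *)

Section DiscretizedGaussian.
Variables (R : realType) (P : nat).
Hypothesis P_gt0 : (0 < P)%N.

Notation T := (P * P + P * P)%N.

(** Position on a grid of mesh 1/P over [-P, P], in units of the mesh and shifted by P^2 to range
    over [0, 2 P^2]; the extreme cells receive the tails. *)
Definition gidx (z : R) : R := clampN T (z * P%:R + (P * P)%:R).

Definition cell (k : 'I_T.+1) : set R := [set z | k%:R <= gidx z < k.+1%:R].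

Definition cellpt (k : 'I_T.+1) : R := (k : nat)%:R / P%:R - P%:R.

Lemma continuous_gidx : continuous gidx.
Proof.
apply: (@lipschitz1_continuous _ P%:R) => x y.
have := clampN_lip T (y * P%:R + (P * P)%:R) ((x - y) * P%:R).
rewrite (_ : _ + _ + _ = x * P%:R + (P * P)%:R) => [h|]; last by ring.
rewrite (le_trans h) //.
by rewrite normrM mulrC ger0_norm.
Qed.

Lemma measurable_cell k : measurable (cell k).
Proof.
rewrite (_ : cell k = gidx @^-1` `[(k : nat)%:R, k.+1%:R[%classic); last first.
  by apply/seteqP; split => z; rewrite /cell /= in_itv.
rewrite -[X in measurable X]setTI.
by apply: continuous_measurable_fun => //; exact: continuous_gidx.
Qed.

Lemma cell_ex z : exists k0, forall k, \1_(cell k) z = (k == k0)%:R :> R.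
Proof.
have g0 : 0 <= gidx z <= T%:R.
  have h : 0 <= (T%:R : R) by [].
  by rewrite /gidx; case: (clampN_cases T (z * P%:R + (P * P)%:R)) => -[? ->]; apply/andP; split; lra.
case/andP: g0 => g0 gT.
have /andP[t1 t2] := truncn_itv g0.
have tT : (Num.truncn (gidx z) < T.+1)%N.
  by rewrite -(ltr_nat R) (le_lt_trans t1) // (le_lt_trans gT) // ltr_nat.
exists (Ordinal tT) => k; rewrite indicE; congr (_%:R); congr nat_of_bool.
apply/idP/eqP => [/set_mem|->]; last by apply/mem_set; rewrite /cell /= t1.
rewrite /cell /= => /andP[k1 k2]; apply/val_inj => /=.
have h1 : ((k : nat) < (Num.truncn (gidx z)).+1)%N by rewrite -(ltr_nat R) (le_lt_trans k1).
have h2 : (Num.truncn (gidx z) < k.+1)%N by rewrite -(ltr_nat R) (le_lt_trans t1).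
by apply/eqP; rewrite eqn_leq -ltnS h1 -ltnS h2.
Qed.

(** Within the grid the error is one mesh width 1/P; beyond it, the distance to the extreme node is
    at most z^2 / P. *)
Lemma cellpt_close k z : cell k z -> `|z - cellpt k| <= (1 + z ^+ 2) / P%:R.
Proof.
have P0 : 0 < (P%:R : R) by rewrite ltr0n.
have P1 : 1 <= (P%:R : R) by rewrite ler1n.
rewrite /cell /= -natr1 => /andP[k1 k2].
have kT : (k : nat)%:R <= (T%:R : R) by rewrite ler_nat -ltnS.
rewrite ler_pdivlMr // -[X in _ * X](ger0_norm (ltW P0)) -normrM.
rewrite /cellpt mulrBl mulrBl divfK ?gt_eqF //.
have z2 := sqr_ge0 z.
have TE : (T%:R : R) = P%:R * P%:R + P%:R * P%:R by rewrite natrD natrM.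
have m0 : 0 <= ((k : nat)%:R : R) by [].
move: k1 k2 kT m0; rewrite /gidx natrM.
have := clampN_cases T (z * P%:R + P%:R * P%:R); rewrite TE.
move: (clampN _ _) => cl; move: (k : nat)%:R => m; move: P%:R P0 P1 {TE} => p P0 P1.
case=> -[hz ->] k1 k2 kT m0.
- have m00 : m = 0 by lra.
  rewrite m00 sub0r opprK ler0_norm //.
  have zp : z <= - p by rewrite -(ler_pM2r P0); lra.
  nra.
- by rewrite ger0_norm; lra.
have zp : p <= z by rewrite -(ler_pM2r P0); lra.
rewrite ger0_norm; nra.
Qed.

Definition cellw (k : 'I_T.+1) : R := fine (normal_prob 0 1 (cell k)).

Lemma cellw_ge0 k : 0 <= cellw k.
Proof. by rewrite fine_ge0 // measure_ge0. Qed.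

Lemma cell_sum (F : 'I_T.+1 -> R) k0 z : (forall k, \1_(cell k) z = (k == k0)%:R :> R) ->
  \sum_k F k * \1_(cell k) z = F k0.
Proof.
move=> kz; rewrite (bigD1 k0) //= kz eqxx mulr1 big1 ?addr0 // => k kk0.
by rewrite kz (negbTE kk0) mulr0.
Qed.

Lemma growth4_sum (I : Type) (r : seq I) (F : I -> R -> R) :
  (forall i, growth4 (F i)) -> growth4 (fun z => \sum_(i <- r) F i z).
Proof.
move=> H; elim: r => [|i r IH].
  by under eq_fun do rewrite big_nil; exact: growth4_cst.
by under eq_fun do rewrite big_cons; exact: growth4D.
Qed.

Lemma growth4_cell k : growth4 (\1_(cell k) : R -> R).
Proof.
split; first exact: measurable_indic (measurable_cell k).
exists 1 => z; rewrite mul1r indicE ger0_norm // (@le_trans _ _ 1) ?lern1 ?leq_b1 //.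
by rewrite lerDl exprn_even_ge0.
Qed.

Lemma gauss_sum (I : Type) (r : seq I) (F : I -> R -> R) :
  (forall i, growth4 (F i)) ->
  gauss (fun z => \sum_(i <- r) F i z) = \sum_(i <- r) gauss (F i).
Proof.
move=> H; elim: r => [|i r IH].
  by under eq_fun do rewrite big_nil; rewrite gauss_cst big_nil.
under eq_fun do rewrite big_cons.
by rewrite gaussD ?IH ?big_cons //; exact: growth4_sum.
Qed.

Lemma gauss_cells (F : 'I_T.+1 -> R) :
  gauss (fun z => \sum_k F k * \1_(cell k) z) = \sum_k cellw k * F k.
Proof.
rewrite gauss_sum => [|k]; last exact/growth4Z/growth4_cell.
apply: eq_bigr => k _; rewrite gaussZ; last exact: growth4_cell.
rewrite [RHS]mulrC; congr (F k * _).
rewrite /gauss /Rintegral integral_indic //; last exact: measurable_cell.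
by rewrite setIT.
Qed.

Lemma cellw_sum1 : \sum_k cellw k = 1.
Proof.
rewrite -[RHS](gauss_cst 1) (_ : (fun=> 1) = fun z : R => \sum_k 1 * \1_(cell k) z).
  by rewrite gauss_cells; apply: eq_bigr => k _; rewrite mulr1.
by apply/funext => z; have [k0 kz] := cell_ex z; rewrite (@cell_sum (fun=> 1) k0).
Qed.

(** The factor 2 is the Gaussian mean of 1 + z^2. *)
Lemma cellw_gauss L F : lipschitz1 L F ->
  `|\sum_k cellw k * F (cellpt k) - gauss F| <= L * (2 / P%:R).
Proof.
move=> FL; have gF := lipschitz1_growth FL.
have gs : growth4 (fun z => \sum_k F (cellpt k) * \1_(cell k) z).
  by apply: growth4_sum => k; exact/growth4Z/growth4_cell.
rewrite -gauss_cells -gaussB // (le_trans (gauss_abs _)) //.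
  by apply: growth4D => //; exact: growth4N.
have g2 : growth4 (fun z : R => L / P%:R * (1 + z ^+ 2)).
  by apply: growth4Z; apply: growth4D; [exact: growth4_cst|exact: growth4_pow].
apply: (@le_trans _ _ (gauss (fun z : R => L / P%:R * (1 + z ^+ 2)))); last first.
  rewrite gaussZ ?gaussD ?gauss_cst ?gauss_sqr; first by rewrite mulrAC -mulrA.
  - exact: growth4_cst.
  - exact: growth4_pow.
  by apply: growth4D; [exact: growth4_cst|exact: growth4_pow].
apply: gauss_le => //.
  have [m [c h]] := growth4D gs (growth4N gF); split; first exact: measurableT_comp.
  by exists c => z; rewrite normr_id.
move=> z; have [k0 kz] := cell_ex z.
rewrite (@cell_sum (fun k => F (cellpt k)) k0) // (le_trans (FL _ _)) //.
rewrite -mulrA ler_wpM2l ?(lipschitz1_ge0 FL) // distrC mulrC; apply: cellpt_close.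
by have := kz k0; rewrite eqxx indicE; case: (boolP (z \in cell k0)) => [/set_mem //|_ /esym/eqP]; rewrite oner_eq0.
Qed.

End DiscretizedGaussian.

Section FiniteProduct.
Variables (R : realType) (d : nat) (K : finType) (q c : K -> R) (g : 'I_d -> 'cV[R]_d).
Hypothesis q_sum1 : \sum_k q k = 1.

Let W (k : {ffun 'I_d -> K}) : R := \prod_i q (k i).
Let upd1 (j : 'I_d) (k : {ffun 'I_d -> K}) (m : K) : {ffun 'I_d -> K} :=
  [ffun i => if i == j then m else k i].

                                                                            
(** An independent draw may replace coordinate [j]: exchanging the two is an involution that
    preserves the product weights. *)
Lemma product_swap j (Phi : K -> {ffun 'I_d -> K} -> R) :
  (forall m k m', Phi m (upd1 j k m') = Phi m k) ->
  \sum_m q m * \sum_k W k * Phi m k = \sum_k W k * Phi (k j) k.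
Proof.
move=> HPhi; pose sw (u : K * {ffun 'I_d -> K}) := (u.2 j, upd1 j u.2 u.1).
have swK : involutive sw.
  case=> m k; rewrite /sw /=; congr pair; first by rewrite ffunE eqxx.
  by apply/ffunP => i; rewrite !ffunE; case: eqP => // ->.
transitivity (\sum_(u : K * {ffun 'I_d -> K}) q u.1 * W u.2 * Phi u.1 u.2).
  rewrite -(pair_bigA _ (fun m k => q m * W k * Phi m k)) /=.
  by apply: eq_bigr => m _; rewrite big_distrr; apply: eq_bigr => k _ /=; rewrite mulrA.
rewrite (reindex_inj (inv_inj swK)) /=.
transitivity (\sum_(u : K * {ffun 'I_d -> K}) q u.1 * (W u.2 * Phi (u.2 j) u.2)).
  apply: eq_bigr => -[m k] _ /=; rewrite HPhi mulrA; congr (_ * _).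
  rewrite /W (bigD1 j) //= [in RHS](bigD1 j) //= ffunE eqxx mulrCA; congr (_ * (_ * _)).
  by apply: eq_bigr => i ij; rewrite ffunE (negPf ij).
rewrite -(pair_bigA _ (fun m k => q m * (W k * Phi (k j) k))) /=.
under eq_bigr do rewrite -big_distrr /=.
by rewrite -big_distrl /= q_sum1 mul1r.
Qed.

Lemma foldr_favg (f : 'cV[R]_d -> R) (r : seq 'I_d) x : uniq r ->
  foldr (favg q c) f (map g r) x = \sum_k W k * f (x + \sum_(i <- r) c (k i) *: g i).
Proof.
elim: r x => [|j r IH] x /=.
  move=> _; under eq_bigr do rewrite big_nil addr0.
  rewrite -big_distrl /= (_ : \sum_k W k = 1) ?mul1r //.
  by rewrite -(bigA_distr_bigA (fun=> q)) big1.
move=> /andP[jr ur].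
transitivity (\sum_m q m * \sum_k W k * f (x + c m *: g j + \sum_(i <- r) c (k i) *: g i)).
  by apply: eq_bigr => m _; rewrite IH.
rewrite (@product_swap j (fun m k => f (x + c m *: g j + \sum_(i <- r) c (k i) *: g i))).
  by apply: eq_bigr => k _; rewrite big_cons addrA.
move=> m k m'; congr (f (_ + _)); apply: eq_big_seq => i ir; rewrite ffunE.
by have [ij|//] := eqVneq i j; rewrite -ij ir in jr.
Qed.

End FiniteProduct.

Section GaussianVector.
Variables (R : realType) (d : nat) (dZ : measure_display) (OmegaZ : measurableType dZ)
  (Q : probability OmegaZ R) (Z : OmegaZ -> 'cV[R]_d) (g : 'I_d -> 'cV[R]_d).
Hypothesis Z_gauss : std_gaussian Q Z.

Lemma marginal_law i (B : set R) : measurable B ->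
  Q [set w | B (Z w i 0)] = normal_prob 0 1 B.
Proof.
move=> mB; pose BB j : set R := if j == i then B else setT.
have mBB j : measurable (BB j) by rewrite /BB; case: (j == i).
have := Z_gauss.2 BB mBB; rewrite (bigD1 i) //= big1 ?mule1.
  rewrite /BB eqxx => <-; congr (Q _); apply/seteqP; split=> w /=.
    by move=> h j; case: eqP => // ->.
  by move=> /(_ i); rewrite eqxx.
move=> j ji; rewrite /BB (negPf ji); exact: probability_setT.
Qed.

Lemma integral_marginal (F : R -> R) i : measurable_fun [set: R] F -> (forall x, 0 <= F x) ->
  (\int[Q]_w (F (Z w i 0%R))%:E = \int[normal_prob 0 1]_x (F x)%:E)%E.
Proof.
move=> mF F0.
have mZ : measurable_fun setT (fun w => Z w i 0 : measurableTypeR R) := Z_gauss.1 i.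
transitivity (\int[pushforward Q (fun w => Z w i 0%R : measurableTypeR R)]_x (F x)%:E)%E.
  rewrite ge0_integral_pushforward //; first exact/measurable_EFinP.
  by move=> x _; rewrite lee_fin.
apply: eq_measure_integral => A mA _; exact: marginal_law.
Qed.

Lemma integral_sqr i : (\int[Q]_w ((Z w i 0%R) ^+ 2)%:E = 1%:E)%E.
Proof.
rewrite (@integral_marginal (fun x => x ^+ 2)) //; last by move=> x; exact: sqr_ge0.
transitivity (gauss (fun x : R => x ^+ 2))%:E; last by rewrite gauss_sqr.
symmetry; rewrite /gauss /Rintegral; apply: fineK.
apply: integrable_fin_num => //; apply: gauss_integrable; exact: growth4_pow.
Qed.

Lemma integrable_sqr i : Q.-integrable setT (fun w => ((Z w i 0) ^+ 2)%:E).
Proof.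
apply/integrableP; split.
  apply/measurable_EFinP; apply: measurable_funX; exact: Z_gauss.1.
under eq_integral do rewrite /= ger0_norm ?sqr_ge0 //.
by rewrite integral_sqr ltry.
Qed.

(** A quadratic majorant in Z covers Lipschitz functions of the vector as well as the truncation
    error of the smoothing. *)
Definition dominated (F : OmegaZ -> R) : Prop := measurable_fun setT F /\
  exists a b : R, forall w, `|F w| <= a + b * \sum_i Z w i 0 ^+ 2.

Lemma integrable_quad (a b : R) :
  Q.-integrable setT (EFin \o fun w => a + b * \sum_i Z w i 0 ^+ 2).
Proof.
have -> : (EFin \o fun w => a + b * \sum_i Z w i 0 ^+ 2) =
   (fun w => a%:E + b%:E * \sum_(i <- index_enum 'I_d) ((Z w i 0%R) ^+ 2)%:E)%E.
  by apply/funext => w; rewrite /= EFinD EFinM sumEFin.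
apply: integrableD => //; first exact: finite_measure_integrable_cst.
apply: integrableZl => //; apply: integrable_sum => // i _; exact: integrable_sqr.
Qed.

Lemma Rintegral_quad (a b : R) :
  (\int[Q]_w (a + b * \sum_i Z w i 0 ^+ 2))%R = a + b * d%:R.
Proof.
have is2 : Q.-integrable setT (EFin \o fun w => \sum_i Z w i 0 ^+ 2).
  have := integrable_quad 0 1; congr (Q.-integrable setT); apply/funext => w /=.
  by rewrite add0r mul1r.
rewrite RintegralD //; last 2 first.
- exact: finite_measure_integrable_cst.
- have := integrable_quad 0 b; congr (Q.-integrable setT); apply/funext => w /=.
  by rewrite add0r.
rewrite RintegralZl // Rintegral_cst //.
have -> : fine (Q [set: OmegaZ]) = 1 by rewrite (_ : Q _ = 1%E) //; exact: probability_setT.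
rewrite mulr1; congr (_ + b * _).
rewrite /Rintegral; under eq_integral do rewrite -sumEFin.
rewrite integral_sum //; last by move=> i; exact: integrable_sqr.
under eq_bigr do rewrite integral_sqr.
by rewrite sumEFin sumr_const card_ord.
Qed.

Lemma integrable_dominated F : dominated F -> Q.-integrable setT (EFin \o F).
Proof.
move=> [mF [a [b Fab]]].
apply: (@le_integrable _ _ _ Q setT measurableT _ (EFin \o fun w => a + b * \sum_i Z w i 0 ^+ 2)).
- exact/measurable_EFinP.
- by move=> w _; rewrite /= lee_fin (le_trans (Fab w)) // ler_norm.
- exact: integrable_quad.
Qed.

Lemma Rintegral_dominated (F : OmegaZ -> R) (a b : R) : measurable_fun setT F ->
  (forall w, `|F w| <= a + b * \sum_i Z w i 0 ^+ 2) ->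
  `|(\int[Q]_w F w)%R| <= a + b * d%:R.
Proof.
move=> mF Fab; have dF : dominated F by split=> //; exists a, b.
have iF := integrable_dominated dF.
rewrite (le_trans (le_normr_Rintegral measurableT iF)) // -Rintegral_quad.
apply: le_Rintegral => //; last exact: integrable_quad.
apply: integrable_dominated; split; first exact: measurableT_comp.
by exists a, b => w; rewrite normr_id.
Qed.

End GaussianVector.

Section GaussianWalk.
Variables (R : realType) (d : nat) (dZ : measure_display) (OmegaZ : measurableType dZ)
  (Q : probability OmegaZ R) (Z : OmegaZ -> 'cV[R]_d) (g : 'I_d -> 'cV[R]_d).
Hypothesis Z_gauss : std_gaussian Q Z.
Variables (L : R) (f : 'cV[R]_d -> R).
Hypothesis L_ge0 : 0 <= L.
Hypothesis f_lip : forall x u, `|f (x + u) - f x| <= L * n1 u.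

Let K := L * \sum_i n1 (g i).

Let K_ge0 : 0 <= K.
Proof. by rewrite mulr_ge0 // sumr_ge0 // => i _; exact: n1_ge0. Qed.

Section Discretization.
Variable P : nat.
Hypothesis P_gt0 : (0 < P)%N.
Notation T := (P * P + P * P)%N.

Definition box (k : {ffun 'I_d -> 'I_T.+1}) : set OmegaZ :=
  [set w | forall i, cell (k i) (Z w i 0)].

Definition boxpt (k : {ffun 'I_d -> 'I_T.+1}) : 'cV[R]_d := \sum_i cellpt R (k i) *: g i.

Definition discretized (w : OmegaZ) : R := \sum_k f (boxpt k) * \1_(box k) w.

Lemma measurable_box k : measurable (box k).
Proof.
have -> : box k = \big[setI/setT]_(i <- index_enum 'I_d)
   ((fun w => Z w i 0) @^-1` cell (k i)).
  apply/seteqP; split=> w.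
    by move=> h; rewrite -bigcap_seq => i _; exact: h.
  by rewrite -bigcap_seq => h i; apply: h; rewrite /= mem_index_enum.
apply: bigsetI_measurable => i _; rewrite -[X in measurable X]setTI.
by apply: Z_gauss.1 => //; exact: measurable_cell.
Qed.

(** Boxes are measurable rectangles, the very sets on which [std_gaussian] prescribes the law of
    Z. *)
Lemma box_law k : Q (box k) = (\prod_i cellw R (k i))%:E.
Proof.
have := Z_gauss.2 (fun i => cell (k i)) (fun i => @measurable_cell R P (k i)).
rewrite -/(box k) => ->.
rewrite (_ : (\prod_i cellw R (k i))%:E = \prod_i (cellw R (k i))%:E)%E.
  apply: eq_bigr => i _; rewrite fineK // fin_num_measure //; exact: measurable_cell.
by elim/big_rec2: _ => // i y1 y2 _ <-; rewrite EFinM.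
Qed.

Lemma integrable_box (c : R) k : Q.-integrable setT (fun w => (c * \1_(box k) w)%:E).
Proof.
have := integrableZl measurableT c (integrable_indic Q (measurable_box k)).
by congr (Q.-integrable setT); apply/funext => w.
Qed.

Lemma integrable_discretized : Q.-integrable setT (EFin \o discretized).
Proof.
have -> : EFin \o discretized = fun w => (\sum_k (f (boxpt k) * \1_(box k) w)%:E)%E.
  by apply/funext => w; rewrite /= /discretized -sumEFin.
by apply: integrable_sum => // k _; exact: integrable_box.
Qed.

Lemma Rintegral_discretized :
  (\int[Q]_w discretized w)%R =
  \sum_(k : {ffun 'I_d -> 'I_T.+1}) (\prod_i cellw R (k i)) * f (boxpt k).
Proof.
rewrite /Rintegral /discretized; under eq_integral do rewrite -sumEFin.
rewrite integral_sum //; last by move=> k; exact: integrable_box.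
transitivity (fine (\sum_(k : {ffun 'I_d -> 'I_T.+1}) ((\prod_i cellw R (k i)) * f (boxpt k))%:E)%E).
  congr fine; apply: eq_bigr => k _.
  under eq_integral do rewrite EFinM.
  rewrite integralZl //; last exact: integrable_indic (measurable_box k).
  rewrite integral_indic //; last exact: measurable_box.
  rewrite setIT [RHS]EFinM muleC; congr (_ * _)%E; exact: box_law.
by rewrite sumEFin.
Qed.

Lemma discretized_close w :
  `|f (\sum_i Z w i 0 *: g i) - discretized w| <=
     K / P%:R * d%:R + K / P%:R * \sum_i Z w i 0 ^+ 2.
Proof.
have /choice[k0 Hk0] i := cell_ex P (Z w i 0).
have -> : discretized w = f (boxpt [ffun i => k0 i]).
  rewrite /discretized (bigD1 [ffun i => k0 i]) //= big1 => [|k kk0].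
    rewrite addr0 indicE mem_set ?mulr1 // => i; rewrite ffunE.
    apply/set_mem; have := Hk0 i (k0 i); rewrite indicE eqxx.
    by case: (_ \in _) => // /eqP; rewrite eq_sym oner_eq0.
  rewrite indicE memNset ?mulr0 // => h; move/eqP: kk0; apply; apply/ffunP => i; rewrite ffunE.
  have := Hk0 i (k i); rewrite indicE mem_set; last exact: h.
  by case: eqP => // _ /eqP; rewrite oner_eq0.
have -> : \sum_i Z w i 0 *: g i = boxpt [ffun i => k0 i] +
    \sum_i (Z w i 0 - cellpt R (k0 i)) *: g i.
  by rewrite -big_split /=; apply: eq_bigr => i _; rewrite ffunE -scalerDl addrC subrK.
rewrite (le_trans (f_lip _ _)) // -mulrDr /K -!mulrA ler_wpM2l //.
rewrite (le_trans (n1_sum _ _ _)) // big_distrl /=; apply: ler_sum => i _.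
rewrite n1Z mulrC ler_wpM2l ?n1_ge0 // (le_trans (cellpt_close P_gt0 _)) //.
  apply/set_mem; have := Hk0 i (k0 i); rewrite indicE eqxx.
  by case: (_ \in _) => // /eqP; rewrite eq_sym oner_eq0.
rewrite mulrC ler_wpM2l ?invr_ge0 //.
have d1 : 1 <= d%:R :> R by rewrite ler1n (leq_ltn_trans _ (ltn_ord i)).
rewrite lerD // (bigD1 i) //= lerDl sumr_ge0 // => j _; exact: sqr_ge0.
Qed.

Lemma measurable_discretized : measurable_fun setT discretized.
Proof.
apply: measurable_sum => k; apply: measurable_funM => //.
exact: measurable_indic (measurable_box k).
Qed.

End Discretization.

(** Measurability is given for the coordinates of Z; it passes to a Lipschitz function of the vector
    as the pointwise limit of step functions on boxes. *)
Lemma measurable_gauss_lip : measurable_fun setT (fun w => f (\sum_i Z w i 0 *: g i)).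
Proof.
apply: (@measurable_fun_cvg _ _ _ _ (fun n => discretized n.+1)).
  by move=> m; exact: measurable_discretized.
move=> w _; set q := \sum_i Z w i 0 ^+ 2.
apply/cvgrPdist_le => e e0; near=> n.
rewrite (le_trans (discretized_close (ltn0Sn n) w)) // -mulrDr mulrAC ler_pdivrMr // -ler_pdivrMl //.
rewrite -natr1 (@le_trans _ _ n%:R) ?lerDl //; near: n; exact: nbhs_infty_ger.
Unshelve. all: by end_near. Qed.

Lemma gauss_lip_dominated : dominated Z (fun w => f (\sum_i Z w i 0 *: g i)).
Proof.
split; first exact: measurable_gauss_lip.
exists (`|f 0| + L * \sum_i n1 (g i)), K => w.
have := f_lip 0 (\sum_i Z w i 0 *: g i); rewrite add0r => h.
rewrite -[X in `|X|](subrK (f 0)) addrC (le_trans (ler_normD _ _)) // -addrA lerD2l.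
rewrite (le_trans h) // -mulrA -mulrDr ler_wpM2l //.
rewrite -[X in _ <= X + _]mulr1 -mulrDr.
rewrite (le_trans (n1_sum _ _ _)) // big_distrl; apply: ler_sum => i _ /=.
rewrite n1Z mulrC ler_wpM2l ?n1_ge0 // (@le_trans _ _ (1 + Z w i 0 ^+ 2)) //.
  set t := Z w i 0; have := sqr_ge0 (`|t| - 1); rewrite -[t ^+ 2]real_normK ?num_real //.
  have := normr_ge0 t; nra.
rewrite lerD2l (bigD1 i) //= lerDl sumr_ge0 // => j _; exact: sqr_ge0.
Qed.

(** The mean of the step function on boxes is the iterated quadrature reached from the walk. All
    discretization errors are O(1/P) with [P] arbitrary, so they vanish from the bound. *)
Lemma gauss_walk M a n : 0 <= a -> a * Num.sqrt n%:R = 1 -> 0 <= M ->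
  let gs := map g (index_enum 'I_d) in
  smooth_along L M gs f ->
  `|(\int[Q]_w f (\sum_i Z w i 0 *: g i))%R - iter n (walk (map ( *:%R a) gs)) f 0|
    <= d%:R * (n%:R * (a ^+ 3 * (1 + gauss_abs3 R) * M)).
Proof.
move=> a0 an M0 gs Hf; set I := (X in `|X - _|); set W := iter _ _ _ _.
set B := n%:R * _.
have iF := integrable_dominated Z_gauss gauss_lip_dominated.
have key P : (0 < P)%N -> `|I - W| <= d%:R * B + (K * d%:R + K * d%:R + d%:R * (L * 2)) / P%:R.
  move=> P0.
  have := @walk_favg R d _ (cellw R (P := P)) (cellpt R (P := P)) (2 / P%:R)
    (@cellw_ge0 R P) (cellw_sum1 R P) (fun L F HF => cellw_gauss P0 HF)
    L M a n gs gs f 0 a0 an (fun x h => h) Hf.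
  rewrite (foldr_favg (cellpt R (P:=P)) g (cellw_sum1 R P)) ?index_enum_uniq // size_map.
  have -> : size (index_enum 'I_d) = d by rewrite -[RHS]card_ord cardT enumT.
  have -> : \sum_(k : {ffun 'I_d -> 'I_(P * P + P * P).+1}) (\prod_i cellw R (k i)) * f (0 + \sum_(i <- index_enum 'I_d) cellpt R (k i) *: g i)
     = (\int[Q]_w discretized P w)%R.
    by rewrite Rintegral_discretized //; apply: eq_bigr => k _; rewrite add0r.
  rewrite -/W -/B => h1.
  have h2 : `|I - (\int[Q]_w discretized P w)%R| <= K / P%:R * d%:R + K / P%:R * d%:R.
    rewrite -RintegralB //; last exact: integrable_discretized.
    apply: (Rintegral_dominated Z_gauss) => //; last by move=> w; exact: (discretized_close P0 w).
    by apply: measurable_funB; [exact: measurable_gauss_lip|exact: measurable_discretized].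
  set D := (\int[Q]_w discretized P w)%R in h1 h2.
  rewrite -[X in `|X|](subrKA D) (le_trans (ler_normD _ _)) //.
  rewrite distrC in h1; rewrite (le_trans (lerD h2 h1)) // le_eqVlt; apply/orP; left; apply/eqP.
  by rewrite mulrDr; field; rewrite pnatr_eq0 -lt0n.
apply/ler_addgt0Pr => e e0; set c := K * d%:R + K * d%:R + d%:R * (L * 2) in key.
rewrite (le_trans (key (Num.truncn (c / e)).+1 isT)) // lerD2l ler_pdivrMr // mulrC -ler_pdivrMr //.
exact/ltW/truncnS_gt.
Qed.

End GaussianWalk.

                                           

(** * Second moment of the TD error *)

Section StepSizes.
Variables (R : realType) (eps : nat -> R).
Hypothesis eps_gt0 : forall k, 0 < eps k.
Hypothesis eps_diff : forall k, eps k - eps k.+1 <= eps k / k.+1%:R.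
Hypothesis eps_noninc : forall k, eps k.+1 <= eps k.
Hypothesis eps_small : forall eta, 0 < eta ->
  exists k0, forall k, (k0 <= k)%N -> eps k <= eta /\ k.+1%:R^-1 <= eta * eps k.

                                                                                      
               
Lemma drift_bound (a b v h : nat -> R) (c K : R) :
  0 < c -> c <= 1 -> 1 <= K ->
  (forall k, 0 <= b k) -> (forall k, b k ^+ 2 <= a k) ->
  (forall k, c * a k <= v k) -> (forall k, v k <= K * a k) ->
  (forall k, `|h k| <= K * (a k + b k)) -> (forall k, `|h k.+1| <= K * (1 + a k)) ->
  (forall k, v k.+1 - 2 * eps k * h k.+1 <=
     v k - 2 * eps k * h k - 2 * c * eps k * a k + K * eps k ^+ 2 * (1 + a k)) ->
  exists2 C, 0 <= C & forall k, a k <= C * eps k.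
Proof.
move=> c0 c1 K1 b0 ba va1 va2 hab h1 H.
have K0 : 0 < K by rewrite (lt_le_trans ltr01).
have a0 k : 0 <= a k by rewrite (le_trans (sqr_ge0 (b k))).
(* Since w <= 4 K a + K eps^2, half of the drift 2 c eps a yields the contraction g eps w; the other
   half absorbs the terms of order eps^2 a as soon as 8 K eps <= c, that is eps <= [eta]. *)
pose g := c / (4 * K); pose eta := c / (8 * K).
have g0 : 0 < g by rewrite divr_gt0 // mulr_gt0.
have eta0 : 0 < eta by rewrite divr_gt0 // mulr_gt0.
have gK : g * (4 * K) = c by rewrite /g; field; rewrite gt_eqF.
have etaK : eta * (8 * K) = c by rewrite /eta; field; rewrite gt_eqF.
have geta : g = 2 * eta by rewrite /g /eta; field; rewrite gt_eqF.
have [k0 Hk0] := eps_small eta0.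
pose w k := v k - 2 * eps k * h k.
have eta1 : eta <= 1 by nra.
have wupp k : (k0 <= k)%N -> w k <= 4 * K * a k + K * eps k ^+ 2.
  move=> kk0; have [e1 e2] := Hk0 k kk0; have e0 := eps_gt0 k.
  have := hab k; have := va2 k; have := ba k; have := a0 k; have := b0 k.
  rewrite /w; move: (a k) (b k) (v k) (h k) (eps k) e0 e1 {e2} => A B v' h' e e0 e1 B0 A0 BA vA.
  rewrite ler_norml => /andP[hl hu].
  have t1 : - (2 * e * h') <= 2 * e * (K * (A + B)) by rewrite -mulrN ler_wpM2l; lra.
  have t2 : 2 * e * B <= e ^+ 2 + A by have := sqr_ge0 (e - B); nra.
  have t3 : K * (2 * e * B) <= K * (e ^+ 2 + A) by rewrite ler_wpM2l // ltW.
  have t4 : e * (K * A) <= 1 * (K * A) by apply: ler_wpM2r; [exact: mulr_ge0 (ltW K0) A0 | lra].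
  lra.
have wlow k : (k0 <= k)%N -> c / 2 * a k <= w k + 4 * K ^+ 2 / c * eps k ^+ 2.
  move=> kk0; have [e1 e2] := Hk0 k kk0; have e0 := eps_gt0 k.
  have := hab k; have := va1 k; have := ba k; have := a0 k; have := b0 k.
  rewrite /w; move: (a k) (b k) (v k) (h k) (eps k) e0 e1 {e2} => A B v' h' e e0 e1 B0 A0 BA vA.
  rewrite ler_norml => /andP[hl hu].
  have t1 : 2 * e * h' <= 2 * e * (K * (A + B)) by rewrite ler_wpM2l; lra.
  have t2 : 2 * e * K * B <= c / 4 * A + 4 * K ^+ 2 / c * e ^+ 2.
    have t21 : 2 * e * K * B <= c / 4 * B ^+ 2 + 4 * K ^+ 2 / c * e ^+ 2.
      have -> : c / 4 * B ^+ 2 + 4 * K ^+ 2 / c * e ^+ 2 =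
         2 * e * K * B + (c * B - 4 * K * e) ^+ 2 / (4 * c) by field; rewrite gt_eqF.
      by rewrite lerDl divr_ge0 ?sqr_ge0 // ltW // mulr_gt0.
    by rewrite (le_trans t21) // lerD2r ler_wpM2l // divr_ge0 // ltW.
  have t3 : e * (8 * K * A) <= eta * (8 * K * A) by rewrite ler_wpM2r // !mulr_ge0 // ltW.
  have t4 : eta * (8 * K * A) = c * A by rewrite -etaK mulrA.
  lra.
have step k : (k0 <= k)%N -> w k.+1 <= (1 - g * eps k) * w k + (3 * K + c) * eps k ^+ 2.
  move=> kk0; have [e1 e2] := Hk0 k kk0; have e0 := eps_gt0 k.
  have W := wupp k kk0.
  have Hk := H k; have h1k := h1 k; have dk := eps_diff k; have nk := eps_noninc k.
  have a0k := a0 k.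
  have d2 : eps k - eps k.+1 <= eta * eps k ^+ 2.
    by rewrite (le_trans dk) // expr2 mulrA mulrC ler_wpM2r // ltW.
  have s1 : 2 * (eps k - eps k.+1) * h k.+1 <= 2 * (eta * eps k ^+ 2) * (K * (1 + a k)).
    rewrite (le_trans (ler_norm _)) // normrM ler_pM //.
    by rewrite normrM !ger0_norm ?subr_ge0 // ler_wpM2l.
  have s2 : w k.+1 <= w k - 2 * c * eps k * a k + K * eps k ^+ 2 * (1 + a k) +
      2 * (eta * eps k ^+ 2) * (K * (1 + a k)) by rewrite /w in Hk s1 *; lra.
  have s3 : eta * (eps k ^+ 2 * (K * (1 + a k))) <= 1 * (eps k ^+ 2 * (K * (1 + a k))).
    by rewrite ler_wpM2r // !mulr_ge0 ?sqr_ge0 ?addr_ge0 // ltW.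
  have s4 : eps k * (8 * K * (eps k * a k)) <= eta * (8 * K * (eps k * a k)).
    by rewrite ler_wpM2r // !mulr_ge0 // ltW.
  have s5 : eta * (8 * K * (eps k * a k)) = c * (eps k * a k) by rewrite -etaK mulrA.
  have s6 : g * eps k * w k <= g * eps k * (4 * K * a k + K * eps k ^+ 2).
    by rewrite ler_wpM2l // mulr_ge0 // ltW.
  have s7 : g * eps k * (4 * K * a k) = c * (eps k * a k) by rewrite -gK; ring.
  have s8 : eps k * (g * K * eps k ^+ 2) <= 1 * (g * K * eps k ^+ 2).
    by apply: ler_wpM2r; [exact: mulr_ge0 (mulr_ge0 (ltW g0) (ltW K0)) (sqr_ge0 _) | lra].
  have s9 : g * K * eps k ^+ 2 = c / 4 * eps k ^+ 2 by rewrite -gK; field.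
  have q0 : 0 <= c * eps k ^+ 2 by rewrite mulr_ge0 ?sqr_ge0 // ltW.
  have q1 : 0 <= c * (eps k * a k) by rewrite !mulr_ge0 // ltW.
  lra.
(* The first term bounds the noise by M eta eps^2, the second starts the induction at [k0]. As g = 2
   eta, the contraction pays once for the noise and once for the decrease of eps. *)
pose M := 2 * (3 * K + c) / g + `|w k0| / eps k0.
have M1 : (3 * K + c) <= M * eta.
  rewrite /M geta (@le_trans _ _ (2 * (3 * K + c) / (2 * eta) * eta)) //.
    by rewrite le_eqVlt; apply/orP; left; apply/eqP; field; rewrite gt_eqF.
  by rewrite ler_wpM2r ?(ltW eta0) // lerDl divr_ge0 // ltW.
have M0 : 0 <= M by rewrite -(pmulr_lge0 _ eta0) (le_trans _ M1) // addr_ge0 ?mulr_ge0 // ltW.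
have wM k : w (k0 + k)%N <= M * eps (k0 + k)%N.
  elim: k => [|k IH].
    rewrite addn0 /M mulrDl divfK ?gt_eqF // (le_trans (ler_norm _)) // lerDr.
    by rewrite mulr_ge0 ?divr_ge0 ?mulr_ge0 ?addr_ge0 ?mulr_ge0 // ltW.
  rewrite addnS; set k' := (k0 + k)%N in IH *.
  have kk : (k0 <= k')%N by rewrite leq_addr.
  have [e1 e2] := Hk0 k' kk; have e0 := eps_gt0 k'; have dk := eps_diff k'.
  have ge : g * eps k' <= 1 by rewrite geta; nra.
  rewrite (le_trans (step k' kk)) //.
  have u1 : (1 - g * eps k') * w k' <= (1 - g * eps k') * (M * eps k').
    by rewrite ler_wpM2l // subr_ge0.
  have u2 : eps k' / k'.+1%:R <= eta * eps k' ^+ 2.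
    by rewrite expr2 mulrA mulrC ler_wpM2r // ltW.
  have u3 : M * (eps k' - eps k'.+1) <= M * (eta * eps k' ^+ 2).
    by rewrite ler_wpM2l // (le_trans dk).
  have u4 : (3 * K + c) * eps k' ^+ 2 <= M * eta * eps k' ^+ 2 by rewrite ler_wpM2r ?sqr_ge0.
  have u5 : g * eps k' * (M * eps k') = 2 * (M * eta * eps k' ^+ 2) by rewrite geta; ring.
  lra.
(* [C1] inverts the lower bound of w in terms of a; [C2] covers the finitely many times before
   [k0]. *)
pose C1 := 2 / c * (M + 4 * K ^+ 2 / c); pose C2 := \sum_(j < k0) a j / eps j.
have C10 : 0 <= C1.
  exact: mulr_ge0 (divr_ge0 (ler0n _ 2) (ltW c0))
    (addr_ge0 M0 (divr_ge0 (mulr_ge0 (ler0n _ 4) (sqr_ge0 K)) (ltW c0))).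
have C20 : 0 <= C2 by apply: sumr_ge0 => j _; rewrite divr_ge0 // ltW.
exists (C1 + C2) => [|k]; first exact: addr_ge0.
have e0 := eps_gt0 k; case: (leqP k0 k) => kk.
  have [e1 _] := Hk0 k kk; have := wM (k - k0)%N; rewrite subnKC // => wk.
  rewrite mulrDl (@le_trans _ _ (C1 * eps k)) ?lerDl ?(mulr_ge0 C20 (ltW e0)) //.
  have -> : C1 * eps k = (M * eps k + 4 * K ^+ 2 / c * eps k) / (c / 2).
    by rewrite /C1; field; rewrite gt_eqF.
  rewrite ler_pdivlMr ?divr_gt0 // mulrC (le_trans (wlow k kk)) // lerD //.
  apply: ler_wpM2l; first exact: divr_ge0 (mulr_ge0 (ler0n _ 4) (sqr_ge0 K)) (ltW c0).
  by rewrite expr2 ler_piMl ?(ltW e0) // (le_trans e1 eta1).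
rewrite mulrDl (@le_trans _ _ (C2 * eps k)) ?lerDr ?(mulr_ge0 C10 (ltW e0)) //.
rewrite -ler_pdivrMr // /C2 (bigD1 (Ordinal kk)) //= lerDl.
by apply: sumr_ge0 => j _; rewrite divr_ge0 // ltW.
Qed.

End StepSizes.

Section BilinearForm.
Variables (R : realType) (d : nat).
Implicit Types (u v : 'cV[R]_d).

Definition nm (M : 'M[R]_d) : R := \sum_i \sum_j `|M i j|.

Lemma nm_ge0 M : 0 <= nm M.
Proof. by apply: sumr_ge0 => i _; apply: sumr_ge0. Qed.

Lemma n1_mulmx M u : n1 (M *m u) <= nm M * n1 u.
Proof.
rewrite /nm big_distrl; apply: ler_sum => i _ /=; rewrite mxE (le_trans (ler_norm_sum _ _ _)) //.
rewrite big_distrl; apply: ler_sum => j _ /=; rewrite normrM ler_wpM2l //; exact: n1_coord.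
Qed.

Definition bform (Q : 'M[R]_d) u v : R := (u^T *m Q *m v) 0 0.

Lemma bformDl Q u u' v : bform Q (u + u') v = bform Q u v + bform Q u' v.
Proof. by rewrite /bform linearD !mulmxDl mxE. Qed.

Lemma bformDr Q u v v' : bform Q u (v + v') = bform Q u v + bform Q u v'.
Proof. by rewrite /bform mulmxDr mxE. Qed.

Lemma bformZl Q c u v : bform Q (c *: u) v = c * bform Q u v.
Proof. by rewrite /bform linearZ /= -!scalemxAl mxE. Qed.

Lemma bformZr Q c u v : bform Q u (c *: v) = c * bform Q u v.
Proof. by rewrite /bform -scalemxAr mxE. Qed.

Lemma bformNr Q u v : bform Q u (- v) = - bform Q u v.
Proof. by rewrite -scaleN1r bformZr mulN1r. Qed.

Lemma bform_sumr Q u (I : Type) (s : seq I) (F : I -> 'cV[R]_d) :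
  bform Q u (\sum_(i <- s) F i) = \sum_(i <- s) bform Q u (F i).
Proof. by rewrite /bform mulmx_sumr summxE. Qed.

Lemma bformC Q u v : Q^T = Q -> bform Q u v = bform Q v u.
Proof.
move=> QT; rewrite /bform -[in LHS](trmxK (u^T *m Q *m v)) mxE !trmx_mul trmxK QT.
by rewrite mulmxA.
Qed.

Lemma bform_le Q u v : `|bform Q u v| <= nm Q * n1 u * n1 v.
Proof.
rewrite /bform -mulmxA mxE (le_trans (ler_norm_sum _ _ _)) //.
apply: (@le_trans _ _ (\sum_i n1 u * `|(Q *m v) i 0|)).
  by apply: ler_sum => i _; rewrite mxE normrM ler_wpM2r // n1_coord.
rewrite -big_distrr /= mulrAC mulrC ler_wpM2r ?n1_ge0 //; exact: n1_mulmx.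
Qed.

End BilinearForm.

Section TDError.
Variables (R : realType) (S : finType) (d : nat) (p : S -> S -> R) (mu : S -> R).
Hypothesis p_st : stochastic p.
Hypothesis mu_ge0 : forall x, 0 <= mu x.
Hypothesis mu_sum1 : \sum_x mu x = 1.
Variables (A U : S -> 'M[R]_d) (Abar Q : 'M[R]_d) (r V : S -> 'cV[R]_d).
Variables (eps : nat -> R) (D : (nat -> S) -> nat -> 'cV[R]_d) (D0 : 'cV[R]_d).
Hypothesis D_init : forall x, D x 0%N = D0.
Hypothesis D_rec : forall x k, D x k.+1 = D x k - eps k *: (A (x k) *m D x k + r (x k)).
Hypothesis U_poisson : forall x, U x - \sum_y p x y *: U y = A x - Abar.
Hypothesis V_poisson : forall x, V x - \sum_y p x y *: V y = r x.
Hypothesis eps_gt0 : forall k, 0 < eps k.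
Hypothesis eps_le1 : forall k, eps k <= 1.
Hypothesis eps_diff : forall k, eps k - eps k.+1 <= eps k / k.+1%:R.
Hypothesis eps_noninc : forall k, eps k.+1 <= eps k.
Hypothesis eps_small : forall eta, 0 < eta ->
  exists k0, forall k, (k0 <= k)%N -> eps k <= eta /\ k.+1%:R^-1 <= eta * eps k.
Variable kap : R.
Hypothesis kap_ge1 : 1 <= kap.
Hypothesis A_le : forall x, nm (A x) <= kap.
Hypothesis U_le : forall x, nm (U x) <= kap.
Hypothesis r_le : forall x, n1 (r x) <= kap.
Hypothesis V_le : forall x, n1 (V x) <= kap.
Hypothesis Q_le : nm Q <= kap.
Hypothesis Q_sym : Q^T = Q.
Variable c : R.
Hypothesis c_gt0 : 0 < c.
Hypothesis c_le1 : c <= 1.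
Hypothesis Q_pos : forall u, c * n1 u ^+ 2 <= bform Q u u.
Hypothesis Q_drift : forall u, c * n1 u ^+ 2 <= bform Q u (Abar *m u).

Notation E := (EP p mu).

Let kap_gt0 : 0 < kap. Proof. by rewrite (lt_le_trans ltr01). Qed.
Let kap_ge0 := ltW kap_gt0.

(** The inequality is strict: [D x k.+1] is already determined when [x k.+1] is averaged over. *)
Lemma td_adapted k x y : (forall j, (j < k)%N -> x j = y j) -> D x k = D y k.
Proof.
elim: k => [|k IH] xy; first by rewrite !D_init.
by rewrite !D_rec xy // IH // => j jk; rewrite xy // ltnS ltnW.
Qed.

Let G x u := A x *m u + r x.

Lemma affine_le (M : 'M[R]_d) (b u : 'cV[R]_d) : nm M <= kap -> n1 b <= kap ->
  n1 (M *m u + b) <= kap * (1 + n1 u).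
Proof.
move=> hM hb; rewrite (le_trans (n1D _ _)) // mulrDr mulr1 addrC lerD //.
by rewrite (le_trans (n1_mulmx _ _)) // ler_wpM2r // n1_ge0.
Qed.

(** Corrector for the noise in the drift of the quadratic form: [U] treats the multiplicative part,
    [V] the additive one. *)
Let H y u := bform Q u (U y *m u + V y).

Lemma bform_kap u v : `|bform Q u v| <= kap * n1 u * n1 v.
Proof.
by rewrite (le_trans (bform_le _ _ _)) // !ler_wpM2r ?n1_ge0.
Qed.

Lemma corrector_le y u : `|H y u| <= kap ^+ 2 * (n1 u ^+ 2 + n1 u).
Proof.
rewrite (le_trans (bform_kap _ _)) //.
have -> : kap ^+ 2 * (n1 u ^+ 2 + n1 u) = kap * n1 u * (kap * (1 + n1 u)) by ring.
by rewrite ler_wpM2l ?mulr_ge0 ?n1_ge0 // affine_le.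
Qed.

Lemma td_step_le x k : n1 (eps k *: G (x k) (D x k)) <= eps k * (kap * (1 + n1 (D x k))).
Proof.
by rewrite n1Z (gtr0_norm (eps_gt0 k)) ler_wpM2l ?(ltW (eps_gt0 k)) // affine_le.
Qed.

Lemma td_growth x k : 1 + n1 (D x k.+1) <= (1 + kap) * (1 + n1 (D x k)).
Proof.
rewrite D_rec -/(G _ _); have := n1D (D x k) (- (eps k *: G (x k) (D x k))).
rewrite n1N; have := td_step_le x k; have := n1_ge0 (D x k); have := eps_le1 k.
set t := n1 (D x k); move=> e1 t0 h1 h2.
have : eps k * (kap * (1 + t)) <= 1 * (kap * (1 + t)).
  by rewrite ler_wpM2r // mulr_ge0 ?addr_ge0.
lra.
Qed.

(** The price of keeping the old iterate in the corrector: one step moves it by O(eps) only. *)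
Lemma corrector_step y x k : `|H y (D x k.+1) - H y (D x k)|
  <= eps k * (kap ^+ 3 * (2 + kap)) * (1 + n1 (D x k)) ^+ 2.
Proof.
set t := n1 (D x k); have t0 : 0 <= t := n1_ge0 _.
have he := td_step_le x k; have hg := td_growth x k; rewrite -/t in he hg.
pose e := - (eps k *: G (x k) (D x k)).
have De : D x k.+1 = D x k + e by rewrite D_rec.
rewrite -n1N -/e in he.
have -> : H y (D x k.+1) - H y (D x k) =
    bform Q e (U y *m D x k.+1 + V y) + bform Q (D x k) (U y *m e).
  rewrite /H {1}De bformDl De mulmxDr (addrAC (U y *m D x k)) !bformDr; ring.
rewrite (le_trans (ler_normD _ _)) //.
have b1 := bform_kap e (U y *m D x k.+1 + V y).
have b2 := bform_kap (D x k) (U y *m e).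
have b3 := affine_le (D x k.+1) (U_le y) (V_le y).
have b4 : n1 (U y *m e) <= kap * n1 e.
  by rewrite (le_trans (n1_mulmx _ _)) // ler_wpM2r ?n1_ge0.
have e0 := n1_ge0 e.
have c1 : kap * n1 e * n1 (U y *m D x k.+1 + V y) <=
   kap * (eps k * (kap * (1 + t))) * (kap * ((1 + kap) * (1 + t))).
  apply: ler_pM; rewrite ?mulr_ge0 ?n1_ge0 //; first by rewrite ler_wpM2l.
  by rewrite (le_trans b3) // ler_wpM2l.
have c2 : kap * t * n1 (U y *m e) <= kap * (1 + t) * (kap * (eps k * (kap * (1 + t)))).
  apply: ler_pM; rewrite ?mulr_ge0 ?n1_ge0 //; first by rewrite ler_wpM2l // lerDr.
  by rewrite (le_trans b4) // ler_wpM2l.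
rewrite (le_trans (lerD (le_trans b1 c1) (le_trans b2 c2))) // le_eqVlt; apply/orP; left.
by apply/eqP; ring.
Qed.

Lemma corrector_poisson x u :
  \sum_y p x y * H y u = H x u - bform Q u ((A x - Abar) *m u + r x).
Proof.
have -> : \sum_y p x y * H y u = bform Q u ((\sum_y p x y *: U y) *m u + \sum_y p x y *: V y).
  rewrite mulmx_suml -big_split bform_sumr; apply: eq_bigr => y _ /=.
  by rewrite -scalemxAl -scalerDr bformZr.
rewrite /H -bformNr -bformDr; congr bform.
rewrite -U_poisson -V_poisson mulmxBl opprD !opprB addrACA.
by rewrite [U x *m u + _]addrC [V x + _]addrC !subrK.
Qed.

(** kap^3 (5 + 2 kap) collects the square of the step and twice the reserve for [corrector_step];
    the factor 2 comes from (1 + t)^2 <= 2 (1 + t^2). *)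
Let K := 2 * kap ^+ 3 * (5 + 2 * kap).

(** Averaging the corrector over the next state trades the random matrix [A (x k)] for [Abar], to
    which [Q_drift] applies. The extra eps^2 term on the left is the reserve for
    [corrector_step]. *)
Lemma td_drift x k :
  let u := D x k in
  bform Q (D x k.+1) (D x k.+1) - 2 * eps k * (\sum_y p (x k) y * H y u)
    + 2 * eps k ^+ 2 * (kap ^+ 3 * (2 + kap)) * (1 + n1 u) ^+ 2
  <= bform Q u u - 2 * eps k * H (x k) u - 2 * c * eps k * n1 u ^+ 2
     + K * eps k ^+ 2 * (1 + n1 u ^+ 2).
Proof.
rewrite /=; set u := D x k; set t := n1 u; have t0 : 0 <= t := n1_ge0 _.
set g := G (x k) u.
have -> : D x k.+1 = u + - eps k *: g by rewrite D_rec -/u scaleNr.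
rewrite corrector_poisson.
have -> : bform Q u ((A (x k) - Abar) *m u + r (x k)) = bform Q u g - bform Q u (Abar *m u).
  rewrite -bformNr -bformDr; congr bform; rewrite /g /G mulmxBl -!addrA; congr (_ + _).
  by rewrite addrC.
have h2 : bform Q g g <= kap ^+ 3 * (1 + t) ^+ 2.
  rewrite (le_trans (ler_norm _)) // (le_trans (bform_kap _ _)) //.
  have -> : kap ^+ 3 * (1 + t) ^+ 2 = kap * (kap * (1 + t)) * (kap * (1 + t)) by ring.
  have gl := affine_le u (A_le (x k)) (r_le (x k)).
  by apply: ler_pM; rewrite ?mulr_ge0 ?n1_ge0 // ler_wpM2l.
clearbody g; rewrite bformDl !bformDr !bformZl !bformZr (bformC g u Q_sym).
have h1 := Q_drift u; rewrite -/t in h1.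
have h3 : (1 + t) ^+ 2 <= 2 * (1 + t ^+ 2) by have := sqr_ge0 (t - 1); lra.
have e0 := eps_gt0 k.
have h4 : eps k * (c * t ^+ 2) <= eps k * bform Q u (Abar *m u) by rewrite ler_wpM2l // ltW.
have h5 : eps k ^+ 2 * bform Q g g <= eps k ^+ 2 * (kap ^+ 3 * (1 + t) ^+ 2).
  by rewrite ler_wpM2l // sqr_ge0.
have h6 : eps k ^+ 2 * (kap ^+ 3 * (5 + 2 * kap)) * (1 + t) ^+ 2 <=
          eps k ^+ 2 * (kap ^+ 3 * (5 + 2 * kap)) * (2 * (1 + t ^+ 2)).
  apply: ler_wpM2l => //; apply: mulr_ge0 (sqr_ge0 _) (mulr_ge0 (exprn_ge0 3 kap_ge0) _).
  by rewrite addr_ge0 // mulr_ge0.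
rewrite /K; lra.
Qed.

Lemma td_second_moment : exists2 C, 0 <= C &
  forall k, E k (fun x => n1 (D x k) ^+ 2) <= C * eps k.
Proof.
have K3 : 1 <= kap ^+ 3 by rewrite exprn_ege1.
have t1 (t : R) : 0 <= t -> (1 + t) ^+ 2 <= 2 * (1 + t ^+ 2).
  by move=> _; have := sqr_ge0 (t - 1); lra.
have kK : kap ^+ 2 <= K.
  rewrite /K; have : kap ^+ 2 * 1 <= kap ^+ 2 * kap by rewrite ler_wpM2l ?exprn_ge0.
  have : 0 <= kap ^+ 3 * kap by rewrite mulr_ge0 ?exprn_ge0.
  have := exprn_ge0 2 kap_ge0; lra.
have kK1 : 1 <= kap ^+ 2 by rewrite exprn_ege1.
apply: (@drift_bound _ eps eps_gt0 eps_diff eps_noninc eps_small _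
  (fun k => E k (fun x => n1 (D x k))) (fun k => E k (fun x => bform Q (D x k) (D x k)))
  (fun k => E k (fun x => H (x k) (D x k))) c K c_gt0 c_le1).
- exact: le_trans kK1 kK.
- by move=> k; apply: EP_ge0 => // x; exact: n1_ge0.
- by move=> k; exact: EP_sqr.
- by move=> k; rewrite -EPZ; apply: EP_le => // x; exact: Q_pos.
- move=> k; rewrite -EPZ; apply: EP_le => // x.
  rewrite (le_trans (ler_norm _)) // (le_trans (bform_kap _ _)) //.
  rewrite -mulrA -expr2 ler_wpM2r ?sqr_ge0 // (le_trans _ kK) //.
  by rewrite expr2 ler_peMr.
- move=> k; rewrite -EPD -EPZ (le_trans (EP_abs _ _ _ _)) //; apply: EP_le => // x.
  rewrite (le_trans (corrector_le _ _)) // ler_wpM2r //.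
  by rewrite addr_ge0 ?sqr_ge0 ?n1_ge0.
- move=> k; rewrite -(EP_cst p_st mu_sum1 k 1) -EPD -EPZ (le_trans (EP_abs _ _ _ _)) //.
  rewrite -(@EP_tower _ _ p mu p_st k k.+1 (fun x => K * (1 + n1 (D x k) ^+ 2))) //; last first.
    by move=> x y xy; rewrite (@td_adapted k x y) // => j jk; rewrite xy // ltnW.
  apply: EP_le => // x; rewrite (le_trans (corrector_le _ _)) //.
  have g := td_growth x k; set t' := n1 _ in g *; set t := n1 _ in g *.
  have t'0 : 0 <= t' := n1_ge0 _; have t0 : 0 <= t := n1_ge0 _.
  have g2 : (1 + t') ^+ 2 <= ((1 + kap) * (1 + t)) ^+ 2.
    by rewrite lerXn2r ?nnegrE ?mulr_ge0 ?addr_ge0.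
  have h1 : kap ^+ 2 * (t' ^+ 2 + t') <= kap ^+ 2 * ((1 + kap) * (1 + t)) ^+ 2.
    by rewrite ler_wpM2l ?sqr_ge0 // (le_trans _ g2) //; lra.
  rewrite (le_trans h1) // exprMn mulrA.
  have h2 : kap ^+ 2 * (1 + kap) ^+ 2 * (1 + t) ^+ 2 <=
      kap ^+ 2 * (1 + kap) ^+ 2 * (2 * (1 + t ^+ 2)).
    by rewrite ler_wpM2l ?t1 // mulr_ge0 ?sqr_ge0.
  rewrite (le_trans h2) // mulrA ler_wpM2r ?addr_ge0 ?sqr_ge0 // /K.
  have : 0 <= kap ^+ 2 * (kap - 1) by rewrite mulr_ge0 ?sqr_ge0 ?subr_ge0.
  have : 0 <= kap ^+ 3 * (kap - 1) by rewrite mulr_ge0 ?exprn_ge0 ?subr_ge0.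
  have := exprn_ge0 3 kap_ge0; lra.
move=> k.
(* The iterate inside the corrector is frozen at time [k], so that the new state occurs only as [y]
   and can be averaged. *)
pose F x y := bform Q (D x k.+1) (D x k.+1) - 2 * eps k * H y (D x k)
  + 2 * eps k ^+ 2 * (kap ^+ 3 * (2 + kap)) * (1 + n1 (D x k)) ^+ 2.
have Dk x y : (forall j, (j <= k)%N -> x j = y j) -> D x k = D y k.
  by move=> xy; apply: td_adapted => j jk; rewrite xy // ltnW.
have -> : E k.+1 (fun x => bform Q (D x k.+1) (D x k.+1)) - 2 * eps k *
     E k.+1 (fun x => H (x k.+1) (D x k.+1)) =
  E k.+1 (fun x => bform Q (D x k.+1) (D x k.+1) - 2 * eps k * H (x k.+1) (D x k.+1)).
  by rewrite EPB EPZ.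
apply: (@le_trans _ _ (E k.+1 (fun x => F x (x k.+1)))).
  apply: EP_le => // x; rewrite /F.
  have := corrector_step (x k.+1) x k; rewrite ler_norml => /andP[h _].
  have e0 := eps_gt0 k.
  have : eps k * (- (eps k * (kap ^+ 3 * (2 + kap)) * (1 + n1 (D x k)) ^+ 2)) <=
     eps k * (H (x k.+1) (D x k.+1) - H (x k.+1) (D x k)) by rewrite ler_wpM2l // ltW.
  lra.
rewrite EP_markov //; last first.
  move=> y x x' xx'; rewrite /F (@td_adapted k.+1 x x') //.
  by rewrite (Dk _ _ xx').
pose RHS x := bform Q (D x k) (D x k) - 2 * eps k * H (x k) (D x k) -
  2 * c * eps k * n1 (D x k) ^+ 2 + K * eps k ^+ 2 * (1 + n1 (D x k) ^+ 2).
apply: (@le_trans _ _ (E k.+1 RHS)).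
  apply: EP_le => // x; rewrite (le_trans _ (td_drift x k)) // /F.
  under eq_bigr do rewrite mulrDr mulrBr.
  rewrite big_split sumrB /= -!big_distrl /= (p_st.2 _) !mul1r.
  rewrite lerD2r lerD2l lerN2 le_eqVlt; apply/orP; left; apply/eqP.
  by rewrite big_distrr; apply: eq_bigr => y _ /=; rewrite mulrCA.
rewrite (@EP_tower _ _ p mu p_st k k.+1) //; last first.
  by move=> x y xy; rewrite /RHS (Dk _ _ xy) xy.
by rewrite /RHS !EPD !EPN !EPZ EPD EP_cst.
Qed.

End TDError.

                                            

(** * Decomposition of the averaged error *)

Section MartingaleSecondMoment.
Variables (R : realType) (S : finType) (p : S -> S -> R) (mu : S -> R).
Hypothesis p_st : stochastic p.
Variable xi : nat -> (nat -> S) -> S -> R.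
Hypothesis xi_adapted : forall k y, adapted k ((xi k)^~ y).
Hypothesis xi_mart : forall k x, \sum_y p (x k) y * xi k x y = 0.

(** Orthogonality of martingale increments. *)
Lemma martingale_second_moment n :
  EP p mu n.+1 (fun x => (\sum_(1 <= k < n.+1) xi k x (x k.+1)) ^+ 2) =
  \sum_(1 <= k < n.+1) EP p mu k.+1 (fun x => xi k x (x k.+1) ^+ 2).
Proof.
elim: n => [|n IH].
  rewrite big_geq // -[RHS](EP0 p mu 1); apply: EP_ext => x.
  by rewrite big_geq // expr0n.
have Mad : adapted n.+1 (fun x => \sum_(1 <= k < n.+1) xi k x (x k.+1)).
  move=> x y xy; rewrite !big_nat; apply: eq_bigr => k /andP[_ kn].
  rewrite (xi_adapted (x k.+1) (_ : forall j, (j <= k)%N -> x j = y j)) => [|j jk].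
    by rewrite xy.
  by rewrite xy // (leq_trans jk) // ltnW.
rewrite [RHS]big_nat_recr // -IH.
rewrite -(@EP_tower _ _ p mu p_st n.+1 n.+2 (fun x => (\sum_(1 <= k < n.+1) _) ^+ 2)) //; last first.
  by move=> x y xy; rewrite (Mad x y xy).
transitivity (EP p mu n.+2 (fun x => (\sum_(1 <= k < n.+1) xi k x (x k.+1)) ^+ 2 +
   2 * ((\sum_(1 <= k < n.+1) xi k x (x k.+1)) * xi n.+1 x (x n.+2)) + xi n.+1 x (x n.+2) ^+ 2)).
  by apply: EP_ext => x; rewrite big_nat_recr //=; ring.
rewrite !EPD EPZ.
rewrite (@EP_markov _ _ p mu p_st n.+1 n.+2
  (fun x y => (\sum_(1 <= k < n.+1) xi k x (x k.+1)) * xi n.+1 x y)) //; last first.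
  by move=> y u v uv; rewrite (Mad u v uv) (xi_adapted y uv).
rewrite [X in 2 * X](_ : _ = 0) ?mulr0 ?addr0 //.
rewrite -[RHS](EP0 p mu n.+2); apply: EP_ext => x.
under eq_bigr do rewrite mulrCA; by rewrite -big_distrr /= xi_mart mulr0.
Qed.

End MartingaleSecondMoment.

Section Decomposition.
Variables (R : realType) (S : finType) (d : nat) (p : S -> S -> R) (mu : S -> R).
Hypothesis p_st : stochastic p.
Hypothesis mu_ge0 : forall x, 0 <= mu x.
Hypothesis mu_sum1 : \sum_x mu x = 1.
Variables (A U : S -> 'M[R]_d) (Abar : 'M[R]_d) (r V : S -> 'cV[R]_d).
Variables (eps : nat -> R) (D : (nat -> S) -> nat -> 'cV[R]_d).
Hypothesis D_adapted : forall k x y, (forall j, (j < k)%N -> x j = y j) -> D x k = D y k.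
Hypothesis D_rec : forall x k, D x k.+1 = D x k - eps k *: (A (x k) *m D x k + r (x k)).
Hypothesis U_poisson : forall x, U x - \sum_y p x y *: U y = A x - Abar.
Hypothesis V_poisson : forall x, V x - \sum_y p x y *: V y = r x.
Hypothesis eps_gt0 : forall k, 0 < eps k.
Hypothesis eps_le1 : forall k, eps k <= 1.
Hypothesis eps_noninc : forall k, eps k.+1 <= eps k.
Variables kap C : R.
Hypothesis kap_ge0 : 0 <= kap.
Hypothesis A_le : forall x, nm (A x) <= kap.
Hypothesis U_le : forall x, nm (U x) <= kap.
Hypothesis r_le : forall x, n1 (r x) <= kap.
Hypothesis V_le : forall x, n1 (V x) <= kap.
Hypothesis C_ge0 : 0 <= C.
Hypothesis D_le : forall k, EP p mu k (fun x => n1 (D x k) ^+ 2) <= C ^+ 2 * eps k.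

Notation E := (EP p mu).

(** The second-moment bound makes the mean of |D_k| / eps_k of order [s k]. *)
Let s k : R := (Num.sqrt (eps k))^-1.
Let nu x y : 'M[R]_d := U y - \sum_z p x z *: U z.
(** Collects what telescopes: the Poisson solutions for both kinds of noise, and D_k / eps_k from
    Abel summation. *)
Let Y x k : 'cV[R]_d := V (x k) + U (x k) *m D x k - (eps k)^-1 *: D x k.

Let sqeps_gt0 k : 0 < Num.sqrt (eps k). Proof. by rewrite sqrtr_gt0. Qed.

Let s_ge1 k : 1 <= s k.
Proof.
by rewrite /s invf_ge1 // -sqrtr1 ler_wsqrtr.
Qed.

Let s_gt0 k : 0 < s k. Proof. exact: lt_le_trans ltr01 (s_ge1 k). Qed.

Let s_sqr k : s k ^+ 2 = (eps k)^-1.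
Proof. by rewrite /s exprVn sqr_sqrtr // ltW. Qed.

Let s_nondec k : s k <= s k.+1.
Proof. by rewrite /s lef_pV2 ?posrE // ler_wsqrtr. Qed.

Lemma step_decomposition x k :
  Abar *m D x k + (V (x k.+1) - \sum_y p (x k) y *: V y) =
  (Y x k.+1 - Y x k) + ((eps k.+1)^-1 - (eps k)^-1) *: D x k.+1
  - nu (x k) (x k.+1) *m D x k - U (x k.+1) *m (D x k.+1 - D x k).
Proof.
have e0 : eps k != 0 by rewrite gt_eqF.
have hr : (eps k)^-1 *: (D x k - D x k.+1) = A (x k) *m D x k + r (x k).
  by rewrite D_rec opprD opprK addrA subrr add0r scalerA mulVf // scale1r.
have hA : Abar *m D x k = A (x k) *m D x k - (U (x k) - \sum_y p (x k) y *: U y) *m D x k.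
  by rewrite U_poisson -mulmxBl opprB addrC subrK.
have hV : \sum_y p (x k) y *: V y = V (x k) - r (x k) by rewrite -V_poisson opprB addrC subrK.
rewrite hA hV /nu /Y.
have -> : A (x k) *m D x k = (eps k)^-1 *: (D x k - D x k.+1) - r (x k).
  by rewrite hr addrK.
rewrite !mulmxBl !mulmxBr; set PU := (\sum_y _) *m _.
apply/matrixP => i j; rewrite !mxE; ring.
Qed.

Lemma EP_D k : E k (fun x => n1 (D x k)) <= C * Num.sqrt (eps k).
Proof.
have h : (E k (fun x => n1 (D x k))) ^+ 2 <= (C * Num.sqrt (eps k)) ^+ 2.
  by rewrite exprMn sqr_sqrtr ?(ltW (eps_gt0 k)) // (le_trans (EP_sqr _ _ _ _ _)).
move: h; rewrite ler_sqr ?nnegrE //; first by apply: EP_ge0 => // x; exact: n1_ge0.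
by rewrite mulr_ge0 // sqrtr_ge0.
Qed.

Lemma EP_D_later k n : (k <= n)%N -> E n (fun x => n1 (D x k)) <= C * Num.sqrt (eps k).
Proof.
move=> kn; rewrite (EP_tower mu p_st kn) ?EP_D // => x y xy.
by rewrite (@D_adapted k x y) // => j jk; rewrite xy // ltnW.
Qed.

Lemma EP_Y k n : (k <= n)%N -> E n (fun x => n1 (Y x k)) <= kap + kap * C + C * s k.
Proof.
move=> kn; have e0 := eps_gt0 k; have q0 := sqeps_gt0 k.
apply: (@le_trans _ _ (E n (fun x => kap + (kap + (eps k)^-1) * n1 (D x k)))).
  apply: EP_le => // x; rewrite /Y (le_trans (n1D _ _)) // n1N n1Z gtr0_norm ?invr_gt0 //.
  rewrite mulrDl addrA lerD2r (le_trans (n1D _ _)) // lerD //.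
  by rewrite (le_trans (n1_mulmx _ _)) // ler_wpM2r // n1_ge0.
rewrite EPD EP_cst // EPZ -addrA lerD2l mulrDl.
have h := EP_D_later kn; have h0 : 0 <= E n (fun x => n1 (D x k)).
  by apply: EP_ge0 => // x; exact: n1_ge0.
rewrite lerD //.
  rewrite ler_wpM2l // (le_trans h) // -[leRHS]mulr1 ler_wpM2l //.
  by rewrite -sqrtr1 ler_wsqrtr.
rewrite (le_trans (ler_wpM2l _ h)) ?invr_ge0 ?(ltW e0) //.
by rewrite -s_sqr /s le_eqVlt; apply/orP; left; apply/eqP; field; rewrite gt_eqF.
Qed.

Lemma nm_nu x y : nm (nu x y) <= 2 * kap.
Proof.
have nmD (M N : 'M[R]_d) : nm (M + N) <= nm M + nm N.
  rewrite -big_split; apply: ler_sum => i _ /=; rewrite -big_split; apply: ler_sum => j _ /=.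
  by rewrite mxE ler_normD.
rewrite (le_trans (nmD _ _)) // mulr2n mulrDl mul1r lerD //.
have -> : nm (- \sum_z p x z *: U z) = nm (\sum_z p x z *: U z).
  by apply: eq_bigr => i _; apply: eq_bigr => j _; rewrite mxE normrN.
apply: (@le_trans _ _ (\sum_z p x z * nm (U z))); last first.
  rewrite -[leRHS]mul1r -(p_st.2 x) big_distrl; apply: ler_sum => z _ /=.
  by rewrite ler_wpM2l // p_st.1.
elim/big_rec2: _ => [|z b M _ IH].
  by rewrite /nm big1 // => i _; rewrite big1 // => j _; rewrite mxE normr0.
rewrite (le_trans (nmD _ _)) // lerD // /nm big_distrr /=; apply: ler_sum => i _.
rewrite big_distrr /=; apply: ler_sum => j _; rewrite mxE normrM.
by rewrite ger0_norm // p_st.1.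
Qed.

(** The sum is a martingale in each coordinate, so orthogonality gives the root of the sum of the
    eps_k where the triangle inequality would give the sum of their roots. *)
Lemma EP_noise n :
  E n.+1 (fun x => n1 (\sum_(1 <= k < n.+1) nu (x k) (x k.+1) *m D x k)) <=
  d%:R * (2 * kap * C) * Num.sqrt (\sum_(1 <= k < n.+1) eps k).
Proof.
rewrite /n1 EP_sum.
have -> : d%:R * (2 * kap * C) * Num.sqrt (\sum_(1 <= k < n.+1) eps k) =
   \sum_(i < d) (2 * kap * C) * Num.sqrt (\sum_(1 <= k < n.+1) eps k).
  by rewrite sumr_const card_ord -[RHS]mulr_natl [RHS]mulrA.
apply: ler_sum => i _.
set B := (2 * kap * C) * _.
have B0 : 0 <= B by rewrite /B !mulr_ge0 // sqrtr_ge0.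
rewrite -ler_sqr ?nnegrE //; last by apply: EP_ge0.
rewrite (le_trans (EP_sqr p_st mu_ge0 mu_sum1 _ _)) //.
pose xi k (x : nat -> S) y := (nu (x k) y *m D x k) i 0.
have -> : E n.+1 (fun x => `|(\sum_(1 <= k < n.+1) nu (x k) (x k.+1) *m D x k) i 0| ^+ 2) =
   E n.+1 (fun x => (\sum_(1 <= k < n.+1) xi k x (x k.+1)) ^+ 2).
  by apply: EP_ext => x; rewrite real_normK ?num_real // summxE.
rewrite martingale_second_moment //; last 2 first.
- move=> k y u v uv; rewrite /xi uv // (@D_adapted k u v) // => j jk.
  by rewrite uv // ltnW.
- move=> k x; rewrite /xi.
  have -> : \sum_y p (x k) y * (nu (x k) y *m D x k) i 0 =
     ((\sum_y p (x k) y *: nu (x k) y) *m D x k) i 0.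
    rewrite mulmx_suml summxE; apply: eq_bigr => y _.
    by rewrite -scalemxAl [RHS]mxE.
  rewrite (_ : \sum_y _ = 0) ?mul0mx ?mxE //.
  rewrite /nu; under eq_bigr do rewrite scalerBr.
  by rewrite sumrB -scaler_suml (p_st.2 _) scale1r subrr.
rewrite /B exprMn sqr_sqrtr; last by rewrite sumr_ge0 // => k _; rewrite ltW.
rewrite big_distrr; apply: ler_sum => k _.
apply: (@le_trans _ _ (E k.+1 (fun x => (2 * kap) ^+ 2 * n1 (D x k) ^+ 2))).
  apply: EP_le => // x; rewrite /xi /= -exprMn -real_normK ?num_real //.
  rewrite lerXn2r ?nnegrE ?mulr_ge0 ?n1_ge0 // (le_trans (n1_coord _ _)) //.
  by rewrite (le_trans (n1_mulmx _ _)) // ler_wpM2r ?n1_ge0 // nm_nu.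
rewrite (EP_tower mu p_st (leqnSn k)); last first.
  by move=> x y xy; rewrite (@D_adapted k x y) // => j jk; rewrite xy // ltnW.
by rewrite EPZ /= [X in _ <= X * _]exprMn -[leRHS]mulrA ler_wpM2l // sqr_ge0.
Qed.

Lemma EP_increment k n : (k < n)%N ->
  E n (fun x => n1 (U (x k.+1) *m (D x k.+1 - D x k))) <= kap ^+ 2 * (1 + C) * eps k.
Proof.
move=> kn; have e0 := eps_gt0 k.
apply: (@le_trans _ _ (E n (fun x => kap ^+ 2 * eps k * (1 + n1 (D x k))))).
  apply: EP_le => // x.
  have -> : D x k.+1 - D x k = - (eps k *: (A (x k) *m D x k + r (x k))).
    by rewrite D_rec addrAC subrr add0r.
  rewrite mulmxN n1N -scalemxAr n1Z gtr0_norm //.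
  rewrite -mulrA mulrCA ler_wpM2l ?(ltW e0) // expr2 -mulrA.
  rewrite (le_trans (n1_mulmx _ _)) // ler_pM ?nm_ge0 ?n1_ge0 //.
  rewrite (le_trans (n1D _ _)) // mulrDr mulr1 addrC lerD //.
  by rewrite (le_trans (n1_mulmx _ _)) // ler_wpM2r // n1_ge0.
rewrite EPZ EPD EP_cst // mulrAC ler_wpM2r ?(ltW e0) // ler_wpM2l ?sqr_ge0 // lerD2l.
rewrite (le_trans (EP_D_later (ltnW kn))) // -[leRHS]mulr1 ler_wpM2l //.
by rewrite -sqrtr1 ler_wsqrtr.
Qed.

(** With eps^(-1) = s^2 the coefficient factors as (s' - s)(s' + s); the moment bound C / s' cancels
    the second factor up to 2, and what remains telescopes. *)
Lemma EP_stepsize_drift k n : (k < n)%N ->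
  E n (fun x => n1 (((eps k.+1)^-1 - (eps k)^-1) *: D x k.+1)) <= 2 * C * (s k.+1 - s k).
Proof.
move=> kn; under [X in EP _ _ _ X]eq_fun do rewrite n1Z.
rewrite EPZ -!s_sqr ger0_norm; last first.
  by rewrite subr_ge0 lerXn2r ?nnegrE ?(ltW (s_gt0 _)).
apply: (@le_trans _ _ ((s k.+1 ^+ 2 - s k ^+ 2) * (C * Num.sqrt (eps k.+1)))).
  rewrite ler_wpM2l ?EP_D_later //.
  by rewrite subr_ge0 lerXn2r ?nnegrE ?(ltW (s_gt0 _)).
have -> : Num.sqrt (eps k.+1) = (s k.+1)^-1 by rewrite /s invrK.
have n0 := s_nondec k; have p0 := s_gt0 k; have p1 := s_gt0 k.+1.
rewrite mulrA ler_pdivrMr //.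
have : C * ((s k.+1 - s k) * (s k + s k.+1)) <= C * ((s k.+1 - s k) * (2 * s k.+1)).
  by rewrite ler_wpM2l // ler_wpM2l ?subr_ge0 //; lra.
lra.
Qed.

Lemma decomposition_error : exists2 C', 0 <= C' & forall n,
  E n.+1 (fun x => n1 (\sum_(1 <= k < n.+1)
     (Abar *m D x k + (V (x k.+1) - \sum_y p (x k) y *: V y)))) <=
  C' * (s n.+1 + Num.sqrt (\sum_(1 <= k < n.+1) eps k) + \sum_(1 <= k < n.+1) eps k).
Proof.
have smon n : s 1%N <= s n.+1 by elim: n => // n IH; rewrite (le_trans IH).
exists (2 * (kap + kap * C) + 2 * C + 2 * C + d%:R * (2 * kap * C) + kap ^+ 2 * (1 + C)).
  by rewrite !addr_ge0 ?mulr_ge0 ?addr_ge0 ?mulr_ge0 ?sqr_ge0.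
move=> n; set Se := \sum_(1 <= k < n.+1) eps k.
have Se0 : 0 <= Se by rewrite sumr_ge0 // => k _; rewrite ltW.
have key x : n1 (\sum_(1 <= k < n.+1)
     (Abar *m D x k + (V (x k.+1) - \sum_y p (x k) y *: V y))) <=
   n1 (Y x n.+1) + n1 (Y x 1%N) +
   \sum_(1 <= k < n.+1) n1 (((eps k.+1)^-1 - (eps k)^-1) *: D x k.+1) +
   n1 (\sum_(1 <= k < n.+1) nu (x k) (x k.+1) *m D x k) +
   \sum_(1 <= k < n.+1) n1 (U (x k.+1) *m (D x k.+1 - D x k)).
  under eq_bigr do rewrite step_decomposition.
  rewrite !sumrB big_split /= telescope_sumr //.
  rewrite (le_trans (n1D _ _)) // lerD //; last by rewrite n1N; exact: n1_sum.
  rewrite (le_trans (n1D _ _)) // lerD //; last by rewrite n1N.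
  rewrite (le_trans (n1D _ _)) // lerD //; last exact: n1_sum.
  by rewrite (le_trans (n1D _ _)) // n1N.
apply: (le_trans (EP_le p_st mu_ge0 n.+1 key)).
rewrite !EPD.
rewrite (EP_sum p mu (index_iota 1 n.+1) n.+1
  (fun k x => n1 (((eps k.+1)^-1 - (eps k)^-1) *: D x k.+1))).
rewrite (EP_sum p mu (index_iota 1 n.+1) n.+1
  (fun k x => n1 (U (x k.+1) *m (D x k.+1 - D x k)))).
have b1 := EP_Y (leqnn n.+1); have b2 := EP_Y (isT : (1 <= n.+1)%N).
have b3 : \sum_(1 <= k < n.+1) E n.+1 (fun x => n1 (((eps k.+1)^-1 - (eps k)^-1) *: D x k.+1))
   <= 2 * C * s n.+1.
  apply: (@le_trans _ _ (\sum_(1 <= k < n.+1) 2 * C * (s k.+1 - s k))).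
    by rewrite ler_sum_nat // => k /andP[_ kn]; exact: EP_stepsize_drift.
  rewrite -big_distrr /= telescope_sumr // ler_wpM2l ?mulr_ge0 // lerBlDr lerDl.
  exact/ltW/s_gt0.
have b4 := EP_noise n; rewrite -/Se in b4.
have b5 : \sum_(1 <= k < n.+1) E n.+1 (fun x => n1 (U (x k.+1) *m (D x k.+1 - D x k)))
   <= kap ^+ 2 * (1 + C) * Se.
  by rewrite /Se mulr_sumr ler_sum_nat // => k /andP[_ kn]; exact: EP_increment.
have b6 : C * s 1%N <= C * s n.+1 by rewrite ler_wpM2l.
have S1 := s_ge1 n.+1.
have b7 : 2 * (kap + kap * C) * 1 <= 2 * (kap + kap * C) * s n.+1.
  by rewrite ler_wpM2l // mulr_ge0 // addr_ge0 // mulr_ge0.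
set W := Num.sqrt Se in b4 *; have W0 : 0 <= W by rewrite sqrtr_ge0.
set k1 := 2 * (kap + kap * C) in b7 *.
set k4 := d%:R * (2 * kap * C) in b4 *; set k5 := kap ^+ 2 * (1 + C) in b5 *.
have p4 : 0 <= k4 by rewrite /k4 !mulr_ge0.
have p5 : 0 <= k5 by rewrite /k5 mulr_ge0 ?sqr_ge0 // addr_ge0.
have p1 : 0 <= k1 by rewrite /k1 mulr_ge0 // addr_ge0 // mulr_ge0.
have S0 := ltW (s_gt0 n.+1).
rewrite (le_trans (lerD (lerD (lerD (lerD b1 b2) b3) b4) b5)) //.
set kk := k1 + 2 * C + 2 * C + k4 + k5.
rewrite (@le_trans _ _ ((k1 + 2 * C + 2 * C) * s n.+1 + k4 * W + k5 * Se)) //.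
  rewrite !mulrDl !mulr1 in b7 *; rewrite /k1 in b7 *; lra.
clearbody k1 k4 k5 W.
have q1 : (k1 + 2 * C + 2 * C) * s n.+1 <= kk * s n.+1 by rewrite ler_wpM2r // /kk; lra.
have q2 : k4 * W <= kk * W.
  by rewrite ler_wpM2r // /kk addrAC lerDr !addr_ge0 // mulr_ge0.
have q3 : k5 * Se <= kk * Se.
  by rewrite ler_wpM2r // /kk lerDr !addr_ge0 // mulr_ge0.
by rewrite !mulrDr; apply: lerD => //; exact: lerD.
Qed.

End Decomposition.

                              

(** * Rates for the polynomial step sizes *)

Section PowerRates.
Variables (R : realType) (delta : R).
Hypothesis delta_range : 2^-1 < delta < 1.

Let delta_gt0 : 0 < delta. Proof. by case/andP: delta_range => h _; rewrite (lt_trans _ h). Qed.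
Let delta_lt1 : delta < 1. Proof. by case/andP: delta_range. Qed.

(** Young's inequality with exponents 1/a and 1/(1 - a), applied to y^a and 1. *)
Lemma powR_bernoulli (a y : R) : 0 < a < 1 -> 0 <= y -> y `^ a <= 1 + a * (y - 1).
Proof.
move=> /andP[a0 a1] y0; have b0 : 0 < 1 - a by rewrite subr_gt0.
have h := @conjugate_powR _ (y `^ a) 1 a^-1 (1 - a)^-1 (powR_ge0 _ _) ler01.
rewrite -powRrM mulfV ?gt_eqF // powRr1 // powR1 mulr1 !invrK mul1r in h.
by rewrite (le_trans (h _ _ _)) ?invr_gt0 //; [rewrite addrC subrK | lra].
Qed.

(** Sum against integral of x^(a-1), in discrete form: Bernoulli's bound gives n^a <= (n+1)^a (1 -
    a/(n+1)). *)
Lemma powR_sum (a : R) n : 0 < a < 1 ->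
  \sum_(1 <= k < n.+1) k.+1%:R `^ (a - 1) <= a^-1 * n%:R `^ a.
Proof.
move=> /[dup] a01 /andP[a0 a1]; elim: n => [|n IH].
  by rewrite big_geq // powR0 ?gt_eqF // mulr0.
have n1 : 0 < n.+1%:R :> R by rewrite ltr0n.
have n2 : 0 < n.+2%:R :> R by rewrite ltr0n.
have h1 : n.+2%:R `^ (a - 1) <= n.+1%:R `^ (a - 1).
  rewrite -opprB !powRN lef_pV2 ?posrE ?powR_gt0 // ge0_ler_powR ?nnegrE ?ltW ?subr_gt0 //.
  by rewrite ltr_nat.
have h2 : n%:R `^ a <= n.+1%:R `^ a * (1 - a / n.+1%:R).
  have -> : n%:R = n.+1%:R * (1 - n.+1%:R^-1) :> R.
    by rewrite mulrBr mulr1 mulfV ?gt_eqF // -natr1 addrK.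
  have y0 : 0 <= 1 - (n.+1%:R)^-1 :> R by rewrite subr_ge0 invf_le1 // ler1n.
  rewrite powRM ?ler0n // ler_wpM2l ?powR_ge0 // (le_trans (powR_bernoulli a01 y0)) //.
  by rewrite addrAC subrr add0r mulrN.
have h3 : n.+1%:R `^ (a - 1) = n.+1%:R `^ a / n.+1%:R.
  by rewrite powRB ?pnatr_eq0 ?implybT // powRr1 // ltW.
rewrite big_nat_recr //= (le_trans (lerD IH h1)) // h3.
have h4 : a^-1 * n%:R `^ a <= a^-1 * (n.+1%:R `^ a * (1 - a / n.+1%:R)).
  by rewrite ler_wpM2l // invr_ge0 ltW.
have h5 : a^-1 * (n.+1%:R `^ a * (1 - a / n.+1%:R)) = a^-1 * n.+1%:R `^ a - n.+1%:R `^ a / n.+1%:R.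
  by field; rewrite !gt_eqF.
by rewrite h5 in h4; rewrite -lerBrDr.
Qed.

Lemma powR_unbounded (a M : R) : 0 < a -> 0 <= M ->
  exists k0, forall k, (k0 <= k)%N -> M <= k.+1%:R `^ a.
Proof.
move=> a0 M0; exists (Num.truncn (M `^ a^-1)) => k hk.
have -> : M = (M `^ a^-1) `^ a by rewrite -powRrM mulVf ?gt_eqF // powRr1.
rewrite ge0_ler_powR ?nnegrE ?powR_ge0 ?ltW //.
by rewrite (lt_le_trans (truncnS_gt _)) // ler_nat.
Qed.

Let eps k : R := k.+1%:R `^ (- delta).

Let epsE k : eps k = (k.+1%:R `^ delta)^-1. Proof. exact: powRN. Qed.

Lemma stepsize_gt0 k : 0 < eps k. Proof. by rewrite powR_gt0 // ltr0n. Qed.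

Lemma stepsize_le1 k : eps k <= 1.
Proof.
rewrite epsE invf_le1 ?powR_gt0 ?ltr0n //.
rewrite -[X in X <= _](powRr0 k.+1%:R) ler_powR ?(ltW delta_gt0) // ler1n //.
Qed.

Lemma stepsize_noninc k : eps k.+1 <= eps k.
Proof.
rewrite !epsE lef_pV2 ?posrE ?powR_gt0 ?ltr0n // ge0_ler_powR ?nnegrE ?ltW //.
by rewrite ltr_nat.
Qed.

(** A ratio t <= 1 satisfies t <= t^delta, so the relative decrease of the step size is at most
    1/(k+2). *)
Lemma stepsize_diff k : eps k - eps k.+1 <= eps k / k.+1%:R.
Proof.
have k1 : 0 < k.+1%:R :> R by rewrite ltr0n.
have k2 : 0 < k.+2%:R :> R by rewrite ltr0n.
have h : k.+1%:R / k.+2%:R <= k.+1%:R `^ delta / k.+2%:R `^ delta :> R.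
  have -> : k.+1%:R `^ delta / k.+2%:R `^ delta = (k.+1%:R / k.+2%:R) `^ delta :> R.
    by rewrite powRM ?invr_ge0 ?ltW // -(powR_inv1 (ltW k2)) powRAC (powR_inv1 (powR_ge0 _ _)).
  apply: ger1_powR; last exact: ltW.
  by rewrite divr_gt0 //= ler_pdivrMr // mul1r ler_nat.
have e0 := stepsize_gt0 k.
have e1 : eps k.+1 = eps k * (k.+1%:R `^ delta / k.+2%:R `^ delta).
  by rewrite !epsE; field; rewrite !gt_eqF ?powR_gt0.
rewrite e1 -[X in X - _]mulr1 -mulrBr ler_wpM2l ?(ltW e0) //.
rewrite (le_trans (lerB (lexx 1) h)) // -{1}(@mulfV _ (k.+2%:R : R)) ?gt_eqF // -mulrBl.
rewrite -[X in X - _]natr1 addrAC subrr add0r mul1r lef_pV2 ?posrE // ler_nat //.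
Qed.

Lemma stepsize_small eta : 0 < eta ->
  exists k0, forall k, (k0 <= k)%N -> eps k <= eta /\ k.+1%:R^-1 <= eta * eps k.
Proof.
move=> eta0; have i0 : 0 <= eta^-1 by rewrite invr_ge0 ltW.
have [k1 h1] := powR_unbounded delta_gt0 i0.
have d1 : 0 < 1 - delta by rewrite subr_gt0.
have [k2 h2] := powR_unbounded d1 i0.
exists (maxn k1 k2) => k; rewrite geq_max => /andP[/h1 g1 /h2 g2].
have kp : 0 < k.+1%:R :> R by rewrite ltr0n.
split; first by rewrite epsE -[leRHS]invrK lef_pV2 ?posrE ?powR_gt0 ?invr_gt0.
have -> : eps k = k.+1%:R `^ (1 - delta) / k.+1%:R.
  by rewrite powRB ?pnatr_eq0 ?implybT // powRr1 ?ltW // epsE; field; rewrite !gt_eqF ?powR_gt0.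
by rewrite mulrA -[leLHS]mul1r ler_wpM2r ?invr_ge0 ?(ltW kp) // mulrC -ler_pdivrMr // mul1r.
Qed.

Definition rate (n : nat) : R :=
  Num.max (Num.sqrt (ln n%:R) / n%:R `^ (delta - 2^-1)) (1 / n%:R `^ ((1 - delta) / 2)).

Section LargeTime.
Variable n : nat.
Hypothesis n_large : expR 1 <= n%:R :> R.

Let n_ge1 : 1 <= n%:R :> R.
Proof. by rewrite (le_trans _ n_large) // ltW // expR_gt1. Qed.

Let n_gt0 : 0 < n%:R :> R. Proof. exact: lt_le_trans n_ge1. Qed.

(** For n >= e the factor sqrt(ln n) is at least 1, so the bare power lies below the rate. *)
Lemma rate_ge1 : n%:R `^ (2^-1 - delta) <= rate n.
Proof.
rewrite /rate le_max; apply/orP; left; rewrite -opprB powRN -[leLHS]mul1r.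
rewrite ler_wpM2r ?invr_ge0 ?powR_ge0 // -[X in X <= _]sqrtr1 ler_wsqrtr //.
by rewrite -[leLHS]expRK ler_ln ?posrE ?expR_gt0.
Qed.

Lemma rate_ge2 : n%:R `^ ((delta - 1) / 2) <= rate n.
Proof.
rewrite /rate le_max; apply/orP; right; rewrite mul1r -powRN ler_powR //; lra.
Qed.

Lemma rate_ge_sixth : n%:R `^ (- (1 / 6)) <= rate n.
Proof.
have /andP[h1 h2] := delta_range.
case: (leP (2 / 3) delta) => hd.
  by rewrite (le_trans _ rate_ge2) // ler_powR //; lra.
by rewrite (le_trans _ rate_ge1) // ler_powR //; lra.
Qed.

Lemma rate_ge0 : 0 <= rate n.
Proof. by rewrite (le_trans _ rate_ge_sixth) // powR_ge0. Qed.

(** After division by sqrt n the three terms have exponents (delta - 1)/2, -delta/2 and 1/2 - delta;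
    the middle one is below the first because delta > 1/2. *)
Lemma decomposition_rate :
  ((Num.sqrt (eps n.+1))^-1 + Num.sqrt (\sum_(1 <= k < n.+1) eps k)
     + \sum_(1 <= k < n.+1) eps k) / Num.sqrt n%:R
  <= (4 + 2 * (1 - delta)^-1) * rate n.
Proof.
have /andP[dh d1] := delta_range.
have a0 : 0 < 1 - delta by rewrite subr_gt0.
have a01 : 0 < 1 - delta < 1 by rewrite a0 /= ltrBlDr ltrDl.
set ia := (1 - delta)^-1; have ia1 : 1 <= ia by rewrite /ia invf_ge1 //; lra.
have sn : Num.sqrt n%:R = n%:R `^ (2^-1) :> R by rewrite powR12_sqrt // ltW.
have Sn : \sum_(1 <= k < n.+1) eps k <= ia * n%:R `^ (1 - delta).
  rewrite (le_trans _ (powR_sum n a01)) //; apply: ler_sum => k _.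
  by rewrite /eps addrAC subrr add0r.
have s0 : 0 < Num.sqrt n%:R :> R by rewrite sqrtr_gt0.
have b1 : (Num.sqrt (eps n.+1))^-1 / Num.sqrt n%:R <= 3 * rate n.
  have -> : (Num.sqrt (eps n.+1))^-1 = n.+2%:R `^ (delta / 2).
    rewrite -powR12_sqrt ?(ltW (stepsize_gt0 _)) // -powRN -powRrM.
    by congr (_ `^ _); field.
  (* Here n + 2 <= 3n, and the exponent is below 1. *)
  have h : n.+2%:R `^ (delta / 2) <= 3 * n%:R `^ (delta / 2) :> R.
    apply: (@le_trans _ _ ((3 * n%:R) `^ (delta / 2))).
      apply: ge0_ler_powR; rewrite ?nnegrE ?mulr_ge0 //; first exact: ltW.
      rewrite -addn2 natrD; have := n_ge1; lra.
    rewrite powRM ?ler0n // ler_wpM2r ?powR_ge0 // ler1_powR //; lra.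
  rewrite ler_pdivrMr // (le_trans h) // -mulrA ler_wpM2l // sn.
  rewrite (_ : delta / 2 = (delta - 1) / 2 + 2^-1); last by field.
  by rewrite powRD ?(gt_eqF n_gt0) ?implybT // ler_wpM2r ?powR_ge0 // rate_ge2.
have b3 : (\sum_(1 <= k < n.+1) eps k) / Num.sqrt n%:R <= ia * rate n.
  rewrite ler_pdivrMr // (le_trans Sn) // -mulrA ler_wpM2l ?(le_trans _ ia1) // sn.
  rewrite (_ : 1 - delta = 2^-1 - delta + 2^-1); last by field.
  by rewrite powRD ?(gt_eqF n_gt0) ?implybT // ler_wpM2r ?powR_ge0 // rate_ge1.
have b2 : Num.sqrt (\sum_(1 <= k < n.+1) eps k) / Num.sqrt n%:R <= ia * rate n.
  rewrite ler_pdivrMr //.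
  apply: (@le_trans _ _ (Num.sqrt (ia ^+ 2 * n%:R `^ (1 - delta)))).
    by rewrite ler_wsqrtr // (le_trans Sn) // ler_wpM2r ?powR_ge0 // ler_eXnr.
  rewrite sqrtrM ?sqr_ge0 // sqrtr_sqr ger0_norm ?(le_trans _ ia1) //.
  rewrite -mulrA ler_wpM2l ?(le_trans _ ia1) // -powR12_sqrt ?powR_ge0 // -powRrM sn.
  apply: (@le_trans _ _ (n%:R `^ ((delta - 1) / 2) * n%:R `^ 2^-1)).
    by rewrite -powRD ?(gt_eqF n_gt0) ?implybT // ler_powR //; lra.
  by rewrite ler_wpM2r ?powR_ge0 // rate_ge2.
have := rate_ge0; rewrite !mulrDl; lra.
Qed.

End LargeTime.

End PowerRates.

                                              

(** * The martingale central limit theorem *)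

Lemma term_le_sum (R : realType) (I : finType) (F : I -> R) i :
  (forall j, 0 <= F j) -> F i <= \sum_j F j.
Proof. by move=> F0; rewrite (bigD1 i) //= lerDl sumr_ge0. Qed.

Lemma sqr_sum_n1 (R : realType) (d : nat) (u : 'cV[R]_d) : \sum_i u i 0 ^+ 2 <= n1 u ^+ 2.
Proof.
have s0 : 0 <= \sum_i u i 0 ^+ 2 by apply: sumr_ge0 => i _; exact: sqr_ge0.
have := enorm_le_n1 u; rewrite -ler_sqr ?nnegrE ?sqrtr_ge0 ?n1_ge0 //.
by rewrite /enorm sqr_sqrtr.
Qed.

Section MartingaleCLT.
Variables (R : realType) (S : finType) (d : nat) (p : S -> S -> R) (pi mu : S -> R).
Hypothesis p_st : stochastic p.
Hypothesis p_irr : irreducible_chain p.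
Hypothesis pi_inv : invariant_distribution p pi.
Hypothesis mu_ge0 : forall x, 0 <= mu x.
Hypothesis mu_sum1 : \sum_x mu x = 1.
Variables (m : S -> S -> 'cV[R]_d) (g : 'I_d -> 'cV[R]_d).
Hypothesis m_mart : forall x i, \sum_y p x y * m x y i 0 = 0.
Hypothesis m_cov : forall i l,
  \sum_x pi x * (\sum_y p x y * (m x y i 0 * m x y l 0)) = \sum_j g j i 0 * g j l 0.
Variables (dZ : measure_display) (OmegaZ : measurableType dZ)
  (Q : probability OmegaZ R) (Z : OmegaZ -> 'cV[R]_d).
Hypothesis Z_gauss : std_gaussian Q Z.

Let gs := map g (index_enum 'I_d).
Let s0 : R := \sum_j n1 (g j).

Let s0_ge0 : 0 <= s0. Proof. by apply: sumr_ge0 => j _; exact: n1_ge0. Qed.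

Lemma gauss_sqr_le w : \sum_i (\sum_j Z w j 0 *: g j) i 0 ^+ 2 <=
  s0 ^+ 2 * d%:R * \sum_i Z w i 0 ^+ 2.
Proof.
rewrite (le_trans (sqr_sum_n1 _)) //.
have h : n1 (\sum_j Z w j 0 *: g j) <= s0 * n1 (Z w).
  rewrite (le_trans (n1_sum _ _ _)) // /s0 mulrC big_distrr; apply: ler_sum => j _ /=.
  by rewrite n1Z ler_wpM2r ?n1_ge0 // n1_coord.
apply: (@le_trans _ _ ((s0 * n1 (Z w)) ^+ 2)).
  by rewrite lerXn2r ?nnegrE ?mulr_ge0 ?n1_ge0.
by rewrite exprMn -mulrA ler_wpM2l ?sqr_ge0 // n1_sqr.
Qed.

(** The Rademacher walk along the [g j] is the common middle term: Lindeberg's exchange leads to it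
    from the chain, the coordinatewise comparison from the Gaussian. Both use the same smoothed
    function, and [sg ^+ 3 = a] turns their third-order errors into multiples of [sg]. *)
Lemma martingale_clt : exists2 K, 0 <= K & forall n a sg (h : 'cV[R]_d -> R),
  (forall x y, `|h x - h y| <= n1 (x - y)) ->
  0 <= a -> a * Num.sqrt n%:R = 1 -> 0 < sg -> sg <= 1 -> sg ^+ 3 = a ->
  `|EP p mu n.+1 (fun x => h (mart_sum m a n x)) -
    (\int[Q]_w h (\sum_j Z w j 0 *: g j))%R| <= K * sg.
Proof.
(* By [m_cov] the stationary mean of the conditional covariance is the covariance of the walk, so
   the centered Poisson equation is the one that Lindeberg's exchange requires. *)
have /choice[U1 HU1] : forall il : 'I_d * 'I_d, exists U : S -> R, forall x,
    U x - \sum_y p x y * U y = \sum_y p x y * (m x y il.1 0 * m x y il.2 0) -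
      \sum_(u <- gs) u il.1 0 * u il.2 0.
  move=> [i l]; have [U HU] := poisson_exists_mean p_st p_irr pi_inv
    (fun x => \sum_y p x y * (m x y i 0 * m x y l 0)).
  by exists U => x; rewrite HU /= /mean m_cov /gs big_map.
pose U i l := U1 (i, l).
pose cm := \sum_x \sum_y n1 (m x y); pose cu := \sum_i \sum_l \sum_x `|U i l x|.
have cm0 : 0 <= cm by do 2 (apply: sumr_ge0 => ? _); exact: n1_ge0.
have cu0 : 0 <= cu by do 3 (apply: sumr_ge0 => ? _).
have mle x y : n1 (m x y) <= cm.
  have mx0 z : 0 <= \sum_y n1 (m z y) by apply: sumr_ge0 => ? _; exact: n1_ge0.
  rewrite (le_trans _ (term_le_sum x mx0)) //.
  by apply: (term_le_sum (F := fun y => n1 (m x y))) => ?; exact: n1_ge0.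
have Ule i l x : `|U i l x| <= cu.
  rewrite (le_trans _ (term_le_sum (F := fun i => \sum_l \sum_x `|U i l x|) i _)) //; last first.
    by move=> ?; do 2 (apply: sumr_ge0 => ? _).
  rewrite (le_trans _ (term_le_sum (F := fun l => \sum_x `|U i l x|) l _)) //; last first.
    by move=> ?; apply: sumr_ge0.
  exact: (term_le_sum (F := fun x => `|U i l x|)).
have [C C0 Hsm] := smoothing R d.
pose Lc := cm ^+ 3 + (\sum_(u <- gs) n1 u) ^+ 3 + d%:R ^+ 2 * cu * (\sum_(u <- gs) n1 u + cm)
   + d%:R ^+ 2 * cu.
have gs0 : 0 <= \sum_(u <- gs) n1 u by apply: sumr_ge0 => u _; exact: n1_ge0.
have Lc0 : 0 <= Lc by rewrite /Lc !addr_ge0 ?mulr_ge0 ?addr_ge0 ?exprn_ge0.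
have k0 : 0 <= gauss_abs3 R := gauss_abs3_ge0 R.
pose G := d%:R * (1 + gauss_abs3 R) * (1 + s0) ^+ 3 * C.
have G0 : 0 <= G by rewrite /G !mulr_ge0 ?addr_ge0 ?exprn_ge0.
exists ((C + 1) + 2 * C * Lc + G + (C + 1)).
  have c1 : 0 <= C + 1 by rewrite addr_ge0.
  exact: addr_ge0 (addr_ge0 (addr_ge0 c1 (mulr_ge0 (mulr_ge0 (ler0n _ 2) C0) Lc0)) G0) c1.
move=> n a sg h hlip a0 an sg0 sg1 sga.
have an2 : n%:R * a ^+ 2 = 1.
  by have := congr1 (fun t => t ^+ 2) an; rewrite expr1n exprMn sqr_sqrtr ?ler0n // mulrC.
(* [K1] bounds the squared martingale sum on every path, [K2] the second moment of the Gaussian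
   limit. [B] may depend on [n], since no constant involves it; it is taken large enough for both
   truncation errors to be at most [sg]. *)
pose K1 := (n%:R * (a * cm)) ^+ 2; pose K2 := s0 ^+ 2 * d%:R * d%:R.
have K10 : 0 <= K1 by exact: sqr_ge0.
have K20 : 0 <= K2 by rewrite /K2 !mulr_ge0 ?sqr_ge0.
pose B := (Num.truncn ((K1 + K2) / sg ^+ 2)).+1.
have hB : K1 + K2 <= sg * (sg * B%:R).
  rewrite mulrA -expr2 mulrC -ler_pdivrMr ?exprn_gt0 //; exact/ltW/truncnS_gt.
have sB : 0 < sg * B%:R by rewrite mulr_gt0 // ltr0n.
have [f [D1 [D2 [jf flip fh]]]] := Hsm h sg B hlip sg0 sg1 (ltn0Sn _).
have M0 : 0 <= C / sg ^+ 2 by rewrite divr_ge0 ?exprn_ge0 ?(ltW sg0).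
have asg : C / sg ^+ 2 * a = C * sg by rewrite -sga; field; rewrite gt_eqF.
have e1 : `|EP p mu n.+1 (fun x => h (mart_sum m a n x)) -
    EP p mu n.+1 (fun x => f (mart_sum m a n x))| <= (C + 1) * sg.
  apply: EP_close => // x; rewrite distrC (le_trans (fh _)) // mulrDl mul1r lerD2l.
  rewrite ler_pdivrMr //; apply: le_trans hB.
  apply: (@le_trans _ _ K1); last by rewrite lerDl.
  rewrite (le_trans (sqr_sum_n1 _)) //.
  rewrite lerXn2r ?nnegrE ?n1_ge0 ?mulr_ge0 // /mart_sum (le_trans (n1_sum _ _ _)) //.
  apply: (@le_trans _ _ (\sum_(1 <= j < n.+1) a * cm)).
    by apply: ler_sum => j _; rewrite n1Z ger0_norm // ler_wpM2l.
  by rewrite sumr_const_nat subn1 /= -[leLHS]mulr_natl.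
have e2 := lindeberg p_st mu_ge0 mu_sum1 m_mart (fun i l x => HU1 (i, l) x) cm0 cu0 mle Ule
  n M0 a0 jf.
rewrite -/Lc in e2.
have e2' : C / sg ^+ 2 * (n%:R * a ^+ 3 + a ^+ 2) * Lc <= 2 * C * Lc * sg.
  have -> : C / sg ^+ 2 * (n%:R * a ^+ 3 + a ^+ 2) * Lc =
    (C / sg ^+ 2 * a) * ((n%:R * a ^+ 2) + a) * Lc by ring.
  have a1 : a <= 1 by rewrite -sga exprn_ile1 // ltW.
  rewrite an2 asg; have : C * sg * Lc * (1 + a) <= C * sg * Lc * 2.
    by rewrite ler_wpM2l ?mulr_ge0 ?(ltW sg0) //; lra.
  lra.
have s1 : 0 <= 1 + s0 by rewrite addr_ge0.
(* With 1 + s0 in place of s0, the constant [C * (1 + s0)] also dominates the Lipschitz constant [C]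
   of [f], and a single constant serves for both. *)
have sm : smooth_along (C * (1 + s0)) (C / sg ^+ 2 * (1 + s0) ^+ 3) gs f.
  apply: (jet3_smooth_along M0 C0 jf flip) => u /mapP[j _ ->].
  rewrite (@le_trans _ _ s0) ?lerDr //; apply: (term_le_sum (F := fun j => n1 (g j))) => k.
  exact: n1_ge0.
have flip' x u : `|f (x + u) - f x| <= C * (1 + s0) * n1 u.
  by rewrite (le_trans (flip x u)) // ler_wpM2r ?n1_ge0 // ler_peMr // lerDl.
have M1 : 0 <= C / sg ^+ 2 * (1 + s0) ^+ 3 by rewrite mulr_ge0 ?exprn_ge0.
have e3 := gauss_walk Z_gauss (mulr_ge0 C0 s1) flip' a0 an M1 sm.
rewrite -/gs in e3.
have e3' : d%:R * (n%:R * (a ^+ 3 * (1 + gauss_abs3 R) * (C / sg ^+ 2 * (1 + s0) ^+ 3))) = G * sg.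
  have -> : d%:R * (n%:R * (a ^+ 3 * (1 + gauss_abs3 R) * (C / sg ^+ 2 * (1 + s0) ^+ 3))) =
    d%:R * (1 + gauss_abs3 R) * (1 + s0) ^+ 3 * ((n%:R * a ^+ 2) * (C / sg ^+ 2 * a)) by ring.
  by rewrite an2 asg mul1r /G mulrA.
rewrite e3' in e3.
have hlip' x u : `|h (x + u) - h x| <= 1 * n1 u.
  by rewrite mul1r (le_trans (hlip _ _)) // addrAC subrr add0r.
have df := gauss_lip_dominated g Z_gauss C0 flip.
have dh := gauss_lip_dominated g Z_gauss ler01 hlip'.
have e4 : `|(\int[Q]_w f (\sum_j Z w j 0 *: g j))%R - (\int[Q]_w h (\sum_j Z w j 0 *: g j))%R|
    <= (C + 1) * sg.
  rewrite -RintegralB //; [|exact: integrable_dominated Z_gauss _ df|exact: integrable_dominated Z_gauss _ dh].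
  have := @Rintegral_dominated _ _ _ _ Q Z Z_gauss
    (fun w => f (\sum_j Z w j 0 *: g j) - h (\sum_j Z w j 0 *: g j))
    (C * sg) (s0 ^+ 2 * d%:R / (sg * B%:R)) (measurable_funB df.1 dh.1) => hR.
  rewrite (le_trans (hR _)) => [//|w|].
    rewrite (le_trans (fh _)) // lerD2l mulrAC ler_wpM2r ?invr_ge0 ?(ltW sB) //.
    exact: gauss_sqr_le.
  rewrite mulrDl mul1r lerD2l mulrAC ler_pdivrMr // (le_trans _ hB) // -/K2 lerDr //.
move: (le_trans e2 e2') e1 e3 e4.
move: (EP _ _ _ _) (EP _ _ _ _) (iter _ _ _ _) (Rintegral _ _ _) (Rintegral _ _ _) => x1 x2 x3 x4 x5.
by rewrite !ler_norml => /andP[? ?] /andP[? ?] /andP[? ?] /andP[? ?]; apply/andP; split; lra.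
Qed.

End MartingaleCLT.

                               

(** * Application to the TD average *)

Lemma unitmx_cV (F : fieldType) (d : nat) (M : 'M[F]_d) :
  (forall u : 'cV[F]_d, M *m u = 0 -> u = 0) -> M \in unitmx.
Proof.
move=> H; rewrite -unitmx_tr -row_free_unit -kermx_eq0; apply/eqP/row_matrixP => i.
rewrite row0; apply: trmx_inj; rewrite trmx0; apply: H.
by rewrite -{1}[M]trmxK -trmx_mul -row_mul mulmx_ker row0 trmx0.
Qed.

Lemma mulmx_cols (R : comNzRingType) (d : nat) (G : 'M[R]_d) (v : 'cV[R]_d) :
  G *m v = \sum_j v j 0 *: col j G.
Proof.
apply/matrixP => i k; rewrite ord1 mxE summxE; apply: eq_bigr => j _.
by rewrite !mxE mulrC.
Qed.

Lemma expectation_dominated (R : realType) (d : nat) (dZ : measure_display)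
  (OmegaZ : measurableType dZ) (Q : probability OmegaZ R) (Z : OmegaZ -> 'cV[R]_d)
  (F : OmegaZ -> R) :
  std_gaussian Q Z -> dominated Z F -> ('E_Q[F] = (\int[Q]_w F w)%R%:E)%E.
Proof.
move=> ZG dF; rewrite unlock /Rintegral; symmetry; apply: fineK.
exact: integrable_fin_num (integrable_dominated ZG dF).
Qed.

Section TDCLT.
Variables (R : realType) (S : finType) (d : nat)
    (p : S -> S -> R) (pi mu : S -> R)
    (A : S -> 'M[R]_d) (b : S -> 'cV[R]_d)
    (theta0 thetas : 'cV[R]_d) (delta : R) (V : S -> 'cV[R]_d)
    (dZ : measure_display) (OmegaZ : measurableType dZ)
    (Q : probability OmegaZ R) (Z : OmegaZ -> 'cV[R]_d).
Hypothesis p_stochastic : stochastic p.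
Hypothesis p_irreducible : irreducible_chain p.
Hypothesis pi_invariant : invariant_distribution p pi.
Hypothesis mu_ge0 : forall x, 0 <= mu x.
Hypothesis mu_sum1 : \sum_x mu x = 1.
Hypothesis A_hurwitz : hurwitz (- mean pi A).
Hypothesis delta_range : 2^-1 < delta < 1.
Hypothesis thetas_def : mean pi A *m thetas + mean pi b = 0.
Hypothesis V_poisson : poisson_solution p (td_noise pi A b thetas) V.
Hypothesis Sigma_posdef : posdef (Sigma_infty pi p V).
Hypothesis Z_gaussian : std_gaussian Q Z.

Let eps k : R := k.+1%:R `^ (- delta).
Let Abar := mean pi A.
Let W := invmx Abar.
Let r := td_noise pi A b thetas.
Let Gamma := W *m Sigma_infty pi p V *m W^T.
Let G := sqrtmx Gamma.
Let D x k : 'cV[R]_d := td_iterate A b eps theta0 x k - thetas.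
(** The sign comes from solving the decomposition for D_k; it cancels in the covariance. *)
Let m x y : 'cV[R]_d := - (W *m mart_diff p V x y).

(** On a null vector the Lyapunov inequality bounds the squared norm by zero. *)
Lemma Abar_unit : Abar \in unitmx.
Proof.
have [P [c c0 [_ H]]] := lyapunov A_hurwitz; apply: unitmx_cV => u Au.
have [_] := H u; rewrite Au mulmx0 mxE pmulr_rle0 // => h.
have /eqP : \sum_i u i 0 ^+ 2 = 0.
  by apply/eqP; rewrite eq_le h /= sumr_ge0 // => i _; exact: sqr_ge0.
rewrite psumr_eq0 => [|i _]; last exact: sqr_ge0.
move=> /allP hi; apply/matrixP => i j; rewrite ord1 mxE.
by apply/eqP; have := hi i (mem_index_enum i); rewrite sqrf_eq0.
Qed.

Lemma sqrtmx_Gamma : possemidef G /\ G *m G = Gamma.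
Proof.
have pG : possemidef Gamma.
  case: Sigma_posdef => ST Spos; split.
    by rewrite /Gamma !trmx_mul trmxK ST mulmxA.
  move=> u; have -> : u^T *m Gamma *m u = (W^T *m u)^T *m Sigma_infty pi p V *m (W^T *m u).
    by rewrite /Gamma trmx_mul trmxK !mulmxA.
  have [->|u0] := eqVneq (W^T *m u) 0; first by rewrite mulmx0 mxE.
  exact/ltW/Spos.
have [G0 HG0] := possemidef_sqrt pG.
have ex : exists G1, [set G1 | possemidef G1 /\ G1 *m G1 = Gamma] G1 by exists G0.
exact: (xgetPex 0 ex).
Qed.

Lemma noise_mart x : \sum_y p x y *: m x y = 0.
Proof.
have -> : \sum_y p x y *: m x y = - (W *m (\sum_y p x y *: mart_diff p V x y)).
  rewrite mulmx_sumr -sumrN; apply: eq_bigr => y _.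
  by rewrite /m scalerN -scalemxAr.
rewrite (_ : \sum_y _ = 0) ?mulmx0 ?oppr0 // /mart_diff.
under eq_bigr do rewrite scalerBr.
by rewrite sumrB -scaler_suml (p_stochastic.2 _) scale1r subrr.
Qed.

(** The columns of [G] serve as walk directions: [G] is symmetric, so the sum of g_j g_j^T over its
    columns is G G^T = G G. *)
Lemma noise_cov i l : \sum_x pi x * (\sum_y p x y * (m x y i 0 * m x y l 0)) =
  \sum_j (col j G) i 0 * (col j G) l 0.
Proof.
have [[GT _] GG] := sqrtmx_Gamma.
have -> : \sum_j (col j G) i 0 * (col j G) l 0 = Gamma i l.
  rewrite -GG mxE; apply: eq_bigr => j _; rewrite !mxE; congr (_ * _).
  by rewrite -[in LHS]GT mxE.
have -> : Gamma = \sum_x pi x *: \sum_y p x y *: (m x y *m (m x y)^T).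
  rewrite /Gamma /Sigma_infty /mean2 /mean /Pop mulmx_sumr mulmx_suml.
  apply: eq_bigr => x _; rewrite -scalemxAr -scalemxAl; congr (_ *: _).
  rewrite mulmx_sumr mulmx_suml; apply: eq_bigr => y _.
  rewrite -scalemxAr -scalemxAl; congr (_ *: _).
  by rewrite /m linearN /= mulNmx mulmxN opprK trmx_mul !mulmxA.
rewrite summxE; apply: eq_bigr => x _; rewrite [RHS]mxE summxE; congr (_ * _).
apply: eq_bigr => y _; rewrite [RHS]mxE; congr (_ * _).
by rewrite [RHS]mxE big_ord1; congr (_ * _); rewrite [RHS]mxE.
Qed.

Lemma D_rec x k : D x k.+1 = D x k - eps k *: (A (x k) *m D x k + r (x k)).
Proof.
rewrite /D /= addrAC; congr (_ - _ *: _).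
rewrite /r /td_noise mulmxBl mulmxBr.
have -> : mean pi b = - (mean pi A *m thetas).
  by apply/eqP; rewrite -addr_eq0 addrC thetas_def.
by rewrite opprK [X in _ = _ + X]addrACA addNr addr0 addrA subrK.
Qed.

Lemma poisson_matrix : exists U : S -> 'M[R]_d,
  forall x, U x - \sum_y p x y *: U y = A x - Abar.
Proof.
have /choice[U HU] : forall ij : 'I_d * 'I_d, exists U : S -> R, forall x,
    U x - \sum_y p x y * U y = A x ij.1 ij.2 - Abar ij.1 ij.2.
  move=> [i j]; have [U HU] := poisson_exists_mean p_stochastic p_irreducible pi_invariant
    (fun x => A x i j).
  exists U => x; rewrite HU /=; congr (_ - _); rewrite /Abar /mean summxE.
  by apply: eq_bigr => z _; rewrite mxE.
exists (fun x => \matrix_(i, j) U (i, j) x) => x; apply/matrixP => i j.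
rewrite !mxE summxE -(HU (i, j) x); congr (_ - _); apply: eq_bigr => y _.
by rewrite !mxE.
Qed.

Let Zn n x := \sum_(1 <= k < n.+1) (Abar *m D x k + (V (x k.+1) - \sum_y p (x k) y *: V y)).

Lemma td_error : exists2 C, 0 <= C & forall n, expR 1 <= n%:R :> R ->
  EP p mu n.+1 (fun x => n1 (Zn n x)) / Num.sqrt n%:R <= C * rate delta n.
Proof.
have [U HU] := poisson_matrix.
have [P [c0 c00 [PT HP]]] := lyapunov A_hurwitz.
(* The Lyapunov bounds use the Euclidean norm, and passing to [n1] loses a factor d; [d.+1] avoids a
   division by zero when d = 0. *)
pose c := Num.min 1 (c0 / d.+1%:R).
have c1 : c <= 1 by rewrite ge_min lexx.
have cgt0 : 0 < c by rewrite lt_min ltr01 divr_gt0.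
have cn1 (u : 'cV[R]_d) : c * n1 u ^+ 2 <= c0 * \sum_i u i 0 ^+ 2.
  apply: (@le_trans _ _ (c0 / d.+1%:R * n1 u ^+ 2)).
    by rewrite ler_wpM2r ?sqr_ge0 // ge_min lexx orbT.
  rewrite -mulrA ler_wpM2l ?(ltW c00) // mulrC ler_pdivrMr // mulrC.
  rewrite (le_trans (n1_sqr _)) //; apply: ler_wpM2r; last by rewrite ler_nat leqnSn.
  by apply: sumr_ge0 => i _; exact: sqr_ge0.
pose kap := 1 + \sum_x nm (A x) + \sum_x nm (U x) + \sum_x n1 (r x) + \sum_x n1 (V x) + nm P.
have sA : 0 <= \sum_x nm (A x) by apply: sumr_ge0 => x _; exact: nm_ge0.
have sU : 0 <= \sum_x nm (U x) by apply: sumr_ge0 => x _; exact: nm_ge0.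
have sr : 0 <= \sum_x n1 (r x) by apply: sumr_ge0 => x _; exact: n1_ge0.
have sV : 0 <= \sum_x n1 (V x) by apply: sumr_ge0 => x _; exact: n1_ge0.
have sP : 0 <= nm P := nm_ge0 P.
have kap1 : 1 <= kap by rewrite /kap; lra.
have A_le x : nm (A x) <= kap.
  by have := term_le_sum (F := fun x => nm (A x)) x (fun x => nm_ge0 _); rewrite /kap; lra.
have U_le x : nm (U x) <= kap.
  by have := term_le_sum (F := fun x => nm (U x)) x (fun x => nm_ge0 _); rewrite /kap; lra.
have r_le x : n1 (r x) <= kap.
  by have := term_le_sum (F := fun x => n1 (r x)) x (fun x => n1_ge0 _); rewrite /kap; lra.
have V_le x : n1 (V x) <= kap.
  by have := term_le_sum (F := fun x => n1 (V x)) x (fun x => n1_ge0 _); rewrite /kap; lra.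
have P_le : nm P <= kap by rewrite /kap; lra.
have kap0 : 0 <= kap by rewrite (le_trans ler01).
have egt0 k : 0 < eps k := stepsize_gt0 delta k.
have ele1 k : eps k <= 1 := stepsize_le1 delta_range k.
have enoninc k : eps k.+1 <= eps k := stepsize_noninc delta_range k.
have ediff k : eps k - eps k.+1 <= eps k / k.+1%:R := stepsize_diff delta_range k.
have esmall eta : 0 < eta -> exists k0, forall k, (k0 <= k)%N ->
   eps k <= eta /\ k.+1%:R^-1 <= eta * eps k := @stepsize_small _ _ delta_range eta.
have D0 x : D x 0%N = theta0 - thetas by [].
have Ppos u : c * n1 u ^+ 2 <= bform P u u := le_trans (cn1 u) (HP u).1.
have Pdrift u : c * n1 u ^+ 2 <= bform P u (Abar *m u) := le_trans (cn1 u) (HP u).2.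
have [C1 C10 HC1] := td_second_moment p_stochastic mu_ge0 mu_sum1 D0 D_rec HU V_poisson
  egt0 ele1 ediff enoninc esmall kap1 A_le U_le r_le V_le P_le PT cgt0 c1 Ppos Pdrift.
have Dad k x y : (forall j, (j < k)%N -> x j = y j) -> D x k = D y k :=
  @td_adapted _ _ _ _ _ _ _ _ D0 D_rec k x y.
have HC1' k : EP p mu k (fun x => n1 (D x k) ^+ 2) <= Num.sqrt C1 ^+ 2 * eps k.
  by rewrite sqr_sqrtr.
have [C2 C20 HC2] := decomposition_error p_stochastic mu_ge0 mu_sum1 Dad D_rec HU V_poisson
  egt0 ele1 enoninc kap0 A_le U_le r_le V_le (sqrtr_ge0 C1) HC1'.
exists (C2 * (4 + 2 * (1 - delta)^-1)).
  rewrite mulr_ge0 // addr_ge0 // mulr_ge0 // invr_ge0.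
  by case/andP: delta_range => _ /ltW; rewrite subr_ge0.
move=> n hn; rewrite (le_trans (ler_wpM2r _ (HC2 n))) ?invr_ge0 ?sqrtr_ge0 //.
by rewrite -!mulrA ler_wpM2l // decomposition_rate.
Qed.

(** [W] inverts [Abar] inside each summand of [Zn], and the sign in [m] makes the Poisson increments
    cancel. *)
Lemma td_average_decomposition n x : (0 < n)%N ->
  Num.sqrt n%:R *: (td_average A b eps theta0 x n - thetas) =
  (Num.sqrt n%:R)^-1 *: (W *m Zn n x) + mart_sum m (Num.sqrt n%:R)^-1 n x.
Proof.
move=> n0; have n0' : 0 < n%:R :> R by rewrite ltr0n.
have s0 : Num.sqrt n%:R != 0 :> R by rewrite gt_eqF // sqrtr_gt0.
have -> : td_average A b eps theta0 x n - thetas = n%:R^-1 *: \sum_(1 <= k < n.+1) D x k.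
  rewrite /D sumrB /td_average scalerBr; congr (_ - _).
  by rewrite sumr_const_nat subn1 /= -(scaler_nat n thetas) scalerA mulVf ?scale1r // gt_eqF.
rewrite scalerA (_ : Num.sqrt n%:R / n%:R = (Num.sqrt n%:R)^-1); last first.
  by rewrite -{2}[n%:R](sqr_sqrtr (ltW n0')) expr2 invfM mulrA divff // mul1r.
rewrite /mart_sum -scaler_sumr -scalerDr; congr (_ *: _).
rewrite /Zn mulmx_sumr -big_split; apply: eq_bigr => k _ /=.
by rewrite mulmxDr mulKmx ?Abar_unit // /m /mart_diff /Pop addrK.
Qed.

Lemma td_adapted_average n (h : 'cV[R]_d -> R) : adapted n.+1 (fun x : nat -> S =>
  h (Num.sqrt n%:R *: (td_average A b eps theta0 x n - thetas))).
Proof.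
have ad k x y : (forall j, (j < k)%N -> x j = y j) ->
    td_iterate A b eps theta0 x k = td_iterate A b eps theta0 y k.
  elim: k => // k IH xy /=; rewrite xy // IH // => j jk.
  by rewrite xy // ltnS ltnW.
move=> x y xy; rewrite /td_average; congr (h (_ *: (_ *: _ - _))).
apply: eq_big_nat => k /andP[_ kn]; apply: ad => j jk; apply: xy.
by rewrite ltnW // (leq_trans jk) // ltnW.
Qed.

Lemma td_clt : exists C, forall n, expR 1 <= n%:R :> R -> forall h : 'cV[R]_d -> R, Lip1 h ->
  `|EP p mu n.+1 (fun x => h (Num.sqrt n%:R *: (td_average A b eps theta0 x n - thetas))) -
    (\int[Q]_w h (\sum_j Z w j 0 *: col j G))%R| <= C * rate delta n.
Proof.
have [C1 C10 H1] := td_error.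
have mm x i : \sum_y p x y * m x y i 0 = 0.
  transitivity ((\sum_y p x y *: m x y) i 0); last by rewrite noise_mart mxE.
  by rewrite summxE; apply: eq_bigr => y _; rewrite [RHS]mxE.
have [C2 C20 H2] := martingale_clt p_stochastic p_irreducible pi_invariant mu_ge0 mu_sum1
  mm noise_cov Z_gaussian.
exists (nm W * C1 + C2) => n hn h hL.
have n1' : 1 <= n%:R :> R by rewrite (le_trans _ hn) // ltW // expR_gt1.
have n0 : 0 < n%:R :> R by rewrite (lt_le_trans ltr01).
have n0N : (0 < n)%N by rewrite -(ltr0n R).
have h1 x y : `|h x - h y| <= n1 (x - y) by rewrite (le_trans (hL x y)) // enorm_le_n1.
pose a : R := (Num.sqrt n%:R)^-1.
have s0 : 0 < Num.sqrt n%:R :> R by rewrite sqrtr_gt0.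
have a0 : 0 <= a by rewrite invr_ge0 ltW.
have an : a * Num.sqrt n%:R = 1 by rewrite mulVf // gt_eqF.
pose sg : R := n%:R `^ (- (1 / 6)).
have sg0 : 0 < sg by rewrite powR_gt0.
have sg1 : sg <= 1 by rewrite -[leRHS](powRr0 n%:R) ler_powR //; lra.
have sga : sg ^+ 3 = a.
  rewrite /a -powR12_sqrt ?(ltW n0) // -powRN -powR_mulrn ?(ltW sg0) // -powRrM.
  by congr (_ `^ _); field.
have e2 := H2 n a sg h h1 a0 an sg0 sg1 sga.
have e2' : C2 * sg <= C2 * rate delta n.
  by rewrite ler_wpM2l // rate_ge_sixth.
have e1 : `|EP p mu n.+1 (fun x => h (Num.sqrt n%:R *: (td_average A b eps theta0 x n - thetas))) -
   EP p mu n.+1 (fun x => h (mart_sum m a n x))| <= nm W * C1 * rate delta n.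
  rewrite -EPB (le_trans (EP_abs p_stochastic mu_ge0 _ _)) //.
  apply: (@le_trans _ _ (EP p mu n.+1 (fun x => nm W * a * n1 (Zn n x)))).
    apply: (EP_le p_stochastic mu_ge0 n.+1) => x; rewrite (le_trans (h1 _ _)) //.
    rewrite td_average_decomposition // -/a addrK n1Z ger0_norm // mulrAC mulrC ler_wpM2r //.
    exact: n1_mulmx.
  rewrite EPZ -!mulrA ler_wpM2l ?nm_ge0 // mulrC; exact: H1.
rewrite mulrDl; move: (le_trans e2 e2') e1.
move: (EP _ _ _ _) (EP _ _ _ _) (Rintegral _ _ _) => x1 x2 x3.
by rewrite !ler_norml => /andP[? ?] /andP[? ?]; apply/andP; split; lra.
Qed.

End TDCLT.

Theorem theorem4 (R : realType) (S : finType) (d : nat)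
    (p : S -> S -> R) (pi : S -> R)
    (dO : measure_display) (Omega : measurableType dO)
    (Pr : probability Omega R) (X : nat -> Omega -> S)
    (A : S -> 'M[R]_d) (b : S -> 'cV[R]_d)
    (theta0 thetas : 'cV[R]_d) (delta : R) (V : S -> 'cV[R]_d)
    (dZ : measure_display) (OmegaZ : measurableType dZ)
    (Q : probability OmegaZ R) (Z : OmegaZ -> 'cV[R]_d)
    (p_stochastic : stochastic p)
    (p_irreducible : irreducible_chain p)
    (p_aperiodic : aperiodic_chain p)
    (pi_invariant : invariant_distribution p pi)
    (X_markov : markov_chain p Pr X)
    (A_hurwitz : hurwitz (- mean pi A))
    (delta_range : 2^-1 < delta < 1)
    (thetas_def : mean pi A *m thetas + mean pi b = 0)
    (V_poisson : poisson_solution p (td_noise pi A b thetas) V)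
    (Sigma_posdef : posdef (Sigma_infty pi p V))
    (Z_gaussian : std_gaussian Q Z) :
  let eps k : R := k.+1%:R `^ (- delta) in
  let Abar := mean pi A in
  let G := sqrtmx (invmx Abar *m Sigma_infty pi p V *m (invmx Abar)^T) in
  exists C : R, \forall n \near \oo,
    (wasserstein
       Pr (fun w => Num.sqrt n%:R *:
             (td_average A b eps theta0 (X^~ w) n - thetas))
       Q (fun w => G *m Z w)
     <= (C * Num.max (Num.sqrt (ln n%:R) / n%:R `^ (delta - 2^-1))
                     (1 / n%:R `^ ((1 - delta) / 2)))%:E)%E.
Proof.
move=> eps Abar G.
(* The law of X_0 serves as [mu]; the chain then enters through path expectations alone. *)
have [C HC] := td_clt theta0 p_stochastic p_irreducible pi_invariant
  (init_law_ge0 Pr X) (init_law_sum1 X_markov) A_hurwitz delta_range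
  thetas_def V_poisson Sigma_posdef Z_gaussian.
exists C; near=> n.
have hn : expR 1 <= n%:R :> R by near: n; exact: nbhs_infty_ger.
apply: ge_ereal_sup => _ /= [h hL <-].
have h1 x u : `|h (x + u) - h x| <= 1 * n1 u.
  by rewrite mul1r (le_trans (hL _ _)) // addrAC subrr add0r enorm_le_n1.
rewrite (expectation_path X_markov
  (@td_adapted_average _ _ _ A b theta0 thetas delta n h)).
have -> : h \o (fun w => G *m Z w) = fun w => h (\sum_j Z w j 0 *: col j G).
  by apply/funext => w /=; rewrite mulmx_cols.
rewrite (expectation_dominated Z_gaussian (gauss_lip_dominated _ Z_gaussian ler01 h1)).
rewrite -EFinB lee_fin; have := HC n hn h hL; rewrite ler_norml => /andP[_]; exact.
Unshelve. all: by end_near. Qed.
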